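(* Let $F:\overline{D}\to\mathbb{C}$ be continuous and assume that $\sup_{\partial D}|F|<1$. For $r\in(0,1]$ and $j\in\mathbb{Z}$ let $A_j(r)$ denote the $j$-th Fourier coefficient of $\theta\mapsto F(re^{i\theta})$. Assume that $A_j\equiv 0$ for all $j<0$. Let $\Omega_1\subset\mathbb{C}^2$ be an open neighbourhood of $\Gamma(F)\cup(\partial D\times D)$, and let $\Omega_2\subset\mathbb{C}^2$ be any connected open set satisfying $$\partial D\times D\ \subset\ \overline{\Omega_2}\ \subset\ \Omega_1\cap\big(\{z\in\mathbb{C}:|z|\ge 1\}\times D\big),$$ where $\overline{\Omega_2}$ denotes the closure relative to $\mathbb{C}\times D$ and $\Omega_2\subset\mathbb{C}\times D$. If $f$ is holomorphic on $\Omega_1$, then $f|_{\Omega_2}$ has a holomorphic extension to $D\times D$; that is, there exist an open set $W\supset(\overline{D}\times D)\cup\Omega_2$ and a holomorphic function $g$ on $W$ such that $g=f$ on $\Omega_2$.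
   Context: $D=\{z\in\mathbb{C}:|z|<1\}$ is the open unit disc, $\partial D$ is the unit circle and $\overline{D}$ is the closed unit disc. $\Gamma(F)=\{(z,F(z)):z\in\overline{D}\}\subset\mathbb{C}^2$ is the graph of $F$. The $j$-th Fourier coefficient is $A_j(r)=\frac{1}{2\pi}\int_0^{2\pi}F(re^{i\theta})e^{-ij\theta}\,d\theta$. *)

(* Defs.v *)
From Stdlib Require Import Reals ZArith.
From Coquelicot Require Import Coquelicot.

Open Scope R_scope.

Definition incl {T : Type} (A B : T -> Prop) : Prop := forall x, A x -> B x.

Definition union {T : Type} (A B : T -> Prop) : T -> Prop :=
  fun x => A x \/ B x.

Definition inter {T : Type} (A B : T -> Prop) : T -> Prop :=
  fun x => A x /\ B x.

Definition setprod {S T : Type} (A : S -> Prop) (B : T -> Prop) : S * T -> Prop :=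
  fun p => A (fst p) /\ B (snd p).

Definition closure {T : UniformSpace} (A : T -> Prop) : T -> Prop :=
  fun x => forall P : T -> Prop, locally x P -> exists y, A y /\ P y.

(* The empty set counts as connected. *)
Definition connected {T : UniformSpace} (A : T -> Prop) : Prop :=
  forall U V : T -> Prop, open U -> open V ->
    incl A (union U V) ->
    (exists x, A x /\ U x) -> (exists x, A x /\ V x) ->
    exists x, A x /\ U x /\ V x.

Definition unit_disc : C -> Prop := fun z => Cmod z < 1.
Definition unit_circle : C -> Prop := fun z => Cmod z = 1.
Definition closed_unit_disc : C -> Prop := fun z => Cmod z <= 1.
Definition exterior : C -> Prop := fun z => 1 <= Cmod z.
Definition Cfull : C -> Prop := fun _ => True.

Definition graph (F : C -> C) : C * C -> Prop :=
  fun p => closed_unit_disc (fst p) /\ snd p = F (fst p).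

Definition sup_mod (A : C -> Prop) (F : C -> C) : Rbar :=
  Lub_Rbar (fun x => exists z, A z /\ x = Cmod (F z)).

(* exp (i t) *)
Definition cis (t : R) : C := (cos t, sin t).

Definition fourier_coef (F : C -> C) (j : Z) (r : R) : C :=
  (RtoC (/ (2 * PI)) *
   RInt (V := C_R_CompleteNormedModule)
     (fun t : R => F (RtoC r * cis t) * cis (- (IZR j * t))) 0 (2 * PI))%C.

(* The scalar field is C, so the differential is C-linear. A function on Omega
   is represented by a total one, whose values outside Omega play no role when
   Omega is open. *)
Definition holomorphic_on (Omega : C * C -> Prop) (f : C * C -> C) : Prop :=
  forall p : C * C, Omega p ->
    ex_filterdiff (K := C_AbsRing)
      (U := prod_NormedModule C_AbsRing C_NormedModule C_NormedModule)
      (V := C_NormedModule) f (locally p).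

(* Main.v *)
Require Import Defs.
From Stdlib Require Import Reals ZArith Lra Lia Classical ClassicalEpsilon.
From Coquelicot Require Import Coquelicot.

(** Inside the bidisc the extension is the Cauchy integral of [f (., w)] over the unit
    circle; it agrees with [f] near the circle as soon as the moments
    [\int f (z, w) z^n dz], [n >= 0], vanish for every [|w| < 1].

    For [r] in [[0, 1]] the loop [z |-> (r z, F (r z))], [|z| = 1], lies in the graph of
    [F]; as its negative Fourier coefficients vanish, it is a uniform limit on the circle
    of entire curves [z |-> (p z, q z)].  Let [h] be holomorphic near the graph.  The
    integral [\int h (p z, q z) dz] vanishes for all entire curves close to the
    constant loop [r = 0], by Cauchy's theorem.  Joining two entire curves by a segment
    along which they stay in the domain of [h] gives an integral that is analytic in the
    segment parameter, so its vanishing propagates along the segment; hence it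
    propagates from [r = 0] to [r = 1] in steps whose length depends only on the width of
    the neighbourhood of the graph.  With [h (z, w) = f (z, w) z^n], a last segment from
    an entire curve close to [(z, F z)] to [(z, w)] stays in
    [unit_circle x unit_disc] because [|F| < 1] there, and yields the moments. *)

(** Since its negative coefficients vanish, [F (r z)] on the circle bounds a holomorphic disc, but
    inside the circle that disc may leave the graph, and with it the domain of [h]. Cauchy's theorem
    thus says nothing directly for [r > 0]: only the loop, not its filling, is known to lie where
    [h] is holomorphic. Filling is possible next to a constant loop; everything else is analytic
    continuation. As [F] is merely continuous, the integral need not be analytic in [r]; hence the
    detour through entire curves joined by straight segments, which depend affinely on a parameter
    that can be made complex. The factor [z ^ n] is holomorphic everywhere, so all moments are
    covered by one statement; their vanishing says that the Laurent series of [f (., w)] near the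
    circle has no negative powers. The complex analysis used on the way (Cauchy's formula, Taylor's
    estimate, the identity principle) rests on Goursat's lemma, carried from rectangles to annuli by
    the exponential. *)

Lemma Cmod_minus_sym (x y : C) : Cmod (x - y) = Cmod (y - x).
Proof. rewrite <- Cmod_opp. f_equal. ring. Qed.

Lemma Cmod_0_minus (x : C) : Cmod (x - x) = 0.
Proof. replace (x - x)%C with (RtoC 0) by ring. apply Cmod_0. Qed.

Lemma Cminus_0_r (x : C) : (x - 0)%C = x.
Proof. ring. Qed.

Lemma Cmod_minus_tri (y x z : C) : Cmod (x - z) <= Cmod (x - y) + Cmod (y - z).
Proof. replace (x - z)%C with ((x - y) + (y - z))%C by ring. apply Cmod_triangle. Qed.

Lemma Cmod_minus_le (x y : C) : Cmod (x - y) <= Cmod x + Cmod y.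
Proof. unfold Cminus. rewrite <- (Cmod_opp y). apply Cmod_triangle. Qed.

Lemma Cmod_rev_tri (x y : C) : Cmod x - Cmod y <= Cmod (x - y).
Proof.
  assert (H := Cmod_triangle (x - y) y).
  replace (x - y + y)%C with x in H by ring. lra.
Qed.

(** The sum is preferred to the Euclidean norm because estimates in it stay linear; [norm_CC]
    compares the two. *)
Definition dist (p q : C * C) : R := Cmod (fst p - fst q) + Cmod (snd p - snd q).

Lemma dist_ge_0 p q : 0 <= dist p q.
Proof. unfold dist. generalize (Cmod_ge_0 (fst p - fst q)) (Cmod_ge_0 (snd p - snd q)). lra. Qed.

Lemma dist_refl p : dist p p = 0.
Proof. unfold dist. rewrite !Cmod_0_minus. ring. Qed.

Lemma dist_0 p q : dist p q = 0 -> p = q.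
Proof.
  unfold dist. intros H.
  generalize (Cmod_ge_0 (fst p - fst q)) (Cmod_ge_0 (snd p - snd q)). intros H1 H2.
  destruct p as [a b], q as [c d]. simpl in *.
  assert (Ha : (a - c)%C = 0) by (apply Cmod_eq_0; lra).
  assert (Hb : (b - d)%C = 0) by (apply Cmod_eq_0; lra).
  apply Ceq_minus in Ha. apply Ceq_minus in Hb. now subst.
Qed.

(** * Neighbourhoods and complex differentiability in epsilon-delta form *)

Lemma ball_C_lt (x y : C) (e : R) : Cmod (y - x) < e -> ball (M := C_UniformSpace) x e y.
Proof. intros H. apply C_NormedModule_mixin_compat1. exact H. Qed.

Lemma ball_C_rev (x y : C) (e : posreal) : ball (M := C_UniformSpace) x e y -> Cmod (y - x) < 2 * e.
Proof.
  intros H. apply C_NormedModule_mixin_compat2 in H.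
  change (minus y x) with (y - x)%C in H.
  assert (sqrt 2 < 2).
  { assert (H1 : sqrt 2 * sqrt 2 = 2) by (apply sqrt_sqrt; lra). assert (H2 := sqrt_pos 2). nra. }
  eapply Rlt_trans. exact H. apply Rmult_lt_compat_r; auto. apply cond_pos.
Qed.

Lemma locally_C_eps (x : C) (P : C -> Prop) :
  locally (T := C_UniformSpace) x P <->
  exists d, 0 < d /\ forall y, Cmod (y - x) < d -> P y.
Proof.
  split.
  - intros [d H]. exists d. split. apply cond_pos. intros y Hy. apply H. now apply ball_C_lt.
  - intros [d [Hd H]]. assert (H2 : 0 < d / 2) by lra. exists (mkposreal _ H2). intros y Hy. apply H.
    apply ball_C_rev in Hy. simpl in Hy. lra.
Qed.

Lemma locally_CC_eps (x : C * C) (P : C * C -> Prop) :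
  locally (T := prod_UniformSpace C_UniformSpace C_UniformSpace) x P <->
  exists d, 0 < d /\ forall y, dist y x < d -> P y.
Proof.
  split.
  - intros [d H]. exists d. split. apply cond_pos. intros y Hy. apply H.
    unfold dist in Hy.
    generalize (Cmod_ge_0 (fst y - fst x)) (Cmod_ge_0 (snd y - snd x)); intros.
    split; apply ball_C_lt; eapply Rle_lt_trans with (2 := Hy).
    + rewrite <- (Rplus_0_r (Cmod _)) at 1. now apply Rplus_le_compat_l.
    + rewrite <- (Rplus_0_l (Cmod _)) at 1. now apply Rplus_le_compat_r.
  - intros [d [Hd H]]. assert (H2 : 0 < d / 4) by lra. exists (mkposreal _ H2).
    intros y [Hy1 Hy2]. apply H.
    apply ball_C_rev in Hy1. apply ball_C_rev in Hy2. simpl in Hy1, Hy2. unfold dist. lra.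
Qed.

Lemma locally_R_eps (x : R) (P : R -> Prop) :
  locally x P <-> exists d, 0 < d /\ forall y, Rabs (y - x) < d -> P y.
Proof.
  split.
  - intros [d H]. exists d. split. apply cond_pos. exact H.
  - intros [d [Hd H]]. exists (mkposreal _ Hd). exact H.
Qed.

Lemma continuous_C_eps {T : UniformSpace} (f : T -> C) (x : T) :
  continuous (U := C_UniformSpace) f x <->
  forall e, 0 < e -> locally x (fun y => Cmod (f y - f x) < e).
Proof.
  split.
  - intros H e He. apply (H (fun y => Cmod (y - f x) < e)).
    apply locally_C_eps. now exists e.
  - intros H P HP. apply locally_C_eps in HP. destruct HP as [d [Hd HP]].
    unfold filtermap. generalize (H d Hd). apply filter_imp. intros y Hy. now apply HP.
Qed.

(* [ex_filterdiff] over [C_AbsRing] in epsilon-delta form, see [hol2_ex_filterdiff]. *)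
Definition hol2 (f : C * C -> C) (p : C * C) : Prop :=
  exists a b : C, forall e, 0 < e -> exists d, 0 < d /\ forall x, dist x p < d ->
    Cmod (f x - f p - (a * (fst x - fst p) + b * (snd x - snd p))) <= e * dist x p.

(* One variable is treated as two with a dummy second one, so that the calculus is done once. *)
Definition hol1 (f : C -> C) (z : C) : Prop := hol2 (fun x => f (fst x)) (z, RtoC 0).

Lemma norm_CC (x : C * C) :
  norm (V := prod_NormedModule C_AbsRing C_NormedModule C_NormedModule) x <= dist x (RtoC 0, RtoC 0) /\
  dist x (RtoC 0, RtoC 0) <= 2 * norm (V := prod_NormedModule C_AbsRing C_NormedModule C_NormedModule) x.
Proof.
  unfold dist. simpl.
  rewrite !Cminus_0_r.
  change (norm (V := prod_NormedModule C_AbsRing C_NormedModule C_NormedModule) x)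
    with (sqrt (Cmod (fst x) ^ 2 + Cmod (snd x) ^ 2)).
  assert (H1 := Cmod_ge_0 (fst x)). assert (H2 := Cmod_ge_0 (snd x)).
  split.
  - rewrite <- (sqrt_Rsqr (Cmod (fst x) + Cmod (snd x))) by lra.
    apply sqrt_le_1; unfold Rsqr; nra.
  - assert (Cmod (fst x) <= sqrt (Cmod (fst x) ^ 2 + Cmod (snd x) ^ 2)).
    { rewrite <- (sqrt_Rsqr (Cmod (fst x))) at 1 by lra. apply sqrt_le_1; unfold Rsqr; nra. }
    assert (Cmod (snd x) <= sqrt (Cmod (fst x) ^ 2 + Cmod (snd x) ^ 2)).
    { rewrite <- (sqrt_Rsqr (Cmod (snd x))) at 1 by lra. apply sqrt_le_1; unfold Rsqr; nra. }
    lra.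
Qed.

Lemma dist_minus (x p : C * C) :
  dist (minus (G := prod_NormedModule C_AbsRing C_NormedModule C_NormedModule) x p) (RtoC 0, RtoC 0) = dist x p.
Proof.
  unfold dist. simpl. f_equal; f_equal; unfold plus, opp; simpl; ring.
Qed.

(* Coquelicot's algebraic structures on [C] hide the carrier from [ring]. *)
Ltac cring := match goal with |- @eq _ ?a ?b => change (@eq C a b) end;
  repeat match goal with
  | |- context [@plus ?G ?u ?v] => change (@plus G u v) with (Cplus u v)
  | |- context [@opp ?G ?u] => change (@opp G u) with (Copp u)
  | |- context [@mult ?G ?u ?v] => change (@mult G u v) with (Cmult u v)
  | |- context [@scal ?K ?G ?u ?v] => change (@scal K G u v) with (Cmult u v)
  end; ring.

Lemma hol2_ex_filterdiff (f : C * C -> C) (p : C * C) :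
  hol2 f p <->
  ex_filterdiff (K := C_AbsRing)
      (U := prod_NormedModule C_AbsRing C_NormedModule C_NormedModule)
      (V := C_NormedModule) f (locally p).
Proof.
  split.
  - intros [a [b H]].
    exists (fun v : C * C => (a * fst v + b * snd v)%C). split.
    + split.
      * intros x y. unfold plus; simpl. unfold plus; simpl. cring.
      * intros k x. unfold scal; simpl. unfold scal; simpl. unfold mult; simpl. cring.
      * exists (2 * (Cmod a + Cmod b + 1)).
        assert (Ha := Cmod_ge_0 a). assert (Hb := Cmod_ge_0 b).
        split. lra.
        intros x. destruct (norm_CC x) as [_ Hn].
        unfold dist in Hn; simpl in Hn.
        rewrite !Cminus_0_r in Hn.
        change (norm (K := C_AbsRing) (V := C_NormedModule) (a * fst x + b * snd x)%C)
          with (Cmod (a * fst x + b * snd x)%C).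
        eapply Rle_trans. apply Cmod_triangle. rewrite !Cmod_mult.
        assert (H1 := Cmod_ge_0 (fst x)). assert (H2 := Cmod_ge_0 (snd x)).
        set (n := norm _) in *. set (u := Cmod (fst x)) in *. set (v := Cmod (snd x)) in *.
        apply Rle_trans with ((Cmod a + Cmod b + 1) * (u + v)). nra.
        apply Rle_trans with ((Cmod a + Cmod b + 1) * (2 * n)).
        apply Rmult_le_compat_l. lra. exact Hn. right. ring.
    + intros q Hq. assert (q = p).
      { apply (is_filter_lim_locally_unique (V := prod_NormedModule C_AbsRing C_NormedModule C_NormedModule)) in Hq. now symmetry. }
      subst q. intros e.
      assert (He : 0 < e / 2) by (generalize (cond_pos e); lra).
      destruct (H _ He) as [d [Hd H1]].
      apply locally_CC_eps. exists d. split; auto. intros y Hy.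
      specialize (H1 y Hy).
      destruct (norm_CC (minus (G := prod_NormedModule C_AbsRing C_NormedModule C_NormedModule) y p)) as [_ Hn].
      rewrite dist_minus in Hn.
      match goal with |- norm ?X <= _ => change (norm X) with (Cmod X) end.
      eapply Rle_trans; [ | eapply Rle_trans; [apply H1 | ] ].
      * right. f_equal.
      * set (n := norm _) in *. generalize (cond_pos e). nra.
  - intros [l [[Hp Hs _] Hl]].
    exists (l (RtoC 1, RtoC 0)), (l (RtoC 0, RtoC 1)). intros e He.
    specialize (Hl p (fun P HP => HP) (mkposreal _ He)).
    apply locally_CC_eps in Hl. destruct Hl as [d [Hd Hl]].
    exists d. split; auto. intros x Hx. specialize (Hl x Hx).
    destruct (norm_CC (minus (G := prod_NormedModule C_AbsRing C_NormedModule C_NormedModule) x p)) as [Hn _].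
    rewrite dist_minus in Hn.
    eapply Rle_trans; [ | eapply Rle_trans; [apply Hl | ] ].
    + right. match goal with |- _ = norm ?X => change (norm X) with (Cmod X) end.
      f_equal. unfold minus at 1 2.
      match goal with |- _ = plus (plus ?u (opp ?v)) (opp ?w) =>
        change (plus (plus u (opp v)) (opp w)) with (u - v - w)%C end.
      f_equal.
      set (v := minus x p).
      assert (Hv : v = plus (G := prod_NormedModule C_AbsRing C_NormedModule C_NormedModule)
        (scal (V := prod_NormedModule C_AbsRing C_NormedModule C_NormedModule) (fst x - fst p)%C (RtoC 1, RtoC 0))
        (scal (V := prod_NormedModule C_AbsRing C_NormedModule C_NormedModule) (snd x - snd p)%C (RtoC 0, RtoC 1))).
      { apply injective_projections.
        - change ((fst x - fst p)%C = ((fst x - fst p) * 1 + (snd x - snd p) * 0)%C). ring.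
        - change ((snd x - snd p)%C = ((fst x - fst p) * 0 + (snd x - snd p) * 1)%C). ring. }
      transitivity (l v); [ | reflexivity].
      rewrite Hv. rewrite Hp, !Hs. cring.
    + simpl. set (n := norm _) in *. nra.
Qed.

(** * Complex differentiability, continuity and compactness *)

Lemma hol2_lipschitz (f : C * C -> C) (p : C * C) : hol2 f p ->
  exists L d, 0 < L /\ 0 < d /\ forall x, dist x p < d -> Cmod (f x - f p) <= L * dist x p.
Proof.
  intros [a [b H]]. destruct (H 1 Rlt_0_1) as [d [Hd H1]].
  assert (Ha := Cmod_ge_0 a). assert (Hb := Cmod_ge_0 b).
  exists (1 + Cmod a + Cmod b), d. split. lra. split; auto. intros x Hx.
  specialize (H1 x Hx).
  set (l := (a * (fst x - fst p) + b * (snd x - snd p))%C) in *.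
  replace (f x - f p)%C with ((f x - f p - l) + l)%C by ring.
  eapply Rle_trans. apply Cmod_triangle.
  assert (Cmod l <= (Cmod a + Cmod b) * dist x p).
  { unfold l, dist. eapply Rle_trans. apply Cmod_triangle. rewrite !Cmod_mult.
    generalize (Cmod_ge_0 (fst x - fst p)) (Cmod_ge_0 (snd x - snd p)). intros; nra. }
  lra.
Qed.

Lemma hol2_cont (f : C * C -> C) (p : C * C) : hol2 f p ->
  forall e, 0 < e -> exists d, 0 < d /\ forall x, dist x p < d -> Cmod (f x - f p) < e.
Proof.
  intros H e He. destruct (hol2_lipschitz f p H) as [L [d [HL [Hd H1]]]].
  exists (Rmin d (e / L)). split.
  - apply Rmin_glb_lt; auto. now apply Rdiv_lt_0_compat.
  - intros x Hx. assert (Hx1 := Rlt_le_trans _ _ _ Hx (Rmin_l _ _)).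
    assert (Hx2 := Rlt_le_trans _ _ _ Hx (Rmin_r _ _)).
    eapply Rle_lt_trans. now apply H1.
    replace e with (L * (e / L)) by (field; lra). now apply Rmult_lt_compat_l.
Qed.

Lemma hol2_ext (f g : C * C -> C) (p : C * C) (d : R) : 0 < d ->
  (forall x, dist x p < d -> f x = g x) -> hol2 f p -> hol2 g p.
Proof.
  intros Hd E [a [b H]]. exists a, b. intros e He. destruct (H e He) as [d' [Hd' H1]].
  exists (Rmin d d'). split. now apply Rmin_glb_lt. intros x Hx.
  assert (Hx1 := Rlt_le_trans _ _ _ Hx (Rmin_l _ _)).
  assert (Hx2 := Rlt_le_trans _ _ _ Hx (Rmin_r _ _)).
  rewrite <- !E; auto. now rewrite dist_refl.
Qed.

Lemma hol2_const (c : C) p : hol2 (fun _ => c) p.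
Proof.
  exists (RtoC 0), (RtoC 0). intros e He. exists 1. split. lra. intros x _.
  replace (_ - _)%C with (RtoC 0) by ring. rewrite Cmod_0.
  apply Rmult_le_pos. lra. apply dist_ge_0.
Qed.

Lemma hol2_fst p : hol2 fst p.
Proof.
  exists (RtoC 1), (RtoC 0). intros e He. exists 1. split. lra. intros x _.
  replace (_ - _)%C with (RtoC 0) by ring. rewrite Cmod_0.
  apply Rmult_le_pos. lra. apply dist_ge_0.
Qed.

Lemma hol2_snd p : hol2 snd p.
Proof.
  exists (RtoC 0), (RtoC 1). intros e He. exists 1. split. lra. intros x _.
  replace (_ - _)%C with (RtoC 0) by ring. rewrite Cmod_0.
  apply Rmult_le_pos. lra. apply dist_ge_0.
Qed.

(** The one place where error terms are composed: sums, products and inverses are the cases where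
    [F] is addition, multiplication or inversion. *)
Lemma hol2_comp (F : C * C -> C) (g1 g2 : C * C -> C) p :
  hol2 F (g1 p, g2 p) -> hol2 g1 p -> hol2 g2 p -> hol2 (fun x => F (g1 x, g2 x)) p.
Proof.
  intros [A [B HF]] H1 H2.
  destruct (hol2_lipschitz _ _ H1) as [L1 [d1 [HL1 [Hd1 K1]]]].
  destruct (hol2_lipschitz _ _ H2) as [L2 [d2 [HL2 [Hd2 K2]]]].
  destruct H1 as [a1 [b1 H1]]. destruct H2 as [a2 [b2 H2]].
  assert (HA := Cmod_ge_0 A). assert (HB := Cmod_ge_0 B).
  exists (A * a1 + B * a2)%C, (A * b1 + B * b2)%C. intros e He.
  (* Half of [e] pays for the remainder of [F], taken at a point displaced by at most
     [(L1 + L2) * n]; the other half pays for the remainders of [g1] and [g2], which get multiplied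
     by the partial derivatives [A] and [B]. *)
  set (e1 := e / (L1 + L2) / 2).
  assert (He1 : 0 < e1) by (unfold e1; repeat apply Rdiv_lt_0_compat; lra).
  set (e2 := e / (Cmod A + Cmod B + 1) / 2).
  assert (He2 : 0 < e2) by (unfold e2; repeat apply Rdiv_lt_0_compat; lra).
  destruct (HF e1 He1) as [d3 [Hd3 K3]].
  destruct (H1 e2 He2) as [d4 [Hd4 K4]]. destruct (H2 e2 He2) as [d5 [Hd5 K5]].
  set (d6 := d3 / (L1 + L2)).
  assert (Hd6 : 0 < d6) by (unfold d6; apply Rdiv_lt_0_compat; lra).
  exists (Rmin (Rmin (Rmin d1 d2) (Rmin d4 d5)) d6). split.
  { repeat apply Rmin_glb_lt; auto. }
  intros x Hx.
  assert (X1 := Rlt_le_trans _ _ _ Hx (Rmin_l _ _)). assert (X6 := Rlt_le_trans _ _ _ Hx (Rmin_r _ _)).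
  assert (X12 := Rlt_le_trans _ _ _ X1 (Rmin_l _ _)). assert (X45 := Rlt_le_trans _ _ _ X1 (Rmin_r _ _)).
  specialize (K1 x (Rlt_le_trans _ _ _ X12 (Rmin_l _ _))). specialize (K2 x (Rlt_le_trans _ _ _ X12 (Rmin_r _ _))).
  specialize (K4 x (Rlt_le_trans _ _ _ X45 (Rmin_l _ _))). specialize (K5 x (Rlt_le_trans _ _ _ X45 (Rmin_r _ _))).
  specialize (K3 (g1 x, g2 x)). unfold dist at 1 2 in K3. simpl in K3.
  set (n := dist x p) in *. assert (Hn : 0 <= n) by apply dist_ge_0.
  assert (Hn6 : (L1 + L2) * n < d3).
  { replace d3 with ((L1 + L2) * d6) by (unfold d6; field; lra). apply Rmult_lt_compat_l; lra. }
  assert (K3' := K3 ltac:(lra)). clear K3.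
  set (r3 := (F (g1 x, g2 x) - F (g1 p, g2 p) - _)%C) in K3'.
  set (r4 := (g1 x - g1 p - _)%C) in K4. set (r5 := (g2 x - g2 p - _)%C) in K5.
  replace (_ - _ - _)%C with (r3 + (A * r4 + B * r5))%C by (unfold r3, r4, r5; ring).
  eapply Rle_trans. apply Cmod_triangle.
  assert (Cmod (A * r4 + B * r5) <= e / 2 * n).
  { eapply Rle_trans. apply Cmod_triangle. rewrite !Cmod_mult.
    apply Rle_trans with ((Cmod A + Cmod B) * (e2 * n)).
    rewrite Rmult_plus_distr_r. apply Rplus_le_compat; now apply Rmult_le_compat_l.
    replace (e / 2) with ((Cmod A + Cmod B + 1) * e2) by (unfold e2; field; lra).
    assert (0 <= e2 * n) by (apply Rmult_le_pos; lra). nra. }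
  assert (Cmod r3 <= e / 2 * n).
  { eapply Rle_trans. exact K3'. replace (e / 2) with (e1 * (L1 + L2)) by (unfold e1; field; lra).
    rewrite Rmult_assoc. apply Rmult_le_compat_l; lra. }
  lra.
Qed.

Lemma hol2_add_aux p : hol2 (fun x => fst x + snd x)%C p.
Proof.
  exists (RtoC 1), (RtoC 1). intros e He. exists 1. split. lra. intros x _.
  replace (_ - _)%C with (RtoC 0) by ring. rewrite Cmod_0.
  apply Rmult_le_pos. lra. apply dist_ge_0.
Qed.

Lemma hol2_mul_aux p : hol2 (fun x => fst x * snd x)%C p.
Proof.
  exists (snd p), (fst p). intros e He. exists e. split. lra. intros x Hx.
  replace (_ - _)%C with ((fst x - fst p) * (snd x - snd p))%C by ring.
  rewrite Cmod_mult. apply Rle_trans with (dist x p * dist x p).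
  - unfold dist. generalize (Cmod_ge_0 (fst x - fst p)) (Cmod_ge_0 (snd x - snd p)). intros; nra.
  - apply Rmult_le_compat_r. apply dist_ge_0. lra.
Qed.

Lemma hol2_inv_aux p : fst p <> RtoC 0 -> hol2 (fun x => / fst x)%C p.
Proof.
  intros Hp. set (q := fst p) in *.
  assert (Hq : 0 < Cmod q) by now apply Cmod_gt_0.
  exists (- / (q * q))%C, (RtoC 0). intros e He.
  set (d := e * (Cmod q * Cmod q * Cmod q) / 2).
  assert (Hd : 0 < d) by (unfold d; apply Rdiv_lt_0_compat; [ repeat apply Rmult_lt_0_compat | ]; lra).
  exists (Rmin (Cmod q / 2) d). split. apply Rmin_glb_lt; lra. intros x Hx.
  assert (X1 := Rlt_le_trans _ _ _ Hx (Rmin_l _ _)). assert (X2 := Rlt_le_trans _ _ _ Hx (Rmin_r _ _)).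
  assert (Hz : Cmod (fst x - q) <= dist x p).
  { unfold dist. fold q. generalize (Cmod_ge_0 (snd x - snd p)). lra. }
  set (z := fst x) in *.
  assert (Hzq : Cmod q / 2 < Cmod z).
  { generalize (Cmod_rev_tri q z). rewrite Cmod_minus_sym. lra. }
  assert (Hz0 : z <> RtoC 0) by (apply Cmod_gt_0; lra).
  fold q. replace (_ - _)%C with ((z - q) * (z - q) * / (z * (q * q)))%C by (field; auto).
  rewrite !Cmod_mult, Cmod_inv, !Cmod_mult. 2: repeat apply Cmult_neq_0; auto.
  set (m := Cmod (z - q)) in *. assert (Hm : 0 <= m) by apply Cmod_ge_0.
  apply Rle_trans with (m * dist x p * / (Cmod q / 2 * (Cmod q * Cmod q))).
  - apply Rmult_le_compat.
    + now apply Rmult_le_pos.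
    + left. apply Rinv_0_lt_compat. repeat apply Rmult_lt_0_compat; lra.
    + apply Rmult_le_compat_l; lra.
    + apply Rinv_le_contravar. repeat apply Rmult_lt_0_compat; lra.
      apply Rmult_le_compat_r. apply Rmult_le_pos; lra. lra.
  - apply Rle_trans with (d * dist x p * / (Cmod q / 2 * (Cmod q * Cmod q))).
    + apply Rmult_le_compat_r. left. apply Rinv_0_lt_compat. repeat apply Rmult_lt_0_compat; lra.
      apply Rmult_le_compat_r. apply dist_ge_0. lra.
    + right. unfold d. field. lra.
Qed.

Lemma hol2_plus f g p : hol2 f p -> hol2 g p -> hol2 (fun x => f x + g x)%C p.
Proof. intros. apply (hol2_comp (fun x => fst x + snd x)%C); auto. apply hol2_add_aux. Qed.

Lemma hol2_mult f g p : hol2 f p -> hol2 g p -> hol2 (fun x => f x * g x)%C p.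
Proof. intros. apply (hol2_comp (fun x => fst x * snd x)%C); auto. apply hol2_mul_aux. Qed.

Lemma hol2_inv f p : f p <> RtoC 0 -> hol2 f p -> hol2 (fun x => / f x)%C p.
Proof. intros H0 H. apply (hol2_comp (fun x => / fst x)%C f f); auto. now apply hol2_inv_aux. Qed.

Lemma hol2_minus f g p : hol2 f p -> hol2 g p -> hol2 (fun x => f x - g x)%C p.
Proof.
  intros Hf Hg. apply (hol2_ext (fun x => f x + RtoC (-1) * g x)%C _ p 1). lra.
  intros x _. ring. apply hol2_plus; auto. apply hol2_mult; auto. apply hol2_const.
Qed.

Lemma hol2_div f g p : g p <> RtoC 0 -> hol2 f p -> hol2 g p -> hol2 (fun x => f x / g x)%C p.
Proof. intros. unfold Cdiv. apply hol2_mult; auto. now apply hol2_inv. Qed.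

Lemma hol2_pow f n p : hol2 f p -> hol2 (fun x => Cpow (f x) n) p.
Proof.
  intros H. induction n as [|n IH]; simpl. apply hol2_const. now apply hol2_mult.
Qed.

Lemma hol2_hol1 (F : C -> C) g p : hol1 F (g p) -> hol2 g p -> hol2 (fun x => F (g x)) p.
Proof. intros HF Hg. apply (hol2_comp (fun x => F (fst x)) g (fun _ => RtoC 0) p); auto. apply hol2_const. Qed.

Lemma hol1_id z : hol1 (fun z => z) z.
Proof. apply hol2_fst. Qed.

Lemma hol1_hol2 F g1 g2 z : hol2 F (g1 z, g2 z) -> hol1 g1 z -> hol1 g2 z ->
  hol1 (fun z => F (g1 z, g2 z)) z.
Proof. intros H H1 H2. apply (hol2_comp F (fun x => g1 (fst x)) (fun x => g2 (fst x)) (z, RtoC 0)); auto. Qed.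

Lemma hol1_spec f z : hol1 f z ->
  exists a : C, forall e, 0 < e -> exists d, 0 < d /\ forall y, Cmod (y - z) < d ->
    Cmod (f y - f z - a * (y - z)) <= e * Cmod (y - z).
Proof.
  intros [a [b H]]. exists a. intros e He. destruct (H e He) as [d [Hd H1]].
  exists d. split; auto. intros y Hy. specialize (H1 (y, RtoC 0)).
  unfold dist in H1. simpl in H1. rewrite Cmod_0_minus, Rplus_0_r in H1. specialize (H1 Hy).
  replace (f y - f z - a * (y - z))%C with (f y - f z - (a * (y - z) + b * (0 - 0)))%C by ring.
  exact H1.
Qed.

(** * Continuity of complex-valued maps *)

Notation cts := (continuous (U := C_UniformSpace)).

(** Through this lemma the rules for [hol2] also yield the continuity of sums, products and
    quotients on any uniform space. *)
Lemma cts_hol2 {T : UniformSpace} F (u v : T -> C) x :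
  hol2 F (u x, v x) -> cts u x -> cts v x -> cts (fun t => F (u t, v t)) x.
Proof.
  intros HF Hu Hv. apply continuous_C_eps. intros e He.
  destruct (hol2_cont _ _ HF e He) as [d [Hd H]].
  assert (Hd2 : 0 < d / 2) by lra.
  generalize (proj1 (continuous_C_eps u x) Hu _ Hd2) (proj1 (continuous_C_eps v x) Hv _ Hd2).
  intros H1 H2. generalize (filter_and _ _ H1 H2). apply filter_imp. intros y [Y1 Y2].
  apply H. unfold dist. simpl. lra.
Qed.

Lemma cts_hol1 {T : UniformSpace} F (u : T -> C) x : hol1 F (u x) -> cts u x -> cts (fun t => F (u t)) x.
Proof.
  intros HF Hu. apply (cts_hol2 (fun y => F (fst y)) u (fun _ => RtoC 0)); auto. apply continuous_const.
Qed.

Lemma cts_plus {T : UniformSpace} (u v : T -> C) x : cts u x -> cts v x -> cts (fun t => u t + v t)%C x.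
Proof. intros. apply (cts_hol2 (fun y => fst y + snd y)%C u v); auto. apply hol2_add_aux. Qed.

Lemma cts_mult {T : UniformSpace} (u v : T -> C) x : cts u x -> cts v x -> cts (fun t => u t * v t)%C x.
Proof. intros. apply (cts_hol2 (fun y => fst y * snd y)%C u v); auto. apply hol2_mul_aux. Qed.

Lemma cts_inv {T : UniformSpace} (u : T -> C) x : u x <> RtoC 0 -> cts u x -> cts (fun t => / u t)%C x.
Proof. intros. apply (cts_hol2 (fun y => / fst y)%C u u); auto. now apply hol2_inv_aux. Qed.

Lemma cts_minus {T : UniformSpace} (u v : T -> C) x : cts u x -> cts v x -> cts (fun t => u t - v t)%C x.
Proof.
  intros. apply (cts_hol2 (fun y => fst y - snd y)%C u v); auto.
  apply hol2_minus. apply hol2_fst. apply hol2_snd.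
Qed.

Lemma cts_div {T : UniformSpace} (u v : T -> C) x : v x <> RtoC 0 -> cts u x -> cts v x -> cts (fun t => u t / v t)%C x.
Proof. intros. unfold Cdiv. apply cts_mult; auto. now apply cts_inv. Qed.

Lemma cts_pow {T : UniformSpace} (u : T -> C) n x : cts u x -> cts (fun t => Cpow (u t) n) x.
Proof. intros H. apply (cts_hol1 (fun z => Cpow z n)); auto. apply hol2_pow, hol2_fst. Qed.

Lemma hol1_cts f z : hol1 f z -> cts f z.
Proof. intros H. apply (cts_hol1 f (fun z => z)); auto. apply continuous_id. Qed.

Lemma cts_pair {T : UniformSpace} (a b : T -> R) x :
  continuous a x -> continuous b x -> cts (fun t => (a t, b t) : C) x.
Proof.
  intros Ha Hb. apply continuous_C_eps. intros e He.
  assert (He2 : 0 < e / 2) by lra.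
  assert (H1 := Ha _ (locally_ball (a x) (mkposreal _ He2))).
  assert (H2 := Hb _ (locally_ball (b x) (mkposreal _ He2))).
  unfold filtermap in H1, H2. generalize (filter_and _ _ H1 H2). apply filter_imp. intros y [Y1 Y2].
  change (Rabs (a y - a x) < e / 2) in Y1. change (Rabs (b y - b x) < e / 2) in Y2.
  replace ((a y, b y) - (a x, b x))%C with (RtoC (a y - a x) + RtoC (b y - b x) * Ci)%C.
  eapply Rle_lt_trans. apply Cmod_triangle. rewrite Cmod_mult, Cmod_Ci, !Cmod_R. lra.
  apply injective_projections; simpl; ring.
Qed.

Lemma cts_RtoC {T : UniformSpace} (a : T -> R) x : continuous a x -> cts (fun t => RtoC (a t)) x.
Proof. intros H. apply (cts_pair a (fun _ => 0)); auto. apply continuous_const. Qed.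

Lemma cts_cis t : cts cis t.
Proof.
  apply (cts_pair cos sin); apply continuity_pt_filterlim; apply derivable_continuous_pt.
  apply derivable_pt_cos. apply derivable_pt_sin.
Qed.

(** * Parametrisation of the unit circle *)

Lemma cis_0 : cis 0 = RtoC 1.
Proof. unfold cis. rewrite cos_0, sin_0. reflexivity. Qed.

Lemma cis_add a b : cis (a + b) = (cis a * cis b)%C.
Proof. unfold cis. rewrite cos_plus, sin_plus. apply injective_projections; simpl; ring. Qed.

Lemma cis_2PI : cis (2 * PI) = RtoC 1.
Proof. unfold cis. rewrite cos_2PI, sin_2PI. reflexivity. Qed.

Lemma Cmod_cis t : Cmod (cis t) = 1.
Proof.
  unfold Cmod, cis. simpl. replace (_ + _) with 1. apply sqrt_1.
  generalize (sin2_cos2 t). unfold Rsqr. lra.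
Qed.

Lemma cis_nz t : cis t <> RtoC 0.
Proof. apply Cmod_gt_0. rewrite Cmod_cis. lra. Qed.

Lemma cis_opp t : cis (- t) = (/ cis t)%C.
Proof.
  assert (H := cis_nz t).
  assert (H1 : (cis (- t) * cis t = 1)%C).
  { rewrite <- cis_add. replace (- t + t) with 0 by ring. apply cis_0. }
  replace (cis (- t)) with (cis (- t) * cis t * / cis t)%C by (field; auto).
  rewrite H1. ring.
Qed.

Lemma circle_cis (z : C) : Cmod z = 1 -> exists t, z = cis t.
Proof.
  intros H. assert (H2 := Cmod2_alt z). rewrite H in H2. destruct z as [x y]. unfold Re, Im in H2. simpl in H2.
  assert (Hx : -1 <= x <= 1) by nra.
  destruct (Rle_dec 0 y) as [Hy|Hy].
  - exists (acos x). unfold cis. rewrite cos_acos, sin_acos by lra. f_equal.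
    rewrite <- (sqrt_Rsqr y) by lra. f_equal. unfold Rsqr. lra.
  - exists (- acos x). unfold cis. rewrite cos_neg, sin_neg, cos_acos, sin_acos by lra. f_equal.
    replace y with (- - y) by ring. f_equal.
    rewrite <- (sqrt_Rsqr (- y)) by lra. f_equal. unfold Rsqr. lra.
Qed.

(* Lebesgue-number form of compactness: [P z d] reads "the estimate holds at [z] with radius [d]". *)
Lemma compact_unif (K : C -> Prop) (P : C -> R -> Prop) :
  (forall z, K z -> Cmod z <= 1) ->
  (forall z, ~ K z -> exists d, 0 < d /\ forall y, Cmod (y - z) < d -> ~ K y) ->
  (forall z d d', 0 < d' <= d -> P z d -> P z d') ->
  (forall z, K z -> exists d, 0 < d /\ forall y, K y -> Cmod (y - z) < d -> P y d) ->
  exists d, 0 < d /\ forall z, K z -> P z d.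
Proof.
  intros K1 K2 Pm HP.
  (* The covering lemma wants a radius at every point of the square; off [K], a ball that misses [K]
     will do. The factor 2 appears because a square of half-side [d] lies in the disc of radius
     [2 * d]. *)
  assert (H : forall z : C, exists d : posreal, forall y, K y -> Cmod (y - z) < 2 * d -> P y d).
  { intros z. destruct (classic (K z)) as [Hz|Hz].
    - destruct (HP z Hz) as [d [Hd H]]. assert (Hd2 : 0 < d / 2) by lra.
      exists (mkposreal _ Hd2). simpl. intros y Hy Hyz. apply Pm with d. lra. apply H; auto. lra.
    - destruct (K2 z Hz) as [d [Hd H]]. assert (Hd2 : 0 < d / 2) by lra.
      exists (mkposreal _ Hd2). simpl. intros y Hy Hyz. exfalso. apply (H y); auto. lra. }
  destruct (compactness_value_2d (-1) 1 (-1) 1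
    (fun x y => proj1_sig (constructive_indefinite_description _ (H (x, y))))) as [d Hd].
  exists d. split. apply cond_pos. intros z Hz.
  assert (B := Rmax_Cmod z). assert (B1 := Rmax_l (Rabs (fst z)) (Rabs (snd z))).
  assert (B2 := Rmax_r (Rabs (fst z)) (Rabs (snd z))). assert (K1z := K1 z Hz).
  assert (R1 : -1 <= fst z <= 1) by (apply Rabs_le_between; lra).
  assert (R2 : -1 <= snd z <= 1) by (apply Rabs_le_between; lra).
  apply NNPP. intros Hn. apply (Hd _ _ R1 R2). intros [u [v [_ [_ [Hu [Hv Hdd]]]]]]. apply Hn.
  destruct (constructive_indefinite_description _ (H (u, v))) as [d' Hd']. simpl in *.
  apply Pm with d'. split. apply cond_pos. exact Hdd. apply Hd'; auto.
  replace (z - (u, v))%C with (RtoC (fst z - u) + RtoC (snd z - v) * Ci)%C.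
  eapply Rle_lt_trans. apply Cmod_triangle. rewrite Cmod_mult, Cmod_Ci, !Cmod_R. lra.
  apply injective_projections; simpl; ring.
Qed.

Lemma circle_unif (P : C -> R -> Prop) :
  (forall z d d', 0 < d' <= d -> P z d -> P z d') ->
  (forall z, Cmod z = 1 -> exists d, 0 < d /\ forall y, Cmod y = 1 -> Cmod (y - z) < d -> P y d) ->
  exists d, 0 < d /\ forall z, Cmod z = 1 -> P z d.
Proof.
  apply compact_unif. intros; lra.
  intros z Hz. exists (Rabs (Cmod z - 1)). split. apply Rabs_pos_lt. lra.
  intros y Hy Hy1. revert Hy. generalize (Cmod_rev_tri y z) (Cmod_rev_tri z y).
  rewrite (Cmod_minus_sym z y). unfold Rabs. destruct Rcase_abs; lra.
Qed.

Lemma disc_unif (P : C -> R -> Prop) :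
  (forall z d d', 0 < d' <= d -> P z d -> P z d') ->
  (forall z, Cmod z <= 1 -> exists d, 0 < d /\ forall y, Cmod y <= 1 -> Cmod (y - z) < d -> P y d) ->
  exists d, 0 < d /\ forall z, Cmod z <= 1 -> P z d.
Proof.
  apply compact_unif. intros; lra.
  intros z Hz. exists (Cmod z - 1). split. lra.
  intros y Hy. generalize (Cmod_rev_tri z y). rewrite (Cmod_minus_sym z y). lra.
Qed.

(** * Goursat's lemma on rectangles *)

Definition CI (u : R -> C) (a b : R) : C := RInt (V := C_R_CompleteNormedModule) u a b.

Definition cts_on (u : R -> C) (a b : R) : Prop := forall t, a <= t <= b -> cts u t.

Lemma CI_correct u a b : a <= b -> cts_on u a b ->
  is_RInt (V := C_R_NormedModule) u a b (CI u a b).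
Proof.
  intros Hab H. apply (RInt_correct (V := C_R_CompleteNormedModule)).
  apply (ex_RInt_continuous (V := C_R_CompleteNormedModule)). intros z Hz.
  rewrite Rmin_left, Rmax_right in Hz by auto. now apply H.
Qed.

Lemma CI_unique u a b l : is_RInt (V := C_R_NormedModule) u a b l -> CI u a b = l.
Proof. apply (is_RInt_unique (V := C_R_CompleteNormedModule)). Qed.

Lemma CI_plus u v a b : a <= b -> cts_on u a b -> cts_on v a b ->
  CI (fun t => u t + v t)%C a b = (CI u a b + CI v a b)%C.
Proof.
  intros Hab Hu Hv. apply CI_unique.
  apply (is_RInt_plus (V := C_R_NormedModule)); now apply CI_correct.
Qed.

Lemma CI_minus u v a b : a <= b -> cts_on u a b -> cts_on v a b ->
  CI (fun t => u t - v t)%C a b = (CI u a b - CI v a b)%C.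
Proof.
  intros Hab Hu Hv. apply CI_unique.
  apply (is_RInt_minus (V := C_R_NormedModule)); now apply CI_correct.
Qed.

(** The integral is taken in [C] as a real module, so a complex factor has to be moved out through
    real and imaginary parts. *)
Lemma CI_scal (c : C) u a b : a <= b -> cts_on u a b ->
  CI (fun t => c * u t)%C a b = (c * CI u a b)%C.
Proof.
  intros Hab Hu. apply CI_unique. assert (H := CI_correct u a b Hab Hu).
  assert (H1 := is_RInt_fct_extend_fst (U := R_NormedModule) (V := R_NormedModule) _ _ _ _ H).
  assert (H2 := is_RInt_fct_extend_snd (U := R_NormedModule) (V := R_NormedModule) _ _ _ _ H).
  apply (is_RInt_fct_extend_pair (U := R_NormedModule) (V := R_NormedModule)).
  - apply (is_RInt_minus (V := R_NormedModule));
      apply (is_RInt_scal (V := R_NormedModule)); assumption.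
  - apply (is_RInt_plus (V := R_NormedModule));
      apply (is_RInt_scal (V := R_NormedModule)); assumption.
Qed.

Lemma CI_ext u v a b : a <= b -> (forall t, a < t < b -> u t = v t) -> CI u a b = CI v a b.
Proof.
  intros Hab H. apply (RInt_ext (V := C_R_CompleteNormedModule)).
  rewrite Rmin_left, Rmax_right by auto. exact H.
Qed.

Lemma CI_const (c : C) a b : CI (fun _ => c) a b = (RtoC (b - a) * c)%C.
Proof.
  unfold CI. rewrite (RInt_const (V := C_R_CompleteNormedModule)). apply scal_R_Cmult.
Qed.

Lemma CI_Chasles u a m b : a <= m <= b -> cts_on u a b -> CI u a b = (CI u a m + CI u m b)%C.
Proof.
  intros [H1 H2] Hu. apply CI_unique.
  apply (is_RInt_Chasles (V := C_R_NormedModule)) with m; apply CI_correct; auto;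
    intros t Ht; apply Hu; lra.
Qed.

Lemma Cmod_C_R_norm (x : C) : norm (K := R_AbsRing) (V := C_R_NormedModule) x = Cmod x.
Proof.
  change (sqrt (Rabs (fst x) ^ 2 + Rabs (snd x) ^ 2) = sqrt (fst x ^ 2 + snd x ^ 2)).
  now rewrite !pow2_abs.
Qed.

Lemma CI_le u a b M : a <= b -> cts_on u a b -> (forall t, a <= t <= b -> Cmod (u t) <= M) ->
  Cmod (CI u a b) <= M * (b - a).
Proof.
  intros Hab Hu HM. rewrite <- Cmod_C_R_norm.
  apply (norm_RInt_le (V := C_R_NormedModule) u (fun _ => M) a b); auto.
  - intros x Hx. rewrite Cmod_C_R_norm. now apply HM.
  - now apply CI_correct.
  - replace (M * (b - a)) with (scal (V := R_NormedModule) (b - a) M).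
    apply (is_RInt_const (V := R_NormedModule)). apply Rmult_comm.
Qed.

Lemma nested_intervals (l r : nat -> R) :
  (forall n, l n <= l (S n)) -> (forall n, r (S n) <= r n) -> (forall n, l n <= r n) ->
  exists x, forall n, l n <= x <= r n.
Proof.
  intros Hl Hr Hlr.
  assert (Ml : forall n k, l n <= l (n + k)%nat).
  { intros n k. induction k. rewrite Nat.add_0_r. lra. rewrite Nat.add_succ_r. generalize (Hl (n + k)%nat). lra. }
  assert (Mr : forall n k, r (n + k)%nat <= r n).
  { intros n k. induction k. rewrite Nat.add_0_r. lra. rewrite Nat.add_succ_r. generalize (Hr (n + k)%nat). lra. }
  assert (Hm : forall n m, l n <= r m).
  { intros n m. apply Rle_trans with (l (n + m)%nat). apply Ml.
    eapply Rle_trans. apply Hlr. rewrite Nat.add_comm. apply Mr. }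
  destruct (completeness (fun x => exists n, x = l n)) as [x [Hx1 Hx2]].
  - exists (r 0%nat). intros y [n ->]. apply Hm.
  - exists (l 0%nat). now exists 0%nat.
  - exists x. intros n. split. apply Hx1. now exists n. apply Hx2. intros y [m ->]. apply Hm.
Qed.

(* The integral of [v (s + i t)] along the boundary of [[a, b] x [c, d]]. *)
Definition rect_int (v : R -> R -> C) (a b c d : R) : C :=
  (CI (fun s => v s c - v s d) a b + Ci * CI (fun t => v b t - v a t) c d)%C.

(** Complex differentiability of [v] in the variable [s + i t]: that a single complex [c] gives the
    linear part encodes the Cauchy-Riemann equations. *)
Definition hol_at (v : R -> R -> C) (s t : R) : Prop :=
  exists c : C, forall e, 0 < e -> exists d, 0 < d /\ forall s' t',
    Rabs (s' - s) < d -> Rabs (t' - t) < d ->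
    Cmod (v s' t' - v s t - c * (RtoC (s' - s) + Ci * RtoC (t' - t))) <=
    e * (Rabs (s' - s) + Rabs (t' - t)).

Lemma hol_at_cts v s t : hol_at v s t ->
  cts (fun s' => v s' t) s /\ cts (fun t' => v s t') t.
Proof.
  intros [c H]. destruct (H 1 Rlt_0_1) as [d [Hd H1]].
  assert (Hc := Cmod_ge_0 c).
  assert (K : forall e, 0 < e -> 0 < Rmin d (e / (Cmod c + 2))).
  { intros e He. apply Rmin_glb_lt; auto. apply Rdiv_lt_0_compat; lra. }
  assert (Q : forall e x, 0 < e -> Rabs x < e / (Cmod c + 2) -> (Cmod c + 1) * Rabs x < e).
  { intros e x He Hx. assert (Hp := Rabs_pos x).
    replace e with ((Cmod c + 2) * (e / (Cmod c + 2))) by (field; lra). nra. }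
  split; apply continuous_C_eps; intros e He; apply locally_R_eps; exists (Rmin d (e / (Cmod c + 2)));
    (split; [now apply K|]); intros y Hy.
  - specialize (H1 y t (Rlt_le_trans _ _ _ Hy (Rmin_l _ _))).
    rewrite Rminus_diag, Rabs_R0, Rplus_0_r in H1. specialize (H1 Hd).
    specialize (Q e _ He (Rlt_le_trans _ _ _ Hy (Rmin_r _ _))).
    replace (v y t - v s t)%C with ((v y t - v s t - c * (RtoC (y - s) + Ci * RtoC 0)) + c * RtoC (y - s))%C by ring.
    eapply Rle_lt_trans. apply Cmod_triangle. rewrite Cmod_mult, Cmod_R. lra.
  - specialize (H1 s y). rewrite Rminus_diag, Rabs_R0, Rplus_0_l in H1.
    specialize (H1 Hd (Rlt_le_trans _ _ _ Hy (Rmin_l _ _))).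
    specialize (Q e _ He (Rlt_le_trans _ _ _ Hy (Rmin_r _ _))).
    replace (v s y - v s t)%C with ((v s y - v s t - c * (RtoC 0 + Ci * RtoC (y - t))) + c * (Ci * RtoC (y - t)))%C by ring.
    eapply Rle_lt_trans. apply Cmod_triangle. rewrite !Cmod_mult, Cmod_Ci, Cmod_R. lra.
Qed.

Lemma cts_affine_s (A k : C) (t s : R) : cts (fun s : R => (A + k * (RtoC s + Ci * RtoC t))%C) s.
Proof.
  apply cts_plus; [apply continuous_const|]. apply cts_mult; [apply continuous_const|].
  apply cts_plus; [apply cts_RtoC, continuous_id | apply continuous_const].
Qed.

Lemma cts_affine_t (A k : C) (s t : R) : cts (fun t : R => (A + k * (RtoC s + Ci * RtoC t))%C) t.
Proof.
  apply cts_plus; [apply continuous_const|]. apply cts_mult; [apply continuous_const|].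
  apply cts_plus; [apply continuous_const|]. apply cts_mult; [apply continuous_const|].
  apply cts_RtoC, continuous_id.
Qed.

Section Rectangle.

Variables (v : R -> R -> C) (S0 S1 T0 T1 : R).
Hypothesis Hv : forall s t, S0 <= s <= S1 -> T0 <= t <= T1 -> hol_at v s t.

Lemma rect_cts_s t a b : T0 <= t <= T1 -> S0 <= a -> b <= S1 -> cts_on (fun s => v s t) a b.
Proof. intros Ht Ha Hb s Hs. apply (hol_at_cts v s t). apply Hv; lra. Qed.

Lemma rect_cts_t s a b : S0 <= s <= S1 -> T0 <= a -> b <= T1 -> cts_on (fun t => v s t) a b.
Proof. intros Ht Ha Hb t Hs. apply (hol_at_cts v s t). apply Hv; lra. Qed.

Lemma rect_int_split_s a m b c d : S0 <= a -> a <= m <= b -> b <= S1 -> T0 <= c -> c <= d -> d <= T1 ->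
  rect_int v a b c d = (rect_int v a m c d + rect_int v m b c d)%C.
Proof.
  intros. unfold rect_int.
  rewrite (CI_Chasles _ a m b); auto.
  rewrite (CI_minus (fun t => v b t) (fun t => v a t)), (CI_minus (fun t => v m t) (fun t => v a t)),
    (CI_minus (fun t => v b t) (fun t => v m t)); try apply rect_cts_t; try lra. ring.
  intros s Hs. apply cts_minus; apply (hol_at_cts v s _); apply Hv; lra.
Qed.

Lemma rect_int_split_t a b c m d : S0 <= a -> a <= b -> b <= S1 -> T0 <= c -> c <= m <= d -> d <= T1 ->
  rect_int v a b c d = (rect_int v a b c m + rect_int v a b m d)%C.
Proof.
  intros. unfold rect_int.
  rewrite (CI_Chasles _ c m d); auto.
  rewrite (CI_minus (fun s => v s c) (fun s => v s d)), (CI_minus (fun s => v s c) (fun s => v s m)),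
    (CI_minus (fun s => v s m) (fun s => v s d)); try apply rect_cts_s; try lra. ring.
  intros s Hs. apply cts_minus; apply (hol_at_cts v _ s); apply Hv; lra.
Qed.

(** An affine function of [s + i t] integrates to 0, the contributions of the two pairs of sides
    being opposite. Hence only the deviation from it, at most [eta] on a boundary of length
    [2 * ((b - a) + (d - c))], counts. *)
Lemma rect_int_le (A k : C) (eta : R) a b c d : S0 <= a -> a <= b -> b <= S1 -> T0 <= c -> c <= d -> d <= T1 ->
  (forall s t, a <= s <= b -> c <= t <= d ->
     Cmod (v s t - (A + k * (RtoC s + Ci * RtoC t))) <= eta) ->
  Cmod (rect_int v a b c d) <= 2 * eta * ((b - a) + (d - c)).
Proof.
  intros Ha Hab Hb Hc Hcd Hd H. unfold rect_int.
  set (w := fun s t => (v s t - (A + k * (RtoC s + Ci * RtoC t)))%C).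
  assert (Cs : forall t, c <= t <= d -> cts_on (fun s => w s t) a b).
  { intros t Ht s Hs. apply (cts_minus (fun s => v s t)); [apply (hol_at_cts v s t), Hv; lra | apply cts_affine_s]. }
  assert (Ct : forall s, a <= s <= b -> cts_on (fun t => w s t) c d).
  { intros s Hs t Ht. apply (cts_minus (fun t => v s t)); [apply (hol_at_cts v s t), Hv; lra | apply cts_affine_t]. }
  assert (Ds : cts_on (fun s => w s c - w s d)%C a b).
  { intros s Hs. apply (cts_minus (fun s => w s c) (fun s => w s d)); apply Cs; lra. }
  assert (Dt : cts_on (fun t => w b t - w a t)%C c d).
  { intros t Ht. apply (cts_minus (fun t => w b t) (fun t => w a t)); apply Ct; lra. }
  assert (E1 : CI (fun s => v s c - v s d)%C a b =
    (CI (fun s => w s c - w s d) a b + RtoC (b - a) * (k * Ci * RtoC (c - d)))%C).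
  { rewrite <- CI_const, <- CI_plus; auto.
    - apply CI_ext; auto. intros t _. unfold w. rewrite RtoC_minus. ring.
    - intros s _. apply continuous_const. }
  assert (E2 : CI (fun t => v b t - v a t)%C c d =
    (CI (fun t => w b t - w a t) c d + RtoC (d - c) * (k * RtoC (b - a)))%C).
  { rewrite <- CI_const, <- CI_plus; auto.
    - apply CI_ext; auto. intros t _. unfold w. rewrite RtoC_minus. ring.
    - intros s _. apply continuous_const. }
  rewrite E1, E2.
  match goal with |- Cmod (?x + _ + Ci * (?y + _)) <= _ => replace (Cmod _) with (Cmod (x + Ci * y)) end.
  2: { f_equal. rewrite !RtoC_minus. ring. }
  eapply Rle_trans. apply Cmod_triangle. rewrite Cmod_mult, Cmod_Ci, Rmult_1_l, Rmult_plus_distr_l.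
  apply Rplus_le_compat; apply CI_le; auto; intros s Hs; (eapply Rle_trans; [apply Cmod_minus_le|]).
  - assert (h1 := H s c ltac:(lra) ltac:(lra)). assert (h2 := H s d ltac:(lra) ltac:(lra)). unfold w. lra.
  - assert (h1 := H b s ltac:(lra) ltac:(lra)). assert (h2 := H a s ltac:(lra) ltac:(lra)). unfold w. lra.
Qed.

(** Pigeonhole: the four quarters add up to the whole, so one of them carries at least a quarter of
    the modulus. The bounds on [p] record what is needed to nest the rectangles. *)
Lemma rect_int_quarter s t h k : 0 <= h -> 0 <= k ->
  S0 <= s -> s + 2 * h <= S1 -> T0 <= t -> t + 2 * k <= T1 ->
  exists p : R * R, s <= fst p <= s + h /\ t <= snd p <= t + k /\
    Cmod (rect_int v s (s + 2 * h) t (t + 2 * k)) <=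
    4 * Cmod (rect_int v (fst p) (fst p + h) (snd p) (snd p + k)).
Proof.
  intros Hh Hk Hs1 Hs2 Ht1 Ht2.
  apply NNPP. intros Hn.
  assert (N : forall s' t', s <= s' <= s + h -> t <= t' <= t + k ->
    4 * Cmod (rect_int v s' (s' + h) t' (t' + k)) < Cmod (rect_int v s (s + 2 * h) t (t + 2 * k))).
  { intros s' t' X Y. apply Rnot_le_lt. intros Z. apply Hn. exists (s', t'). auto. }
  assert (N1 := N s t ltac:(lra) ltac:(lra)). assert (N2 := N (s + h) t ltac:(lra) ltac:(lra)).
  assert (N3 := N s (t + k) ltac:(lra) ltac:(lra)). assert (N4 := N (s + h) (t + k) ltac:(lra) ltac:(lra)).
  clear N Hn. replace (s + h + h) with (s + 2 * h) in * by ring.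
  replace (t + k + k) with (t + 2 * k) in * by ring.
  assert (E : rect_int v s (s + 2 * h) t (t + 2 * k) =
    ((rect_int v s (s + h) t (t + k) + rect_int v s (s + h) (t + k) (t + 2 * k)) +
    (rect_int v (s + h) (s + 2 * h) t (t + k) + rect_int v (s + h) (s + 2 * h) (t + k) (t + 2 * k)))%C).
  { rewrite <- !rect_int_split_t; try lra. rewrite <- rect_int_split_s; try lra. reflexivity. }
  rewrite E in N1, N2, N3, N4.
  match type of N1 with _ < Cmod (?x + ?y) => generalize (Cmod_triangle x y) end.
  match type of N1 with _ < Cmod ((?x + ?y) + (?z + ?w)) => generalize (Cmod_triangle x y) (Cmod_triangle z w) end.
  lra.
Qed.

(** Goursat's bisection. The [n]-th nested rectangle keeps at least [D / 4 ^ n] of the integral,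
    while its perimeter and the distances to the limit point are both of order [1 / 2 ^ n].
    Differentiability at the limit point makes the integral smaller than any multiple of their
    product, forcing [D = 0]. *)
Lemma goursat : S0 <= S1 -> T0 <= T1 -> rect_int v S0 S1 T0 T1 = 0.
Proof.
  intros HS HT. set (A := S1 - S0). set (B := T1 - T0).
  set (D := Cmod (rect_int v S0 S1 T0 T1)).
  set (h := fun n => A / 2 ^ n). set (k := fun n => B / 2 ^ n).
  assert (P2 : forall n, 0 < 2 ^ n) by (intros; apply pow_lt; lra).
  assert (Hh : forall n, 0 <= h n) by (intros; unfold h, Rdiv; apply Rmult_le_pos; [unfold A; lra | left; now apply Rinv_0_lt_compat]).
  assert (Hk : forall n, 0 <= k n) by (intros; unfold k, Rdiv; apply Rmult_le_pos; [unfold B; lra | left; now apply Rinv_0_lt_compat]).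
  assert (Eh : forall n, h n = 2 * h (S n)) by (intros; unfold h; simpl; field; generalize (P2 n); lra).
  assert (Ek : forall n, k n = 2 * k (S n)) by (intros; unfold k; simpl; field; generalize (P2 n); lra).
  set (good := fun n (p : R * R) => S0 <= fst p /\ fst p + h n <= S1 /\ T0 <= snd p /\ snd p + k n <= T1 /\
    D <= 4 ^ n * Cmod (rect_int v (fst p) (fst p + h n) (snd p) (snd p + k n))).
  set (nxt := fun n (p q : R * R) => good (S n) q /\ fst p <= fst q <= fst p + h (S n) /\ snd p <= snd q <= snd p + k (S n)).
  assert (step : forall n p, good n p -> exists q, nxt n p q).
  { intros n p [G1 [G2 [G3 [G4 G5]]]]. rewrite Eh in G2, G5. rewrite Ek in G4, G5.
    destruct (rect_int_quarter (fst p) (snd p) (h (S n)) (k (S n))) as [q [Q1 [Q2 Q3]]]; auto.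
    exists q. split; auto. split. lra. split. lra. split. lra. split. lra.
    eapply Rle_trans. exact G5. simpl. assert (0 < 4 ^ n) by (apply pow_lt; lra). nra. }
  (* The selected quarter is only known to exist, so the sequence of lower left corners is built
     with [epsilon]; [(S0, T0)] is at once its start and the default value. *)
  set (seq := fix seq n := match n with O => (S0, T0) | S m => epsilon (inhabits (S0, T0)) (nxt m (seq m)) end).
  assert (G : forall n, good n (seq n)).
  { induction n.
    - unfold good, h, k, A, B. simpl. rewrite !Rdiv_1_r.
      replace (S0 + (S1 - S0)) with S1 by ring. replace (T0 + (T1 - T0)) with T1 by ring.
      fold D. repeat split; lra.
    - apply (epsilon_spec (inhabits (S0, T0)) (nxt n (seq n))). now apply step. }
  assert (N : forall n, nxt n (seq n) (seq (S n))).
  { intros n. apply (epsilon_spec (inhabits (S0, T0)) (nxt n (seq n))). now apply step. }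
  destruct (nested_intervals (fun n => fst (seq n)) (fun n => fst (seq n) + h n)) as [s Hs].
  { intros n. destruct (N n) as [_ [X _]]. lra. }
  { intros n. destruct (N n) as [_ [X _]]. rewrite (Eh n). lra. }
  { intros n. generalize (Hh n). lra. }
  destruct (nested_intervals (fun n => snd (seq n)) (fun n => snd (seq n) + k n)) as [t Ht].
  { intros n. destruct (N n) as [_ [_ X]]. lra. }
  { intros n. destruct (N n) as [_ [_ X]]. rewrite (Ek n). lra. }
  { intros n. generalize (Hk n). lra. }
  apply Cmod_eq_0. fold D. apply NNPP. intros HD.
  assert (HD0 : 0 < D) by (generalize (Cmod_ge_0 (rect_int v S0 S1 T0 T1)); fold D; lra).
  assert (Hs0 : S0 <= s <= S1).
  { destruct (G 0%nat) as [G1 [G2 _]]. specialize (Hs 0%nat). lra. }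
  assert (Ht0 : T0 <= t <= T1).
  { destruct (G 0%nat) as [_ [_ [G1 [G2 _]]]]. specialize (Ht 0%nat). lra. }
  destruct (Hv s t Hs0 Ht0) as [c Hc].
  set (AB := A + B). assert (HAB : 0 <= AB) by (unfold AB, A, B; lra).
  (* The estimates will end in [D <= 2 * e * (AB * AB)], against [D = 4 * e * (AB * AB + 1)]. The 1
     keeps the denominator positive for a degenerate rectangle. *)
  set (e := D / (4 * (AB * AB + 1))).
  assert (He : 0 < e) by (unfold e; apply Rdiv_lt_0_compat; nra).
  destruct (Hc e He) as [d [Hd Hcd]].
  destruct (pow_lt_1_zero (/ 2) ltac:(rewrite Rabs_pos_eq; lra) (d / (AB + 1)) ltac:(apply Rdiv_lt_0_compat; lra)) as [n Hn].
  specialize (Hn n (Nat.le_refl _)).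
  rewrite Rabs_pos_eq in Hn by (apply pow_le; lra).
  assert (Hhk : h n + k n = AB * (/ 2) ^ n).
  { unfold h, k, AB. rewrite pow_inv. field. generalize (P2 n). lra. }
  assert (Hsm : h n + k n < d).
  { rewrite Hhk. assert (0 < (/ 2) ^ n) by (apply pow_lt; lra).
    apply Rle_lt_trans with ((AB + 1) * (/ 2) ^ n). nra.
    replace d with ((AB + 1) * (d / (AB + 1))) by (field; lra). apply Rmult_lt_compat_l; lra. }
  destruct (G n) as [G1 [G2 [G3 [G4 G5]]]]. specialize (Hs n). specialize (Ht n). simpl in Hs, Ht.
  assert (Hkn := Hk n). assert (Hhn := Hh n).
  assert (Hb : Cmod (rect_int v (fst (seq n)) (fst (seq n) + h n) (snd (seq n)) (snd (seq n) + k n)) <=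
    2 * (e * (h n + k n)) * (h n + k n)).
  { replace (h n + k n) with (((fst (seq n) + h n) - fst (seq n)) + ((snd (seq n) + k n) - snd (seq n))) at 2 by ring.
    apply (rect_int_le (v s t - c * (RtoC s + Ci * RtoC t)) c); try lra.
    intros s' t' Hs' Ht'.
    assert (Rabs (s' - s) <= h n) by (apply Rabs_le_between; lra).
    assert (Rabs (t' - t) <= k n) by (apply Rabs_le_between; lra).
    replace (_ - _)%C with (v s' t' - v s t - c * (RtoC (s' - s) + Ci * RtoC (t' - t)))%C
      by (rewrite !RtoC_minus; ring).
    eapply Rle_trans. apply Hcd; lra. apply Rmult_le_compat_l; lra. }
  assert (X : D <= 2 * e * (AB * AB)).
  { eapply Rle_trans. exact G5.
    eapply Rle_trans. apply Rmult_le_compat_l; [ | exact Hb]. apply pow_le; lra.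
    rewrite Hhk. right. replace 4 with (2 * 2) at 1 by ring. rewrite Rpow_mult_distr, pow_inv.
    field. generalize (P2 n). lra. }
  assert (D = e * (4 * (AB * AB + 1))) by (unfold e; field; nra). nra.
Qed.

End Rectangle.

(** * Cauchy's theorem on circles *)

(** The exponential serves as holomorphic polar coordinates: it wraps the rectangle with sides
    [[ln r1, ln r2]] and [[0, 2 * PI]] onto the annulus between the radii [r1] and [r2]. *)
Definition cexp (z : C) : C := (RtoC (exp (fst z)) * cis (snd z))%C.

Lemma cexp_add a b : cexp (a + b) = (cexp a * cexp b)%C.
Proof. unfold cexp. simpl. rewrite exp_plus, cis_add, RtoC_mult. ring. Qed.

Lemma derivable_pt_lim_eps f x l : derivable_pt_lim f x l ->
  forall e, 0 < e -> exists d, 0 < d /\ forall h, Rabs h < d -> Rabs (f (x + h) - f x - l * h) <= e * Rabs h.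
Proof.
  intros H e He. destruct (H e He) as [d Hd]. exists d. split. apply cond_pos. intros h Hh.
  destruct (Req_dec h 0) as [->|Hn].
  - rewrite Rplus_0_r, Rminus_diag, Rmult_0_r, Rminus_0_r, Rabs_R0. lra.
  - specialize (Hd h Hn Hh). replace (f (x + h) - f x - l * h) with (((f (x + h) - f x) / h - l) * h) by (field; auto).
    rewrite Rabs_mult. apply Rmult_le_compat_r. apply Rabs_pos. lra.
Qed.

Lemma cexp_at_0 : forall e, 0 < e -> exists d, 0 < d /\ forall h : C, Cmod h < d ->
  Cmod (cexp h - 1 - h) <= e * Cmod h.
Proof.
  intros e He. set (e' := Rmin 1 (e / 10)).
  assert (He' : 0 < e') by (apply Rmin_glb_lt; lra).
  assert (He1 : e' <= 1) by apply Rmin_l. assert (He2 : e' <= e / 10) by apply Rmin_r.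
  destruct (derivable_pt_lim_eps _ _ _ (derivable_pt_lim_exp 0) e' He') as [d1 [Hd1 K1]].
  destruct (derivable_pt_lim_eps _ _ _ (derivable_pt_lim_sin 0) e' He') as [d2 [Hd2 K2]].
  destruct (derivable_pt_lim_eps _ _ _ (derivable_pt_lim_cos 0) e' He') as [d3 [Hd3 K3]].
  exists (Rmin (Rmin d1 d2) (Rmin d3 e')). split. { repeat apply Rmin_glb_lt; lra. }
  intros h Hh.
  assert (X1 := Rlt_le_trans _ _ _ Hh (Rmin_l _ _)). assert (X2 := Rlt_le_trans _ _ _ Hh (Rmin_r _ _)).
  assert (Y1 := Rlt_le_trans _ _ _ X1 (Rmin_l _ _)). assert (Y2 := Rlt_le_trans _ _ _ X1 (Rmin_r _ _)).
  assert (Y3 := Rlt_le_trans _ _ _ X2 (Rmin_l _ _)). assert (Y4 := Rlt_le_trans _ _ _ X2 (Rmin_r _ _)).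
  clear Hh X1 X2.
  assert (B := Rmax_Cmod h). assert (B1 := Rmax_l (Rabs (fst h)) (Rabs (snd h))).
  assert (B2 := Rmax_r (Rabs (fst h)) (Rabs (snd h))).
  set (x := fst h) in *. set (y := snd h) in *.
  specialize (K1 x ltac:(lra)). specialize (K2 y ltac:(lra)). specialize (K3 y ltac:(lra)).
  rewrite Rplus_0_l in K1, K2, K3. rewrite exp_0 in K1. rewrite sin_0, cos_0 in K2, K3.
  replace (exp x - 1 - 1 * x) with (exp x - 1 - x) in K1 by ring.
  replace (sin y - 0 - 1 * y) with (sin y - y) in K2 by ring.
  replace (cos y - 1 - - 0 * y) with (cos y - 1) in K3 by ring.
  assert (Px := Rabs_pos x). assert (Py := Rabs_pos y).
  assert (E1 : Rabs (exp x - 1) <= 2 * Rabs x).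
  { replace (exp x - 1) with ((exp x - 1 - x) + x) by ring. eapply Rle_trans. apply Rabs_triang. nra. }
  assert (E2 : Rabs (exp x) <= 3).
  { replace (exp x) with ((exp x - 1) + 1) by ring. eapply Rle_trans. apply Rabs_triang. rewrite Rabs_R1. lra. }
  replace (cexp h - 1 - h)%C with
    (RtoC (exp x) * (RtoC (cos y - 1) + Ci * RtoC (sin y - y)) + (RtoC (exp x - 1 - x) + RtoC (exp x - 1) * (Ci * RtoC y)))%C.
  2: { unfold cexp, x, y. destruct h as [h1 h2]. apply injective_projections; simpl; ring. }
  eapply Rle_trans. apply Cmod_triangle.
  assert (Z1 : Cmod (RtoC (exp x) * (RtoC (cos y - 1) + Ci * RtoC (sin y - y))) <= 3 * (2 * (e' * Rabs y))).
  { rewrite Cmod_mult, Cmod_R. apply Rmult_le_compat; auto. apply Rabs_pos. apply Cmod_ge_0.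
    eapply Rle_trans. apply Cmod_triangle. rewrite Cmod_mult, Cmod_Ci, !Cmod_R. lra. }
  assert (Z2 : Cmod (RtoC (exp x - 1 - x) + RtoC (exp x - 1) * (Ci * RtoC y)) <= e' * Rabs x + 2 * Rabs x * Rabs y).
  { eapply Rle_trans. apply Cmod_triangle. rewrite !Cmod_mult, Cmod_Ci, !Cmod_R, Rmult_1_l.
    apply Rplus_le_compat; auto. now apply Rmult_le_compat_r. }
  assert (Rabs x * Rabs y <= e' * Rabs y) by (apply Rmult_le_compat_r; lra).
  assert (e' * Rabs x <= e' * Cmod h) by (apply Rmult_le_compat_l; lra).
  assert (e' * Rabs y <= e' * Cmod h) by (apply Rmult_le_compat_l; lra).
  assert (e' * Cmod h <= e / 10 * Cmod h) by (apply Rmult_le_compat_r; lra).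
  assert (0 <= e * Cmod h) by (apply Rmult_le_pos; lra). lra.
Qed.

Lemma cexp_hol z : hol1 cexp z.
Proof.
  exists (cexp z), (RtoC 0). intros e He. assert (Hm := Cmod_ge_0 (cexp z)).
  destruct (cexp_at_0 (e / (Cmod (cexp z) + 1))) as [d [Hd H]]. apply Rdiv_lt_0_compat; lra.
  exists d. split; auto. intros [x x'] Hx. unfold dist in *. simpl in *.
  assert (H0 := Cmod_ge_0 (x' - 0)). specialize (H (x - z)%C ltac:(lra)).
  set (h := (x - z)%C) in *. replace x with (z + h)%C by (unfold h; ring). rewrite cexp_add.
  replace (_ - _ - _)%C with (cexp z * (cexp h - 1 - h))%C by ring.
  rewrite Cmod_mult. eapply Rle_trans. apply Rmult_le_compat_l; [auto | exact H].
  assert (Hh := Cmod_ge_0 h).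
  apply Rle_trans with (e * Cmod h). 2: apply Rmult_le_compat_l; lra.
  replace e with ((Cmod (cexp z) + 1) * (e / (Cmod (cexp z) + 1))) at 2 by (field; lra).
  set (q := e / _) in *. assert (0 < q) by (unfold q; apply Rdiv_lt_0_compat; lra).
  assert (0 <= q * Cmod h) by (apply Rmult_le_pos; lra). nra.
Qed.

Lemma Cmod_cexp z : Cmod (cexp z) = exp (fst z).
Proof.
  unfold cexp. rewrite Cmod_mult, Cmod_cis, Cmod_R, Rmult_1_r. apply Rabs_pos_eq.
  left. apply exp_pos.
Qed.

Lemma hol1_hol_at (g : C -> C) s t : hol1 g (s, t) -> hol_at (fun s t => g (s, t)) s t.
Proof.
  intros H. destruct (hol1_spec _ _ H) as [a Ha]. exists a. intros e He.
  destruct (Ha e He) as [d [Hd K]]. exists (d / 2). split. lra. intros s' t' Hs Ht.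
  assert (E : ((s', t') - (s, t))%C = (RtoC (s' - s) + Ci * RtoC (t' - t))%C)
    by (apply injective_projections; simpl; ring).
  assert (B : Cmod ((s', t') - (s, t)) <= Rabs (s' - s) + Rabs (t' - t)).
  { rewrite E. eapply Rle_trans. apply Cmod_triangle. rewrite Cmod_mult, Cmod_Ci, !Cmod_R. lra. }
  specialize (K (s', t') ltac:(lra)). rewrite E in K, B.
  eapply Rle_trans. exact K. apply Rmult_le_compat_l; lra.
Qed.

(* The circle integral of [u dz / i] over [|z| = r]. *)
Definition J (u : C -> C) (r : R) : C :=
  CI (fun t => u (RtoC r * cis t) * (RtoC r * cis t))%C 0 (2 * PI).

Lemma two_PI_pos : 0 < 2 * PI.
Proof. generalize PI_RGT_0. lra. Qed.

Lemma Cmod_r_cis r t : 0 <= r -> Cmod (RtoC r * cis t) = r.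
Proof. intros. now rewrite Cmod_mult, Cmod_cis, Cmod_R, Rmult_1_r, Rabs_pos_eq. Qed.

Definition cts_circle (u : C -> C) (r : R) : Prop := forall z, Cmod z = r -> cts u z.

Lemma cts_circle_on u r : 0 <= r -> cts_circle u r ->
  cts_on (fun t => u (RtoC r * cis t) * (RtoC r * cis t))%C 0 (2 * PI).
Proof.
  intros Hr Hu t _.
  assert (Hc : cts (fun t => RtoC r * cis t)%C t) by (apply cts_mult; [apply continuous_const | apply cts_cis]).
  apply cts_mult; auto. apply (continuous_comp _ u); auto. apply Hu. now apply Cmod_r_cis.
Qed.

Lemma J_ext u w r : 0 <= r -> (forall z, Cmod z = r -> u z = w z) -> J u r = J w r.
Proof.
  intros Hr H. apply CI_ext. left; apply two_PI_pos. intros t _. rewrite H; auto. now apply Cmod_r_cis.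
Qed.

Lemma J_plus u w r : 0 <= r -> cts_circle u r -> cts_circle w r ->
  J (fun z => u z + w z)%C r = (J u r + J w r)%C.
Proof.
  intros Hr Hu Hw. unfold J. rewrite <- CI_plus; try now apply cts_circle_on.
  - apply CI_ext. left; apply two_PI_pos. intros; ring.
  - left; apply two_PI_pos.
Qed.

Lemma J_scal c u r : 0 <= r -> cts_circle u r -> J (fun z => c * u z)%C r = (c * J u r)%C.
Proof.
  intros Hr Hu. unfold J. rewrite <- CI_scal; try now apply cts_circle_on.
  - apply CI_ext. left; apply two_PI_pos. intros; ring.
  - left; apply two_PI_pos.
Qed.

Lemma J_le u r M : 0 <= r -> cts_circle u r -> (forall z, Cmod z = r -> Cmod (u z) <= M) ->
  Cmod (J u r) <= M * r * (2 * PI).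
Proof.
  intros Hr Hu H. replace (M * r * (2 * PI)) with (M * r * (2 * PI - 0)) by ring. apply CI_le.
  - left; apply two_PI_pos.
  - now apply cts_circle_on.
  - intros t _. rewrite Cmod_mult, Cmod_r_cis by auto. apply Rmult_le_compat_r; auto.
    apply H. now apply Cmod_r_cis.
Qed.

(** Goursat's lemma for [q (cexp z) * cexp z]: the horizontal sides of the rectangle cancel because
    [cexp] has period [2 i PI], and the vertical sides are the two circle integrals. *)
Lemma J_const_hol q r1 r2 : 0 < r1 <= r2 -> (forall z, r1 <= Cmod z <= r2 -> hol1 q z) -> J q r1 = J q r2.
Proof.
  intros [H1 H2] Hq.
  assert (Hl : ln r1 <= ln r2) by (destruct H2 as [H2| ->]; [left; now apply ln_increasing | lra]).
  set (v := fun s t : R => (fun z => q (cexp z) * cexp z)%C (s, t)).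
  assert (Hv : forall s t, ln r1 <= s <= ln r2 -> 0 <= t <= 2 * PI -> hol_at v s t).
  { intros s t Hs _. apply (hol1_hol_at (fun z => q (cexp z) * cexp z)%C). apply hol2_mult.
    - apply (hol2_hol1 q). 2: apply cexp_hol. apply Hq. rewrite Cmod_cexp. simpl.
      rewrite <- (exp_ln r1), <- (exp_ln r2) by lra.
      destruct Hs as [[h|h] [h'|h']]; split;
        try (left; apply exp_increasing; assumption); right; f_equal; auto.
    - apply cexp_hol. }
  assert (G := goursat v _ _ _ _ Hv Hl (Rlt_le _ _ two_PI_pos)).
  assert (Hp := two_PI_pos).
  unfold rect_int in G.
  rewrite (CI_ext _ (fun _ => RtoC 0)), CI_const, Cmult_0_r, Cplus_0_l in G; auto.
  2: { intros s _. unfold v, cexp. simpl. rewrite cis_0, cis_2PI. ring. }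
  rewrite (CI_minus (fun t => v (ln r2) t) (fun t => v (ln r1) t)) in G; try lra.
  2, 3: intros t Ht; apply (hol_at_cts v _ t); apply Hv; lra.
  assert (E : forall r, 0 < r -> CI (fun t => v (ln r) t) 0 (2 * PI) = J q r).
  { intros r Hr. apply CI_ext. lra. intros t _. unfold v, cexp. simpl. now rewrite exp_ln. }
  rewrite !E in G by lra.
  assert (J q r2 - J q r1 = 0)%C.
  { replace (J q r2 - J q r1)%C with (- Ci * (Ci * (J q r2 - J q r1)))%C.
    rewrite G. ring. replace (- Ci * (Ci * (J q r2 - J q r1)))%C with (- (Ci * Ci) * (J q r2 - J q r1))%C by ring.
    replace (Ci * Ci)%C with (RtoC (-1)). ring. apply injective_projections; simpl; ring. }
  symmetry. now apply Ceq_minus.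
Qed.

Lemma circle_bound u r : 0 <= r -> cts_circle u r -> exists M, 0 < M /\ forall z, Cmod z = r -> Cmod (u z) <= M.
Proof.
  (* The bound is stored as [/ d], which is monotone in the right direction, so that the uniform
     radius delivers a uniform bound. The same device returns wherever boundedness comes from
     compactness. *)
  intros Hr Hu. destruct (circle_unif (fun z d => Cmod (u (RtoC r * z)%C) <= / d)) as [d [Hd H]].
  - intros z d d' Hd H. eapply Rle_trans. exact H. apply Rinv_le_contravar; lra.
  - intros z Hz.
    assert (Hz' : Cmod (RtoC r * z) = r) by (rewrite Cmod_mult, Cmod_R, Hz, Rabs_pos_eq; lra).
    assert (Hc : cts (fun z => u (RtoC r * z)%C) z).
    { apply (continuous_comp (fun z => RtoC r * z)%C u).
      apply (cts_mult (fun _ => RtoC r) (fun z => z)); [apply continuous_const | apply continuous_id].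
      now apply Hu. }
    destruct (proj1 (locally_C_eps _ _) (proj1 (continuous_C_eps _ _) Hc 1 Rlt_0_1)) as [d [Hd H]].
    set (M := Cmod (u (RtoC r * z)%C) + 1).
    assert (HM : 0 < M) by (unfold M; generalize (Cmod_ge_0 (u (RtoC r * z)%C)); lra).
    exists (Rmin d (/ M)). split. apply Rmin_glb_lt; auto. now apply Rinv_0_lt_compat.
    intros y _ Hy. specialize (H y (Rlt_le_trans _ _ _ Hy (Rmin_l _ _))). simpl in H.
    apply Rle_trans with M. unfold M. generalize (Cmod_rev_tri (u (RtoC r * y)%C) (u (RtoC r * z)%C)). lra.
    apply Rle_trans with (/ / M). right; symmetry; apply Rinv_inv. apply Rinv_le_contravar.
    apply Rmin_glb_lt; auto. now apply Rinv_0_lt_compat. apply Rmin_r.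
  - exists (/ d). split. now apply Rinv_0_lt_compat. intros z Hz.
    destruct (Req_dec r 0) as [->|Hr0].
    + apply Cmod_eq_0 in Hz. subst. specialize (H (RtoC 1) Cmod_1). now rewrite Cmult_0_l in H.
    + assert (Hrn : RtoC r <> RtoC 0) by (intros X; apply Hr0; now apply RtoC_inj).
      specialize (H (z / RtoC r)%C). rewrite Cmod_div, Hz, Cmod_R, (Rabs_pos_eq r) in H by auto.
      replace (RtoC r * (z / RtoC r))%C with z in H by (field; auto).
      apply H. field; auto.
Qed.

Lemma J_cont u c : 0 <= c -> cts_circle u c -> forall e, 0 < e ->
  exists d, 0 < d /\ forall r, 0 <= r -> cts_circle u r -> Rabs (r - c) < d -> Cmod (J u r - J u c) <= e.
Proof.
  intros Hc Hu e He. assert (Hp := two_PI_pos).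
  set (e' := e / (2 * PI)). assert (He' : 0 < e') by now apply Rdiv_lt_0_compat.
  destruct (circle_unif (fun z d => forall r, Rabs (r - c) < d ->
    Cmod (u (RtoC r * z) * (RtoC r * z) - u (RtoC c * z) * (RtoC c * z)) <= e')%C) as [d [Hd H]].
  - intros z d d' Hd H r Hr. apply H. lra.
  - intros z Hz.
    assert (Hz' : Cmod (RtoC c * z) = c) by (rewrite Cmod_mult, Cmod_R, Hz, Rabs_pos_eq; lra).
    assert (Hk : cts (fun z => u z * z)%C (RtoC c * z)%C).
    { apply cts_mult. now apply Hu. apply continuous_id. }
    assert (He2 : 0 < e' / 2) by lra.
    destruct (proj1 (locally_C_eps _ _) (proj1 (continuous_C_eps _ _) Hk _ He2)) as [d [Hd H]].
    exists (d / (1 + c)). assert (Hd' : 0 < d / (1 + c)) by (apply Rdiv_lt_0_compat; lra).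
    split; auto. intros y Hy Hyz r Hr.
    assert (E : d = d / (1 + c) + c * (d / (1 + c))) by (field; lra).
    set (w := d / (1 + c)) in *.
    assert (N : c * Cmod (y - z) <= c * w) by (apply Rmult_le_compat_l; lra).
    assert (A1 : Cmod (RtoC c * y - RtoC c * z) < d).
    { replace (RtoC c * y - RtoC c * z)%C with (RtoC c * (y - z))%C by ring.
      rewrite Cmod_mult, Cmod_R, Rabs_pos_eq; lra. }
    assert (A2 : Cmod (RtoC r * y - RtoC c * z) < d).
    { replace (RtoC r * y - RtoC c * z)%C with (RtoC (r - c) * y + RtoC c * (y - z))%C by (rewrite RtoC_minus; ring).
      eapply Rle_lt_trans. apply Cmod_triangle. rewrite !Cmod_mult, !Cmod_R, Hy, (Rabs_pos_eq c); lra. }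
    apply H in A1. apply H in A2.
    match type of A1 with Cmod (?a - ?b) < _ => match type of A2 with Cmod (?c' - _) < _ =>
      generalize (Cmod_minus_tri b c' a) end end.
    rewrite (Cmod_minus_sym (u (RtoC c * z) * _)%C). simpl in *. lra.
  - exists d. split; auto. intros r Hr Hur Hrc. unfold J.
    rewrite <- CI_minus; try (left; exact Hp); try now apply cts_circle_on.
    replace e with (e' * (2 * PI - 0)) by (unfold e'; field; lra).
    apply CI_le. lra.
    + intros t Ht. apply (cts_minus (fun t => u (RtoC r * cis t) * (RtoC r * cis t))%C (fun t => u (RtoC c * cis t) * (RtoC c * cis t))%C);
      now apply cts_circle_on.
    + intros t _. apply H; auto. apply Cmod_cis.
Qed.

Lemma Cmod_small_eq (x y : C) : (forall e, 0 < e -> Cmod (x - y) <= e) -> x = y.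
Proof.
  intros H. apply Ceq_minus. apply Cmod_eq_0. generalize (Cmod_ge_0 (x - y)). intros H0.
  destruct (Req_dec (Cmod (x - y)) 0) as [|Hn]; auto.
  specialize (H (Cmod (x - y) / 2) ltac:(lra)). lra.
Qed.

(* Both sides of the circle [|z| = c] have constant [J], and [J] is continuous across it. *)
Lemma J_const_exc q c r1 r2 : 0 < r1 <= r2 ->
  (forall z, r1 <= Cmod z <= r2 -> cts q z) ->
  (forall z, r1 <= Cmod z <= r2 -> Cmod z <> c -> hol1 q z) -> J q r1 = J q r2.
Proof.
  intros [H1 H2] Hc Hh.
  destruct (Rle_dec r1 c) as [Hc1|Hc1]. 2: { apply J_const_hol; auto. intros; apply Hh; lra. }
  destruct (Rle_dec c r2) as [Hc2|Hc2]. 2: { apply J_const_hol; auto. intros; apply Hh; lra. }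
  assert (Hcc : forall r, r1 <= r <= r2 -> cts_circle q r) by (intros r Hr z <-; now apply Hc).
  transitivity (J q c).
  - destruct (Req_dec r1 c) as [->|Hn]; auto. apply Cmod_small_eq. intros e He.
    destruct (J_cont q c ltac:(lra) (Hcc c ltac:(lra)) e He) as [d [Hd H]].
    set (r := Rmax r1 (c - d / 2)).
    assert (Hr1 : r1 <= r) by apply Rmax_l. assert (Hr2 : c - d / 2 <= r) by apply Rmax_r.
    assert (Hr3 : r < c) by (apply Rmax_lub_lt; lra).
    rewrite (J_const_hol q r1 r); [ | lra | intros; apply Hh; lra]. apply H. lra. apply Hcc; lra.
    apply Rabs_lt_between. lra.
  - symmetry. destruct (Req_dec r2 c) as [->|Hn]; auto. apply Cmod_small_eq. intros e He.
    destruct (J_cont q c ltac:(lra) (Hcc c ltac:(lra)) e He) as [d [Hd H]].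
    set (r := Rmin r2 (c + d / 2)).
    assert (Hr1 : r <= r2) by apply Rmin_l. assert (Hr2 : r <= c + d / 2) by apply Rmin_r.
    assert (Hr3 : c < r) by (apply Rmin_glb_lt; lra).
    rewrite <- (J_const_hol q r r2); [ | lra | intros; apply Hh; lra]. apply H. lra. apply Hcc; lra.
    apply Rabs_lt_between. lra.
Qed.

(** The integral is the same over all small circles, where it is at most a bound for [q] times their
    length. The point 0 is left out; the circle [Cmod z = c], on which only continuity is asked,
    makes room for the filled singularity of a difference quotient, and [c = 0] means that there is
    none. *)
Lemma J_zero q c R0 d M : 0 < R0 -> 0 < d ->
  (forall z, 0 < Cmod z <= R0 -> cts q z) ->
  (forall z, 0 < Cmod z <= R0 -> Cmod z <> c -> hol1 q z) ->
  (forall z, 0 < Cmod z <= d -> Cmod (q z) <= M) -> J q R0 = 0.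
Proof.
  intros HR Hd Hc Hh HM. apply Cmod_small_eq. intros e He. rewrite Cminus_0_r.
  assert (Hp := two_PI_pos).
  set (M' := Rmax M 1). assert (HM1 : M <= M') by apply Rmax_l. assert (HM2 : 1 <= M') by apply Rmax_r.
  set (s := e / (M' * (2 * PI))). assert (Hs : 0 < s) by (apply Rdiv_lt_0_compat; auto; apply Rmult_lt_0_compat; lra).
  set (r := Rmin (Rmin R0 d) s).
  assert (Hr1 : r <= s) by apply Rmin_r.
  assert (Hr : r <= Rmin R0 d) by apply Rmin_l.
  assert (Hr2 : r <= R0) by (eapply Rle_trans; [exact Hr | apply Rmin_l]).
  assert (Hr3 : r <= d) by (eapply Rle_trans; [exact Hr | apply Rmin_r]).
  assert (Hr0 : 0 < r) by (repeat apply Rmin_glb_lt; lra).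
  rewrite <- (J_const_exc q c r R0); [ | lra | intros; apply Hc; lra | intros; apply Hh; lra].
  eapply Rle_trans. apply (J_le q r M'). lra. intros z Hz; apply Hc; lra.
  intros z Hz. eapply Rle_trans. apply HM; lra. lra.
  replace e with (M' * s * (2 * PI)) by (unfold s; field; lra).
  apply Rmult_le_compat_r. lra. apply Rmult_le_compat_l; lra.
Qed.

Ltac rpos := repeat first [assumption | lra | apply Rdiv_lt_0_compat | apply Rmult_lt_0_compat |
  apply Rinv_0_lt_compat | apply pow_lt].

(** * Cauchy kernels and Cauchy's integral formula *)

Lemma Cminus_nz (x y : C) : Cmod x <> Cmod y -> (x - y)%C <> 0.
Proof. intros H E. apply H. f_equal. now apply Ceq_minus. Qed.

Lemma RtoC_nz (r : R) : r <> 0 -> RtoC r <> 0.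
Proof. intros H E. apply H. now apply RtoC_inj. Qed.

Lemma Cmod_nz (x : C) : 0 < Cmod x -> x <> RtoC 0.
Proof. apply Cmod_gt_0. Qed.

Lemma cts_circle_kernel u z r : Cmod z <> r -> cts_circle u r -> cts_circle (fun y => u y / (y - z))%C r.
Proof.
  intros Hz Hu y Hy. apply (cts_div u (fun y => y - z)%C).
  - apply Cminus_nz. lra.
  - now apply Hu.
  - apply (cts_minus (fun y => y) (fun _ => z)). apply continuous_id. apply continuous_const.
Qed.

Lemma kernel_le u z r M : Cmod z < r -> (forall y, Cmod y = r -> Cmod (u y) <= M) ->
  forall y, Cmod y = r -> Cmod (u y / (y - z)) <= M / (r - Cmod z).
Proof.
  intros Hz H y Hy. rewrite Cmod_div by (apply Cminus_nz; lra).
  assert (B := Cmod_rev_tri y z). assert (H1 := H y Hy). assert (H0 := Cmod_ge_0 (u y)).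
  unfold Rdiv. apply Rmult_le_compat; auto. left; apply Rinv_0_lt_compat; lra.
  apply Rinv_le_contravar; lra.
Qed.

(** The circle may be enlarged to radius [r']. There [1 / (y - z) = 1 / y + z / (y * (y - z))],
    where the first term integrates to exactly [2 * PI] and the second to at most
    [2 * PI * Cmod z / (r' - Cmod z)]. The increment [s] is chosen to make this at most [e]. *)
Lemma J_kernel_1_out z r : Cmod z < r -> J (fun y => 1 / (y - z))%C r = RtoC (2 * PI).
Proof.
  intros Hz. apply Cmod_small_eq. intros e He. assert (Hp := two_PI_pos). assert (Hz0 := Cmod_ge_0 z).
  set (s := Cmod z * (2 * PI) / e).
  assert (Hs : 0 <= s) by (apply Rmult_le_pos; [apply Rmult_le_pos; lra | left; now apply Rinv_0_lt_compat]).
  set (r' := r + s).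
  assert (Hr' : cts_circle (fun _ => RtoC 1) r') by (intros y _; apply continuous_const).
  rewrite (J_const_hol _ r r').
  2: unfold r'; lra.
  2: { intros y Hy. apply hol2_div. apply Cminus_nz; simpl; lra. apply hol2_const.
       apply hol2_minus. apply hol2_fst. apply hol2_const. }
  assert (E0 : RtoC (2 * PI) = J (fun y => 1 / y)%C r').
  { unfold J. rewrite (CI_ext _ (fun _ => RtoC 1)), CI_const. rewrite Rminus_0_r. ring. lra.
    intros t _. field. split. apply cis_nz. apply RtoC_nz. unfold r'; lra. }
  assert (Hk0 : cts_circle (fun y => 1 / y)%C r').
  { intros y Hy. apply cts_div. apply Cmod_nz; unfold r' in *; lra. apply continuous_const. apply continuous_id. }
  assert (E1 : J (fun y => 1 / (y - z))%C r' = (J (fun y => 1 / y) r' + z * J (fun y => (1 / y) / (y - z)) r')%C).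
  { rewrite <- J_scal, <- J_plus; try (unfold r'; lra); auto.
    - apply J_ext. unfold r'; lra. intros y Hy. field. split.
      apply Cmod_nz; unfold r' in *; lra. apply Cminus_nz; unfold r' in *; lra.
    - intros y Hy. apply (cts_mult (fun _ => z)). apply continuous_const.
      apply (cts_circle_kernel (fun y => 1 / y)%C z r'); auto. unfold r'; lra.
    - apply (cts_circle_kernel (fun y => 1 / y)%C z r'); auto. unfold r'; lra. }
  rewrite E1, <- E0.
  match goal with |- Cmod (?a + ?b - ?a) <= _ => replace (a + b - a)%C with b by ring end.
  rewrite Cmod_mult.
  assert (B : Cmod (J (fun y => 1 / y / (y - z))%C r') <= 1 / r' / (r' - Cmod z) * r' * (2 * PI)).
  { apply J_le. unfold r'; lra.
    apply (cts_circle_kernel (fun y => 1 / y)%C z r'); auto; unfold r'; lra.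
    apply (kernel_le (fun y => 1 / y)%C). unfold r'; lra.
    intros y Hy. rewrite Cmod_div, Cmod_1, Hy. lra. apply Cmod_nz; unfold r' in *; lra. }
  replace (1 / r' / (r' - Cmod z) * r' * (2 * PI)) with (2 * PI / (r' - Cmod z)) in B by (field; unfold r'; lra).
  eapply Rle_trans. apply Rmult_le_compat_l. auto. exact B.
  assert (Hd : 0 < r' - Cmod z) by (unfold r'; lra).
  apply Rmult_le_reg_r with (r' - Cmod z); auto.
  replace (Cmod z * (2 * PI / (r' - Cmod z)) * (r' - Cmod z)) with (e * s) by (unfold s; field; lra).
  apply Rmult_le_compat_l; unfold r'; lra.
Qed.

Lemma J_kernel_1_in z r : 0 < r < Cmod z -> J (fun y => 1 / (y - z))%C r = 0.
Proof.
  intros [Hr Hz].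
  assert (Hh : forall y, 0 < Cmod y <= r -> hol1 (fun y => 1 / (y - z))%C y).
  { intros y Hy. apply hol2_div. apply Cminus_nz; simpl; lra. apply hol2_const.
       apply hol2_minus. apply hol2_fst. apply hol2_const. }
  apply (J_zero _ 0 r r (/ (Cmod z - r))); auto.
  - intros y Hy. apply hol1_cts. auto.
  - intros y Hy. rewrite Cmod_div, Cmod_1 by (apply Cminus_nz; lra). unfold Rdiv. rewrite Rmult_1_l.
    apply Rinv_le_contravar. lra. generalize (Cmod_rev_tri z y). rewrite Cmod_minus_sym. lra.
Qed.

(** The value [a] at [z] is left free, since differentiability provides the derivative only
    existentially. *)
Definition quot (f : C -> C) (z a : C) : C -> C :=
  fun y => if Ceq_dec y z then a else ((f y - f z) / (y - z))%C.

Lemma quot_hol f z a y : y <> z -> hol1 f y -> hol1 (quot f z a) y.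
Proof.
  intros Hn Hf. assert (H0 : 0 < Cmod (y - z)) by (apply Cmod_gt_0; intros E; apply Hn; now apply Ceq_minus).
  apply (hol2_ext (fun x => (f (fst x) - f z) / (fst x - z))%C _ _ (Cmod (y - z))); auto.
  - intros [x x'] Hx. unfold dist in Hx. simpl in *. unfold quot. destruct (Ceq_dec x z) as [->|]; auto.
    rewrite Cmod_minus_sym in Hx. generalize (Cmod_ge_0 (x' - 0)). lra.
  - apply hol2_div. simpl. now apply Cmod_gt_0. apply hol2_minus. exact Hf. apply hol2_const.
    apply hol2_minus. apply hol2_fst. apply hol2_const.
Qed.

Lemma quot_cts f z : hol1 f z -> exists a, cts (quot f z a) z.
Proof.
  intros H. destruct (hol1_spec _ _ H) as [a Ha]. exists a. apply continuous_C_eps. intros e He.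
  assert (He2 : 0 < e / 2) by lra. destruct (Ha _ He2) as [d [Hd K]].
  apply locally_C_eps. exists d. split; auto. intros y Hy. unfold quot.
  destruct (Ceq_dec z z) as [_|X]; [|now elim X].
  destruct (Ceq_dec y z) as [->|Hn]. rewrite Cmod_0_minus; lra.
  assert (H0 : (y - z)%C <> 0) by (intros E; apply Hn; now apply Ceq_minus).
  replace ((f y - f z) / (y - z) - a)%C with ((f y - f z - a * (y - z)) / (y - z))%C by (field; auto).
  rewrite Cmod_div by auto. apply Cmod_gt_0 in H0. apply Rle_lt_trans with (e / 2). 2: lra.
  apply Rmult_le_reg_r with (Cmod (y - z)); auto. unfold Rdiv at 1.
  rewrite Rmult_assoc, Rinv_l, Rmult_1_r by lra. now apply K.
Qed.

Lemma J_quot f z a r : 0 < r -> Cmod z <> r -> cts_circle f r ->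
  J (quot f z a) r = (J (fun y => f y / (y - z)) r - f z * J (fun y => 1 / (y - z)) r)%C.
Proof.
  intros Hr Hz Hf.
  replace (_ - _)%C with (J (fun y => f y / (y - z)) r + (- f z) * J (fun y => 1 / (y - z)) r)%C by ring.
  assert (H1 : cts_circle (fun y => 1 / (y - z))%C r).
  { apply (cts_circle_kernel (fun _ => RtoC 1)); auto. intros y _; apply continuous_const. }
  rewrite <- J_scal, <- J_plus; auto; try lra.
  - apply J_ext. lra. intros y Hy. unfold quot. destruct (Ceq_dec y z) as [->|Hn]. now elim Hz.
    field. apply Cminus_nz. lra.
  - now apply cts_circle_kernel.
  - intros y Hy. apply (cts_mult (fun _ => - f z)%C). apply continuous_const. now apply H1.
Qed.

(** The difference quotient at [z], filled continuously, has the same integral over both circles;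
    [J_const_exc] is applied with the circle through [z] as exception. Splitting the quotient leaves
    the kernel integrals, which are [2 * PI] for the outer circle and 0 for the inner one. *)
Lemma cauchy_annulus f z r1 r2 : 0 < r1 < Cmod z -> Cmod z < r2 ->
  (forall y, r1 <= Cmod y <= r2 -> hol1 f y) ->
  (J (fun y => f y / (y - z)) r2 - RtoC (2 * PI) * f z)%C = J (fun y => f y / (y - z))%C r1.
Proof.
  intros H1 H2 Hf. destruct (quot_cts f z) as [a Ha]. apply Hf; lra.
  assert (E : J (quot f z a) r1 = J (quot f z a) r2).
  { apply (J_const_exc _ (Cmod z)). lra.
    - intros y Hy. destruct (Ceq_dec y z) as [->|Hn]; auto. apply hol1_cts. apply quot_hol; auto.
    - intros y Hy Hn. apply quot_hol; auto. intros ->; now elim Hn. }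
  rewrite !J_quot in E; try lra; try (intros y Hy; apply hol1_cts, Hf; lra).
  rewrite (J_kernel_1_out z r2), (J_kernel_1_in z r1) in E by lra.
  rewrite Cmult_0_r, Cminus_0_r in E. rewrite E. ring.
Qed.

Lemma cauchy_disc f z R0 : Cmod z < R0 -> (forall y, Cmod y <= R0 -> hol1 f y) ->
  J (fun y => f y / (y - z))%C R0 = (RtoC (2 * PI) * f z)%C.
Proof.
  intros Hz Hf. assert (Hz0 := Cmod_ge_0 z). destruct (quot_cts f z) as [a Ha]. apply Hf; lra.
  assert (Hq : forall y, Cmod y <= R0 -> cts (quot f z a) y).
  { intros y Hy. destruct (Ceq_dec y z) as [->|Hn]; auto. apply hol1_cts. apply quot_hol; auto. }
  assert (Q0 := Hq (RtoC 0) ltac:(rewrite Cmod_0; lra)).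
  destruct (proj1 (locally_C_eps _ _) (proj1 (continuous_C_eps _ _) Q0 1 Rlt_0_1)) as [d [Hd H]].
  assert (E : J (quot f z a) R0 = 0).
  { apply (J_zero _ (Cmod z) R0 (d / 2) (Cmod (quot f z a 0) + 1)); try lra.
    - intros; apply Hq; lra.
    - intros y Hy Hn. apply quot_hol. intros ->; now elim Hn. apply Hf; lra.
    - intros y Hy. specialize (H y). rewrite Cminus_0_r in H. specialize (H ltac:(lra)).
      generalize (Cmod_rev_tri (quot f z a y) (quot f z a 0)). lra. }
  rewrite J_quot in E; try lra. 2: intros y Hy; apply hol1_cts, Hf; lra.
  rewrite J_kernel_1_out in E by lra. apply Ceq_minus. rewrite <- E. ring.
Qed.

(** One step of the geometric series, [1 / (y - z) = 1 / y + z / (y * (y - z))], under the integral.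
    Iterated, it gives Taylor's formula with an integral remainder. *)
Lemma J_geom u z r : 0 < r -> Cmod z <> r -> cts_circle u r ->
  J (fun y => u y / (y - z))%C r = (J (fun y => u y / y) r + z * J (fun y => (u y / y) / (y - z)) r)%C.
Proof.
  intros Hr Hz Hu.
  assert (H1 : cts_circle (fun y => u y / y)%C r).
  { intros y Hy. apply (cts_div u). apply Cmod_nz; lra. now apply Hu. apply continuous_id. }
  assert (H2 := cts_circle_kernel _ z r Hz H1). simpl in H2.
  rewrite <- J_scal, <- J_plus; auto; try lra.
  - apply J_ext. lra. intros y Hy. field. split. apply Cmod_nz; lra. apply Cminus_nz. lra.
  - intros y Hy. apply (cts_mult (fun _ => z)). apply continuous_const. now apply H2.
Qed.

(** * Taylor's estimate, the identity principle and moments *)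

Lemma cts_circle_div_pow f n r : 0 < r -> cts_circle f r -> cts_circle (fun y => f y / y ^ n)%C r.
Proof.
  intros Hr Hf y Hy. apply (cts_div f). apply Cpow_nz. apply Cmod_nz; lra. now apply Hf.
  apply (cts_pow (fun y => y)). apply continuous_id.
Qed.

Lemma J_div_pow_le f n r M : 0 < r -> cts_circle f r -> (forall y, Cmod y = r -> Cmod (f y) <= M) ->
  forall y, Cmod y = r -> Cmod (f y / y ^ n) <= M / r ^ n.
Proof.
  intros Hr Hf HM y Hy. rewrite Cmod_div, Cmod_pow, Hy. apply Rmult_le_compat_r; auto.
  left; apply Rinv_0_lt_compat. now apply pow_lt. apply Cpow_nz. apply Cmod_nz. lra.
Qed.

Lemma J_div_pow_S f n z r : 0 < r -> Cmod z <> r -> cts_circle f r ->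
  J (fun y => (f y / y ^ n) / (y - z))%C r =
  (J (fun y => f y / y ^ S n) r + z * J (fun y => (f y / y ^ S n) / (y - z)) r)%C.
Proof.
  intros Hr Hz Hf. rewrite (J_geom (fun y => f y / y ^ n)%C z r); auto. 2: now apply cts_circle_div_pow.
  assert (E : forall y, Cmod y = r -> (f y / y ^ n / y = f y / y ^ S n)%C).
  { intros y Hy. rewrite Cpow_S. field. split; [apply Cpow_nz|]; apply Cmod_nz; lra. }
  f_equal. apply J_ext; auto; lra. f_equal. apply J_ext. lra. intros y Hy. now rewrite E.
Qed.

(** Two geometric steps in Cauchy's formula leave the remainder [z ^ 2] times an integral, where
    [Cmod z <= R0 / 2] accounts for the factor 2. The constant depends on [M] and [R0] alone;
    differentiation under the integral sign relies on this uniformity. *)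
Lemma taylor_quadratic f R0 M a : 0 < R0 -> (forall y, Cmod y <= R0 -> hol1 f y) ->
  (forall y, Cmod y <= R0 -> Cmod (f y) <= M) ->
  (forall e, 0 < e -> exists d, 0 < d /\ forall y, Cmod y < d ->
    Cmod (f y - f 0 - a * y) <= e * Cmod y) ->
  forall z, Cmod z <= R0 / 2 -> Cmod (f z - f 0 - a * z) <= 2 * M * (Cmod z) ^ 2 / R0 ^ 2.
Proof.
  intros HR Hf HM Ha.
  assert (Hp := two_PI_pos).
  assert (HM0 : 0 <= M) by (eapply Rle_trans; [apply (Cmod_ge_0 (f 0)) | apply HM; rewrite Cmod_0; lra]).
  assert (Hc : cts_circle f R0) by (intros y Hy; apply hol1_cts, Hf; lra).
  assert (HpC : RtoC (2 * PI) <> 0) by (intros E; apply RtoC_inj in E; lra).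
  assert (Ex : forall z, Cmod z < R0 -> (RtoC (2 * PI) * f z = J (fun y => f y / y ^ 1) R0 +
     z * (J (fun y => f y / y ^ 2) R0 + z * J (fun y => (f y / y ^ 2) / (y - z)) R0))%C).
  { intros z Hz. rewrite <- J_div_pow_S, <- J_div_pow_S; auto; try lra.
    rewrite <- cauchy_disc with (R0 := R0); auto. apply J_ext. lra. intros y Hy. simpl. field.
    apply Cminus_nz; lra. }
  set (c := (J (fun y => f y / y ^ 2) R0 / RtoC (2 * PI))%C).
  assert (Q : forall z, Cmod z <= R0 / 2 -> Cmod (f z - f 0 - c * z) <= 2 * M * (Cmod z) ^ 2 / R0 ^ 2).
  { intros z Hz.
    assert (E0 := Ex (RtoC 0) ltac:(rewrite Cmod_0; lra)). rewrite Cmult_0_l, Cplus_0_r in E0.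
    assert (E1 := Ex z ltac:(lra)). rewrite <- E0 in E1.
    replace (f z - f 0 - c * z)%C with (z * z * J (fun y => (f y / y ^ 2) / (y - z)) R0 / RtoC (2 * PI))%C.
    2: { replace (f z) with (RtoC (2 * PI) * f z / RtoC (2 * PI))%C by (field; auto).
         rewrite E1. unfold c. field; auto. }
    rewrite Cmod_div, !Cmod_mult, Cmod_R, Rabs_pos_eq; auto; try lra.
    assert (B : Cmod (J (fun y => f y / y ^ 2 / (y - z))%C R0) <= M / R0 ^ 2 / (R0 - Cmod z) * R0 * (2 * PI)).
    { apply J_le. lra. apply (cts_circle_kernel (fun y => f y / y ^ 2)%C). lra. now apply cts_circle_div_pow.
      apply (kernel_le (fun y => f y / y ^ 2)%C). lra. apply J_div_pow_le; auto. intros; apply HM; lra. }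
    assert (B2 : M / R0 ^ 2 / (R0 - Cmod z) * R0 <= 2 * M / R0 ^ 2).
    { assert (/ (R0 - Cmod z) <= / (R0 / 2)) by (apply Rinv_le_contravar; lra).
      replace (M / R0 ^ 2 / (R0 - Cmod z) * R0) with (M / R0 ^ 2 * R0 * / (R0 - Cmod z)) by (field; lra).
      replace (2 * M / R0 ^ 2) with (M / R0 ^ 2 * R0 * / (R0 / 2)) by (field; lra).
      apply Rmult_le_compat_l; auto. repeat apply Rmult_le_pos; try lra.
      left; apply Rinv_0_lt_compat; apply pow_lt; lra. }
    set (j := Cmod (J _ _)) in *. assert (0 <= Cmod z) by apply Cmod_ge_0.
    apply Rmult_le_reg_r with (2 * PI); auto.
    replace (Cmod z * Cmod z * j / (2 * PI) * (2 * PI)) with (Cmod z ^ 2 * j) by (field; lra).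
    replace (2 * M * Cmod z ^ 2 / R0 ^ 2 * (2 * PI)) with (Cmod z ^ 2 * (2 * M / R0 ^ 2 * (2 * PI))) by (field; lra).
    apply Rmult_le_compat_l. apply pow_le; auto.
    eapply Rle_trans. exact B. apply Rmult_le_compat_r; lra. }
  (* The Cauchy coefficient [c] has just been shown to be a derivative at 0, and [a] is one by
     assumption. They are compared at a real point [t] so small that both errors are at most
     [e / 2 * t]. *)
  replace a with c; auto.
  apply Cmod_small_eq. intros e He. assert (He2 : 0 < e / 2) by lra.
  destruct (Ha _ He2) as [d [Hd Hda]].
  set (K := 2 * M / R0 ^ 2).
  assert (HK : 0 <= K) by (apply Rmult_le_pos; [lra | left; apply Rinv_0_lt_compat, pow_lt; lra]).
  set (t := Rmin (Rmin (d / 2) (R0 / 2)) (e / 2 / (K + 1))).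
  assert (Ht0 : 0 < t) by (repeat apply Rmin_glb_lt; try lra; apply Rdiv_lt_0_compat; lra).
  assert (Ht1 : t <= Rmin (d / 2) (R0 / 2)) by apply Rmin_l.
  assert (Ht2 : t <= d / 2) by (eapply Rle_trans; [exact Ht1 | apply Rmin_l]).
  assert (Ht3 : t <= R0 / 2) by (eapply Rle_trans; [exact Ht1 | apply Rmin_r]).
  assert (Ht4 : t <= e / 2 / (K + 1)) by apply Rmin_r.
  assert (Et : Cmod (RtoC t) = t) by (rewrite Cmod_R, Rabs_pos_eq; lra).
  specialize (Hda (RtoC t) ltac:(lra)). specialize (Q (RtoC t) ltac:(lra)). rewrite Et in *.
  replace (2 * M * t ^ 2 / R0 ^ 2) with (K * t * t) in Q by (unfold K; field; lra).
  assert (K * t <= e / 2).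
  { apply Rle_trans with ((K + 1) * (e / 2 / (K + 1))). apply Rmult_le_compat; lra. right; field; lra. }
  apply Rmult_le_reg_r with t; auto.
  rewrite <- Et at 1. rewrite <- Cmod_mult.
  replace ((c - a) * RtoC t)%C with ((f t - f 0 - a * RtoC t) - (f t - f 0 - c * RtoC t))%C by ring.
  eapply Rle_trans. apply Cmod_minus_le. nra.
Qed.

(** Zeros accumulating at 0 kill the Taylor coefficients one by one, so that [f z] equals [z ^ n]
    times a Cauchy integral for every [n]. The latter is of order [/ R0 ^ n], hence [f z] is of
    order [(Cmod z / R0) ^ n] for all [n]. *)
Lemma identity_zero f R0 : 0 < R0 -> (forall y, Cmod y <= R0 -> hol1 f y) ->
  (forall e, 0 < e -> exists z : C, 0 < Cmod z < e /\ f z = 0) ->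
  forall z, Cmod z < R0 -> f z = 0.
Proof.
  intros HR Hf Hz.
  assert (Hp := two_PI_pos).
  assert (Hc : cts_circle f R0) by (intros y Hy; apply hol1_cts, Hf; lra).
  assert (HpC : RtoC (2 * PI) <> 0) by (intros E; apply RtoC_inj in E; lra).
  destruct (circle_bound f R0 ltac:(lra) Hc) as [M [HM0 HM]].
  assert (B : forall n z, Cmod z < R0 -> Cmod (J (fun y => f y / y ^ n / (y - z))%C R0) <=
    M / R0 ^ n / (R0 - Cmod z) * R0 * (2 * PI)).
  { intros n z Hz1. apply J_le. lra. apply (cts_circle_kernel (fun y => f y / y ^ n)%C). lra. now apply cts_circle_div_pow.
    apply (kernel_le (fun y => f y / y ^ n)%C). lra. now apply J_div_pow_le. }
  assert (Ex : forall n z, Cmod z < R0 -> (RtoC (2 * PI) * f z = z ^ n * J (fun y => (f y / y ^ n) / (y - z)) R0)%C).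
  { induction n as [|n IH]; intros z Hz1.
    - rewrite <- cauchy_disc with (R0 := R0); auto. simpl. rewrite Cmult_1_l.
      apply J_ext. lra. intros y Hy. field. apply Cminus_nz; lra.
    - assert (IH' : forall z, Cmod z < R0 -> (RtoC (2 * PI) * f z = z ^ n *
        (J (fun y => f y / y ^ S n) R0 + z * J (fun y => (f y / y ^ S n) / (y - z)) R0))%C).
      { intros w Hw. rewrite <- J_div_pow_S; auto. lra. }
      clear IH. rewrite IH'; auto. rewrite Cpow_S.
      replace (J (fun y => f y / y ^ S n) R0)%C with (RtoC 0). ring.
      (* At a zero [w] of [f] other than 0 the factor [w ^ n] can be divided out, leaving
         [c = - w * j] with [j] bounded by [K]; as [w] tends to 0, so does this. *)
      symmetry. set (c := J _ _) in *.
      set (K := M / R0 ^ S n / (R0 / 2) * R0 * (2 * PI)).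
      assert (HR1 : 0 < R0 ^ S n) by (now apply pow_lt).
      assert (HK : 0 < K) by (unfold K; rpos).
      apply Cmod_small_eq. intros e He. rewrite Cminus_0_r.
      destruct (Hz (Rmin (R0 / 2) (e / K))) as [w [[Hw0 Hw] Hfw]].
      { apply Rmin_glb_lt. lra. now apply Rdiv_lt_0_compat. }
      assert (W1 := Rlt_le_trans _ _ _ Hw (Rmin_l _ _)). assert (W2 := Rlt_le_trans _ _ _ Hw (Rmin_r _ _)).
      specialize (IH' w ltac:(lra)). rewrite Hfw, Cmult_0_r in IH'.
      assert (Hwn : (w ^ n)%C <> 0) by (apply Cpow_nz, Cmod_nz; lra).
      specialize (B (S n) w ltac:(lra)). set (j := J (fun y => f y / y ^ S n / (y - w))%C R0) in *.
      assert (Ec : c = (- (w * j))%C).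
      { apply Ceq_minus. replace (c - - (w * j))%C with (w ^ n * (c + w * j) / w ^ n)%C by (field; auto).
        rewrite <- IH'. field; auto. }
      rewrite Ec, Cmod_opp, Cmod_mult.
      assert (Cmod j <= K).
      { eapply Rle_trans. exact B. unfold K. apply Rmult_le_compat_r. lra. apply Rmult_le_compat_r. lra.
        apply Rmult_le_compat_l. left; apply Rdiv_lt_0_compat; lra. apply Rinv_le_contravar; lra. }
      apply Rle_trans with (e / K * K). 2: right; field; lra.
      apply Rmult_le_compat; try lra. apply Cmod_ge_0. }
  intros z Hz1. assert (Hz0 := Cmod_ge_0 z). apply Cmod_small_eq. intros e He. rewrite Cminus_0_r.
  set (K := M / (R0 - Cmod z) * R0).
  assert (HK : 0 < K) by (unfold K; rpos).
  assert (Hq0 : 0 <= Cmod z / R0) by (apply Rmult_le_pos; [lra | left; now apply Rinv_0_lt_compat]).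
  assert (Hq1 : Cmod z / R0 < 1) by (apply Rmult_lt_reg_r with R0; auto; unfold Rdiv; rewrite Rmult_assoc, Rinv_l; lra).
  destruct (pow_lt_1_zero (Cmod z / R0) ltac:(rewrite Rabs_pos_eq; lra) (e / K) ltac:(now apply Rdiv_lt_0_compat)) as [n Hn].
  specialize (Hn n (Nat.le_refl _)). rewrite Rabs_pos_eq in Hn by now apply pow_le.
  assert (Hr0 : 0 < R0 ^ n) by now apply pow_lt.
  assert (E := Ex n z Hz1). specialize (B n z Hz1). apply (f_equal Cmod) in E.
  rewrite !Cmod_mult, Cmod_R, Cmod_pow, Rabs_pos_eq in E by lra.
  apply Rmult_le_reg_l with (2 * PI); auto. rewrite E.
  eapply Rle_trans. apply Rmult_le_compat_l. apply pow_le; auto. exact B.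
  replace (Cmod z ^ n * (M / R0 ^ n / (R0 - Cmod z) * R0 * (2 * PI))) with
    (2 * PI * ((Cmod z / R0) ^ n * K)).
  2: { unfold K, Rdiv. rewrite Rpow_mult_distr, pow_inv. field. lra. }
  apply Rmult_le_compat_l. lra. apply Rle_trans with (e / K * K).
  apply Rmult_le_compat_r; lra. right; field; lra.
Qed.

(** Expansion of the Cauchy integral at infinity. As [y ^ S n - z * y ^ n = y ^ n * (y - z)], each
    vanishing moment trades a factor [z] outside the integral for a factor [y] inside. After [n]
    trades the integral is of order [(r / Cmod z) ^ n]. *)
Lemma J_kernel_zero_moments u z r : 0 < r < Cmod z -> cts_circle u r ->
  (forall n : nat, J (fun y => u y * y ^ n)%C r = 0) -> J (fun y => u y / (y - z))%C r = 0.
Proof.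
  intros [Hr Hz] Hu Hm. assert (Hp := two_PI_pos).
  destruct (circle_bound u r ltac:(lra) Hu) as [M [HM0 HM]].
  assert (Hun : forall n, cts_circle (fun y => u y * y ^ n)%C r).
  { intros n y Hy. apply cts_mult. now apply Hu. apply cts_pow, continuous_id. }
  assert (Hzn : z <> 0) by (apply Cmod_nz; lra).
  assert (E : forall n, (z ^ n * J (fun y => u y / (y - z)) r = J (fun y => (u y * y ^ n) / (y - z)) r)%C).
  { induction n as [|n IH].
    - simpl. rewrite Cmult_1_l. apply J_ext. lra. intros y Hy. field. apply Cminus_nz; lra.
    - rewrite Cpow_S, <- Cmult_assoc, IH.
      assert (E : J (fun y => u y * y ^ n)%C r = (J (fun y => (u y * y ^ S n) / (y - z)) r + (- z) * J (fun y => (u y * y ^ n) / (y - z)) r)%C).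
      { rewrite <- J_scal, <- J_plus; try lra.
        - apply J_ext. lra. intros y Hy. rewrite Cpow_S. field. apply Cminus_nz; lra.
        - apply (cts_circle_kernel (fun y => u y * y ^ S n)%C); auto; lra.
        - intros y Hy. apply (cts_mult (fun _ => - z)%C). apply continuous_const.
          apply (cts_circle_kernel (fun y => u y * y ^ n)%C z r); auto; lra.
        - apply (cts_circle_kernel (fun y => u y * y ^ n)%C); auto; lra. }
      rewrite Hm in E. symmetry. apply Ceq_minus. rewrite E. ring. }
  apply Cmod_small_eq. intros e He. rewrite Cminus_0_r.
  set (K := M / (Cmod z - r) * r * (2 * PI)).
  assert (HK : 0 < K) by (unfold K; rpos).
  set (q := r / Cmod z).
  assert (Hq0 : 0 < q) by (apply Rdiv_lt_0_compat; lra).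
  assert (Hq1 : q < 1) by (apply Rmult_lt_reg_r with (Cmod z); try lra; unfold q, Rdiv; rewrite Rmult_assoc, Rinv_l; lra).
  destruct (pow_lt_1_zero q ltac:(rewrite Rabs_pos_eq; lra) (e / K) ltac:(now apply Rdiv_lt_0_compat)) as [n Hn].
  specialize (Hn n (Nat.le_refl _)). rewrite Rabs_pos_eq in Hn by (apply pow_le; lra).
  assert (Hz0 : 0 < Cmod z ^ n) by (apply pow_lt; lra).
  assert (B : Cmod (J (fun y => u y * y ^ n / (y - z))%C r) <= M * r ^ n / (Cmod z - r) * r * (2 * PI)).
  { apply J_le. lra. apply (cts_circle_kernel (fun y => u y * y ^ n)%C); auto; lra.
    intros y Hy. rewrite Cmod_div, Cmod_mult, Cmod_pow, Hy by (apply Cminus_nz; lra).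
    generalize (Cmod_rev_tri z y). rewrite Cmod_minus_sym. intros.
    apply Rmult_le_compat.
    - apply Rmult_le_pos. apply Cmod_ge_0. apply pow_le; lra.
    - left; apply Rinv_0_lt_compat; lra.
    - apply Rmult_le_compat_r; auto. apply pow_le; lra.
    - apply Rinv_le_contravar; lra. }
  rewrite <- E, Cmod_mult, Cmod_pow in B.
  apply Rmult_le_reg_l with (Cmod z ^ n); auto. eapply Rle_trans. exact B.
  replace (M * r ^ n / (Cmod z - r) * r * (2 * PI)) with (Cmod z ^ n * (q ^ n * K)).
  2: { unfold q, K, Rdiv. rewrite Rpow_mult_distr, pow_inv. field. lra. }
  apply Rmult_le_compat_l. lra. apply Rle_trans with (e / K * K).
  apply Rmult_le_compat_r; lra. right; field; lra.
Qed.

(** * Holomorphic dependence on a parameter *)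

Lemma cts_uniform_limit (u : R -> C) :
  (forall e, 0 < e -> exists g : R -> C, (forall t, cts g t) /\ forall t, Cmod (u t - g t) <= e) ->
  forall t, cts u t.
Proof.
  intros H t. apply continuous_C_eps. intros e He.
  destruct (H (e / 4) ltac:(lra)) as [g [Hg Hu]].
  generalize (proj1 (continuous_C_eps g t) (Hg t) (e / 4) ltac:(lra)). apply filter_imp. intros s Hs.
  assert (H1 := Hu s). assert (H2 := Hu t). rewrite Cmod_minus_sym in H2.
  assert (H3 := Cmod_minus_tri (g s) (u s) (u t)). assert (H4 := Cmod_minus_tri (g t) (g s) (u t)). lra.
Qed.

Section ParamIntegral.

Variables (k : R -> C * C -> C) (x0 : C * C) (r0 M : R).
Hypothesis Hr0 : 0 < r0.
Hypothesis Hhol : forall t x, dist x x0 < r0 -> hol2 (k t) x.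
Hypothesis HM : forall t x, dist x x0 < r0 -> Cmod (k t x) <= M.
Hypothesis Hcts : forall x, dist x x0 < r0 -> forall t, cts (fun t => k t x) t.

(** The gradient of [k t] at [x0], pinned down by a quadratic error whose constant does not involve
    [t], so that the error can be integrated. *)
Let kd_spec (t : R) (d : C * C) : Prop :=
  forall x, dist x x0 <= r0 / 4 ->
    Cmod (k t x - k t x0 - (fst d * (fst x - fst x0) + snd d * (snd x - snd x0))) <=
    8 * M / r0 ^ 2 * (dist x x0) ^ 2.

(** Restriction to the complex line through [x0] and [x] reduces the claim to the one-variable
    Taylor estimate at [u = 1]. *)
Lemma kernel_quadratic t : exists d, kd_spec t d.
Proof.
  destruct (Hhol t x0) as [a [b Hab]]. rewrite dist_refl; lra.
  exists (a, b). intros x Hx. simpl.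
  set (m := dist x x0) in *. assert (Hm := dist_ge_0 x x0). fold m in Hm.
  destruct (Req_dec m 0) as [Hm0|Hm0].
  { apply dist_0 in Hm0. subst x. replace (_ - _ - _)%C with (RtoC 0) by ring. rewrite Cmod_0.
    unfold m. rewrite dist_refl. lra. }
  assert (Hmp : 0 < m) by lra.
  set (l := fun u : C => (fst x0 + u * (fst x - fst x0), snd x0 + u * (snd x - snd x0))%C).
  assert (Dl : forall u, dist (l u) x0 = Cmod u * m).
  { intros u. unfold dist, l, m, dist. simpl. rewrite Rmult_plus_distr_l, <- !Cmod_mult.
    f_equal; f_equal; ring. }
  (* For [Cmod u <= R1] the line stays within [r0 / 2] of [x0], and [m <= r0 / 4] amounts to
     [1 <= R1 / 2]. The resulting constant [2 * M / R1 ^ 2] is [8 * M / r0 ^ 2 * m ^ 2]. *)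
  set (R1 := r0 / (2 * m)). assert (HR1 : 0 < R1) by (unfold R1; rpos).
  assert (Dl2 : forall u, Cmod u <= R1 -> dist (l u) x0 < r0).
  { intros u Hu. rewrite Dl. apply Rle_lt_trans with (R1 * m). apply Rmult_le_compat_r; lra.
    unfold R1. replace (r0 / (2 * m) * m) with (r0 / 2) by (field; lra). lra. }
  assert (T := taylor_quadratic (fun u => k t (l u)) R1 M (a * (fst x - fst x0) + b * (snd x - snd x0))%C HR1).
  assert (H1 : Cmod (RtoC 1) <= R1 / 2).
  { rewrite Cmod_1. unfold R1. apply Rmult_le_reg_r with (4 * m). lra.
    replace (r0 / (2 * m) / 2 * (4 * m)) with r0 by (field; lra). lra. }
  specialize (fun A B C => T A B C _ H1). rewrite Cmod_1 in T. simpl in T.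
  assert (E1 : l (RtoC 1) = x) by (apply injective_projections; unfold l; simpl; ring).
  assert (E0 : l (RtoC 0) = x0) by (apply injective_projections; unfold l; simpl; ring).
  rewrite E1, E0, Cmult_1_r in T.
  eapply Rle_trans; [apply T | right; unfold R1; field; lra].
  - intros u Hu. apply (hol1_hol2 (k t) (fun u => fst (l u)) (fun u => snd (l u))).
    + rewrite <- surjective_pairing. apply Hhol. auto.
    + apply hol2_plus. apply hol2_const. apply hol2_mult. apply hol2_fst. apply hol2_const.
    + apply hol2_plus. apply hol2_const. apply hol2_mult. apply hol2_fst. apply hol2_const.
  - intros u Hu. apply HM. auto.
  - intros e He. destruct (Hab (e / m)) as [d [Hd Hd2]]. rpos.
    exists (d / m). split. rpos. intros u Hu. specialize (Hd2 (l u)). rewrite Dl in Hd2.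
    assert (Hum : Cmod u * m < d).
    { replace d with (d / m * m) by (field; lra). now apply Rmult_lt_compat_r. }
    specialize (Hd2 Hum). replace (e / m * (Cmod u * m)) with (e * Cmod u) in Hd2 by (field; lra).
    rewrite <- E0 in Hd2 at 1.
    eapply Rle_trans; [right | exact Hd2]. f_equal. rewrite E0. f_equal. unfold l. simpl. ring.
Qed.

Let kd (t : R) : C * C := epsilon (inhabits (RtoC 0, RtoC 0)) (kd_spec t).

Lemma kd_correct t : kd_spec t (kd t).
Proof. apply epsilon_spec. apply kernel_quadratic. Qed.

(* The derivative is a uniform limit of difference quotients. *)
Lemma kd_cts t : cts (fun t => fst (kd t)) t /\ cts (fun t => snd (kd t)) t.
Proof.
  assert (HM0 : 0 <= M).
  { eapply Rle_trans. apply (Cmod_ge_0 (k 0 x0)). apply HM. rewrite dist_refl; lra. }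
  set (K := 8 * M / r0 ^ 2).
  assert (HK : 0 <= K) by (apply Rmult_le_pos; [lra | left; rpos]).
  assert (Hs : forall e, 0 < e -> exists s, 0 < s /\ s <= r0 / 4 /\ K * s <= e).
  { intros e He. exists (Rmin (r0 / 4) (e / (K + 1))).
    assert (0 < e / (K + 1)) by rpos.
    split. apply Rmin_glb_lt; lra. split. apply Rmin_l.
    apply Rle_trans with ((K + 1) * (e / (K + 1))). apply Rmult_le_compat; try lra.
    apply Rmin_glb; lra. apply Rmin_r. right; field; lra. }
  split; revert t; apply cts_uniform_limit; intros e He; destruct (Hs e He) as [s [Hs0 [Hs1 Hs2]]];
    assert (Es : Cmod (RtoC s) = s) by (rewrite Cmod_R, Rabs_pos_eq; lra);
    assert (Esn : RtoC s <> 0) by (apply RtoC_nz; lra).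
  - set (x := ((fst x0 + RtoC s)%C, snd x0)).
    assert (Dx : dist x x0 = s).
    { unfold dist, x. simpl. rewrite Cmod_0_minus, Rplus_0_r. transitivity (Cmod (RtoC s)); [f_equal; ring | exact Es]. }
    exists (fun t => (k t x - k t x0) / RtoC s)%C. split.
    + intros t. apply (cts_div (fun t => k t x - k t x0)%C (fun _ => RtoC s)); auto.
      * apply (cts_minus (fun t => k t x) (fun t => k t x0)); apply Hcts. lra. rewrite dist_refl; lra.
      * apply continuous_const.
    + intros t. assert (Q := kd_correct t x ltac:(lra)). fold K in Q. rewrite Dx in Q.
      unfold x at 2 3 in Q. simpl in Q.
      replace (fst (kd t) - (k t x - k t x0) / RtoC s)%C with
        (- (k t x - k t x0 - (fst (kd t) * (fst x0 + s - fst x0) + snd (kd t) * (snd x0 - snd x0))) / RtoC s)%C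
        by (field; auto).
      rewrite Cmod_div, Cmod_opp, Es by auto. apply Rmult_le_reg_r with s; auto.
      unfold Rdiv. rewrite Rmult_assoc, Rinv_l, Rmult_1_r by lra. eapply Rle_trans. exact Q.
      nra.
  - set (x := (fst x0, (snd x0 + RtoC s)%C)).
    assert (Dx : dist x x0 = s).
    { unfold dist, x. simpl. rewrite Cmod_0_minus, Rplus_0_l. transitivity (Cmod (RtoC s)); [f_equal; ring | exact Es]. }
    exists (fun t => (k t x - k t x0) / RtoC s)%C. split.
    + intros t. apply (cts_div (fun t => k t x - k t x0)%C (fun _ => RtoC s)); auto.
      * apply (cts_minus (fun t => k t x) (fun t => k t x0)); apply Hcts. lra. rewrite dist_refl; lra.
      * apply continuous_const.
    + intros t. assert (Q := kd_correct t x ltac:(lra)). fold K in Q. rewrite Dx in Q.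
      unfold x at 2 3 in Q. simpl in Q.
      replace (snd (kd t) - (k t x - k t x0) / RtoC s)%C with
        (- (k t x - k t x0 - (fst (kd t) * (fst x0 - fst x0) + snd (kd t) * (snd x0 + s - snd x0))) / RtoC s)%C
        by (field; auto).
      rewrite Cmod_div, Cmod_opp, Es by auto. apply Rmult_le_reg_r with s; auto.
      unfold Rdiv. rewrite Rmult_assoc, Rinv_l, Rmult_1_r by lra. eapply Rle_trans. exact Q.
      nra.
Qed.

(** The integrals of the partial derivatives are the partial derivatives of the integral, because
    the quadratic error is uniform in [t]. This serves both the deformation integrals and the Cauchy
    integral that extends [f]. *)
Lemma param_int_hol : hol2 (fun x => CI (fun t => k t x) 0 (2 * PI)) x0.
Proof.
  assert (Hp := two_PI_pos). assert (Hp' := Rlt_le _ _ Hp).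
  assert (HM0 : 0 <= M).
  { eapply Rle_trans. apply (Cmod_ge_0 (k 0 x0)). apply HM. rewrite dist_refl; lra. }
  set (K := 8 * M / r0 ^ 2).
  assert (HK : 0 <= K) by (apply Rmult_le_pos; [lra | left; rpos]).
  exists (CI (fun t => fst (kd t)) 0 (2 * PI)), (CI (fun t => snd (kd t)) 0 (2 * PI)). intros e He.
  set (s := e / ((K + 1) * (2 * PI))). assert (Hs : 0 < s) by (unfold s; rpos).
  exists (Rmin (r0 / 4) s). split. apply Rmin_glb_lt; lra.
  intros x Hx. assert (X1 := Rlt_le_trans _ _ _ Hx (Rmin_l _ _)). assert (X2 := Rlt_le_trans _ _ _ Hx (Rmin_r _ _)).
  set (u := (fst x - fst x0)%C). set (w := (snd x - snd x0)%C).
  assert (C1 : cts_on (fun t => k t x) 0 (2 * PI)) by (intros t _; apply Hcts; lra).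
  assert (C2 : cts_on (fun t => k t x0) 0 (2 * PI)) by (intros t _; apply Hcts; rewrite dist_refl; lra).
  assert (C3 : cts_on (fun t => fst (kd t)) 0 (2 * PI)) by (intros t _; apply kd_cts).
  assert (C4 : cts_on (fun t => snd (kd t)) 0 (2 * PI)) by (intros t _; apply kd_cts).
  assert (C5 : cts_on (fun t => u * fst (kd t))%C 0 (2 * PI)).
  { intros t Ht. apply (cts_mult (fun _ => u)). apply continuous_const. now apply C3. }
  assert (C6 : cts_on (fun t => w * snd (kd t))%C 0 (2 * PI)).
  { intros t Ht. apply (cts_mult (fun _ => w)). apply continuous_const. now apply C4. }
  assert (C7 : cts_on (fun t => k t x - k t x0)%C 0 (2 * PI)).
  { intros t Ht. apply (cts_minus (fun t => k t x)); auto. }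
  assert (C8 : cts_on (fun t => u * fst (kd t) + w * snd (kd t))%C 0 (2 * PI)).
  { intros t Ht. apply (cts_plus (fun t => u * fst (kd t))%C); auto. }
  rewrite (Cmult_comm _ u), (Cmult_comm _ w).
  rewrite <- !CI_scal by assumption. rewrite <- CI_plus by assumption.
  rewrite <- CI_minus by assumption. rewrite <- CI_minus by assumption.
  assert (Hd := dist_ge_0 x x0).
  replace (e * dist x x0) with (e * dist x x0 / (2 * PI) * (2 * PI - 0)) by (field; lra).
  apply CI_le; auto.
  - intros t Ht. apply (cts_minus (fun t => k t x - k t x0)%C); auto.
  - intros t _. assert (Q := kd_correct t x ltac:(lra)). fold K in Q.
    eapply Rle_trans. 2: eapply Rle_trans. 2: exact Q.
    right; f_equal; unfold u, w; ring.
    replace (e * dist x x0 / (2 * PI)) with ((K + 1) * (s * dist x x0)) by (unfold s; field; lra).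
    simpl. rewrite Rmult_1_r. apply Rmult_le_compat; try lra. now apply Rmult_le_pos.
    apply Rmult_le_compat_r; lra.
Qed.

End ParamIntegral.

(** * Analytic continuation along a segment of loops *)

Definition eps_open (O : C * C -> Prop) : Prop :=
  forall p, O p -> exists d, 0 < d /\ forall x, dist x p < d -> O x.

Section Segment.

Variables (O : C * C -> Prop) (h : C * C -> C) (p0 p1 q0 q1 : C -> C).
Hypothesis HO : eps_open O.
Hypothesis Hh : forall x, O x -> hol2 h x.
Hypothesis Hp0 : cts_circle p0 1.
Hypothesis Hp1 : cts_circle p1 1.
Hypothesis Hq0 : cts_circle q0 1.
Hypothesis Hq1 : cts_circle q1 1.

(** The parameter is complex so that integrals can be differentiated in it, although only real
    values in [[0, 1]] are assumed to keep the loop in [O]. *)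
Definition seg (tau z : C) : C * C :=
  (p0 z + tau * (p1 z - p0 z), q0 z + tau * (q1 z - q0 z))%C.

Hypothesis Hseg : forall (tau : R) z, 0 <= tau <= 1 -> Cmod z = 1 -> O (seg (RtoC tau) z).

Lemma seg_comp_cts (a b : C -> C) z (tau : C) : cts a z -> cts b z ->
  cts (fun y : C * C => a (snd y) + fst y * (b (snd y) - a (snd y)))%C (tau, z).
Proof.
  intros Ha Hb.
  assert (A : cts (fun y : C * C => a (snd y)) (tau, z)) by (apply (continuous_comp snd a); [apply continuous_snd | exact Ha]).
  assert (B : cts (fun y : C * C => b (snd y)) (tau, z)) by (apply (continuous_comp snd b); [apply continuous_snd | exact Hb]).
  apply (cts_plus (fun y : C * C => a (snd y))); auto.
  apply (cts_mult (fun y : C * C => fst y)). apply continuous_fst.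
  apply (cts_minus (fun y : C * C => b (snd y))); auto.
Qed.

Lemma seg_near (tau z : C) : Cmod z = 1 -> forall e, 0 < e -> exists d, 0 < d /\
  forall tau' z' : C, Cmod (tau' - tau) < d -> Cmod (z' - z) < d -> dist (seg tau' z') (seg tau z) < e.
Proof.
  intros Hz e He.
  assert (H1 := proj1 (continuous_C_eps _ _) (seg_comp_cts p0 p1 z tau (Hp0 z Hz) (Hp1 z Hz)) (e / 2) ltac:(lra)).
  assert (H2 := proj1 (continuous_C_eps _ _) (seg_comp_cts q0 q1 z tau (Hq0 z Hz) (Hq1 z Hz)) (e / 2) ltac:(lra)).
  apply locally_CC_eps in H1. apply locally_CC_eps in H2.
  destruct H1 as [d1 [Hd1 H1]]. destruct H2 as [d2 [Hd2 H2]].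
  exists (Rmin d1 d2 / 2). assert (B1 := Rmin_l d1 d2). assert (B2 := Rmin_r d1 d2).
  assert (B3 : 0 < Rmin d1 d2) by now apply Rmin_glb_lt.
  split. lra. intros tau' z' Ht' Hz'.
  assert (D : dist (tau', z') (tau, z) < Rmin d1 d2) by (unfold dist; simpl; lra).
  specialize (H1 (tau', z') (Rlt_le_trans _ _ _ D B1)). specialize (H2 (tau', z') (Rlt_le_trans _ _ _ D B2)). simpl in H1, H2.
  unfold dist, seg. simpl. lra.
Qed.

(** Compactness of the circle thickens the real parameter [t0] to a complex disc on which the loops
    stay in [O] and [h] stays bounded along them. *)
Lemma seg_unif (t0 : R) : 0 <= t0 <= 1 -> exists d, 0 < d /\ forall z tau : C, Cmod z = 1 -> Cmod (tau - RtoC t0) < d ->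
  O (seg tau z) /\ Cmod (h (seg tau z)) <= / d.
Proof.
  intros Ht.
  destruct (circle_unif (fun z d => forall tau, Cmod (tau - RtoC t0) < d -> O (seg tau z) /\ Cmod (h (seg tau z)) <= / d)) as [d [Hd H]].
  - intros z d d' Hd H tau Htau. destruct (H tau ltac:(lra)) as [A B]. split; auto.
    eapply Rle_trans. exact B. apply Rinv_le_contravar; lra.
  - intros z Hz. assert (Oz := Hseg t0 z Ht Hz).
    destruct (HO _ Oz) as [d1 [Hd1 H1]].
    destruct (hol2_cont _ _ (Hh _ Oz) 1 Rlt_0_1) as [d2 [Hd2 H2]].
    destruct (seg_near (RtoC t0) z Hz (Rmin d1 d2) ltac:(now apply Rmin_glb_lt)) as [d3 [Hd3 H3]].
    set (N := Cmod (h (seg (RtoC t0) z)) + 1).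
    assert (HN : 0 < N) by (unfold N; generalize (Cmod_ge_0 (h (seg (RtoC t0) z))); lra).
    assert (HN' : 0 < / N) by now apply Rinv_0_lt_compat.
    exists (Rmin d3 (/ N)). split. now apply Rmin_glb_lt.
    intros y Hy Hyz tau Htau.
    specialize (H3 tau y (Rlt_le_trans _ _ _ Htau (Rmin_l _ _)) (Rlt_le_trans _ _ _ Hyz (Rmin_l _ _))).
    split. apply H1. eapply Rlt_le_trans. exact H3. apply Rmin_l.
    specialize (H2 _ (Rlt_le_trans _ _ _ H3 (Rmin_r _ _))).
    apply Rle_trans with N.
    + unfold N. generalize (Cmod_rev_tri (h (seg tau y)) (h (seg (RtoC t0) z))). lra.
    + apply Rle_trans with (/ / N). right; symmetry; apply Rinv_inv.
      apply Rinv_le_contravar. now apply Rmin_glb_lt. apply Rmin_r.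
  - exists d. split; auto.
Qed.

Definition seg_int (tau : C) : C := J (fun z => h (seg tau z)) 1.

Lemma seg_int_hol (t0 : R) : 0 <= t0 <= 1 -> exists d, 0 < d /\ forall tau : C, Cmod (tau - RtoC t0) < d -> hol1 seg_int tau.
Proof.
  intros Ht. destruct (seg_unif t0 Ht) as [d [Hd H]]. exists d. split; auto. intros tau Htau.
  set (k := fun t (x : C * C) => (h (seg (fst x) (RtoC 1 * cis t)) * (RtoC 1 * cis t))%C).
  assert (Hc : forall t, Cmod (RtoC 1 * cis t) = 1) by (intros; apply Cmod_r_cis; lra).
  assert (Hx : forall x : C * C, dist x (tau, RtoC 0) < d - Cmod (tau - RtoC t0) -> Cmod (fst x - RtoC t0) < d).
  { intros x Hx. unfold dist in Hx. simpl in Hx. generalize (Cmod_ge_0 (snd x - 0)) (Cmod_minus_tri tau (fst x) (RtoC t0)). lra. }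
  apply (param_int_hol k (tau, RtoC 0) (d - Cmod (tau - RtoC t0)) (/ d)); try lra.
  - intros t x X. unfold k. apply hol2_mult. 2: apply hol2_const.
    apply (hol2_comp h (fun x => fst (seg (fst x) (RtoC 1 * cis t)%C)) (fun x => snd (seg (fst x) (RtoC 1 * cis t)%C))).
    + rewrite <- surjective_pairing. apply Hh. apply H; auto.
    + apply hol2_plus. apply hol2_const. apply hol2_mult. apply hol2_fst. apply hol2_const.
    + apply hol2_plus. apply hol2_const. apply hol2_mult. apply hol2_fst. apply hol2_const.
  - intros t x X. unfold k. rewrite Cmod_mult, Hc, Rmult_1_r. apply H; auto.
  - intros x X t. unfold k.
    assert (Cc : forall t, cts (fun t => RtoC 1 * cis t)%C t)
      by (intros s; apply (cts_mult (fun _ => RtoC 1)); [apply continuous_const | apply cts_cis]).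
    apply (cts_mult (fun t => h (seg (fst x) (RtoC 1 * cis t)))%C); auto.
    assert (G : forall a b : C -> C, cts_circle a 1 -> cts_circle b 1 ->
      cts (fun t => a (RtoC 1 * cis t) + fst x * (b (RtoC 1 * cis t) - a (RtoC 1 * cis t)))%C t).
    { intros a b Ha Hb.
      assert (A : cts (fun t => a (RtoC 1 * cis t)%C) t) by (apply (continuous_comp _ a); auto).
      assert (B : cts (fun t => b (RtoC 1 * cis t)%C) t) by (apply (continuous_comp _ b); auto).
      apply (cts_plus (fun t => a (RtoC 1 * cis t)%C)); auto.
      apply (cts_mult (fun _ => fst x)). apply continuous_const.
      apply (cts_minus (fun t => b (RtoC 1 * cis t)%C)); auto. }
    apply (cts_hol2 h (fun t => p0 (RtoC 1 * cis t) + fst x * (p1 (RtoC 1 * cis t) - p0 (RtoC 1 * cis t)))%C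
      (fun t => q0 (RtoC 1 * cis t) + fst x * (q1 (RtoC 1 * cis t) - q0 (RtoC 1 * cis t)))%C); auto.
    apply Hh. change (O (seg (fst x) (RtoC 1 * cis t)%C)). apply H; auto.
Qed.

(** At the supremum [ts] of the initial intervals on which the integral vanishes, its zeros
    accumulate from below. By the identity principle it vanishes on a disc around [ts], which would
    push the supremum further unless [ts = 1]. *)
Lemma seg_int_zero (e : R) : 0 < e -> (forall t : R, 0 <= t <= e -> t <= 1 -> seg_int (RtoC t) = 0) ->
  seg_int (RtoC 1) = 0.
Proof.
  intros He Hz.
  set (E := fun t => 0 <= t <= 1 /\ forall s, 0 <= s <= t -> seg_int (RtoC s) = 0).
  assert (HE : E (Rmin e 1)).
  { split. split. apply Rmin_glb; lra. apply Rmin_r. intros s Hs.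
    generalize (Rmin_l e 1) (Rmin_r e 1). intros. apply Hz; lra. }
  destruct (completeness E) as [ts [Hu Hl]].
  { exists 1. intros t [Ht _]. lra. }
  { now exists (Rmin e 1). }
  assert (Hts0 : 0 < ts). { apply Rlt_le_trans with (Rmin e 1). apply Rmin_glb_lt; lra. now apply Hu. }
  assert (Hts1 : ts <= 1). { apply Hl. intros t [Ht _]. lra. }
  assert (Hbelow : forall s, 0 <= s < ts -> seg_int (RtoC s) = 0).
  { intros s Hs. apply NNPP. intros Hn. assert (ts <= s); [|lra]. apply Hl. intros t [Ht1 Ht2].
    apply Rnot_lt_le. intros Hst. apply Hn. apply Ht2. lra. }
  destruct (seg_int_hol ts ltac:(lra)) as [d [Hd Hhol]].
  assert (Z : forall u : C, Cmod u < d / 2 -> seg_int (RtoC ts + u)%C = 0).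
  { apply (identity_zero (fun u => seg_int (RtoC ts + u)%C)). lra.
    - intros y Hy. apply (hol2_hol1 seg_int (fun x => RtoC ts + fst x)%C).
      + simpl. apply Hhol. replace (ts + y - ts)%C with y by ring. lra.
      + apply hol2_plus. apply hol2_const. apply hol2_fst.
    - intros e' He'. set (s := Rmin (e' / 2) ts).
      assert (0 < s) by (apply Rmin_glb_lt; lra). assert (s <= e' / 2) by apply Rmin_l. assert (s <= ts) by apply Rmin_r.
      exists (RtoC (- s)). rewrite Cmod_R, Rabs_Ropp, Rabs_pos_eq by lra. split. lra.
      rewrite <- RtoC_plus. apply Hbelow. lra. }
  destruct (Rle_lt_or_eq_dec ts 1 Hts1) as [Hlt|Heq].
  - exfalso. set (t' := Rmin 1 (ts + d / 4)).
    assert (T1 : t' <= 1) by apply Rmin_l. assert (T2 : t' <= ts + d / 4) by apply Rmin_r.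
    assert (T3 : ts < t') by (apply Rmin_glb_lt; lra).
    assert (E t').
    { split. lra. intros s Hs. destruct (Rlt_le_dec s ts) as [|Hs2]. apply Hbelow; lra.
      replace s with (ts + (s - ts)) by ring. rewrite RtoC_plus. apply Z. rewrite Cmod_R, Rabs_pos_eq; lra. }
    specialize (Hu t' H). lra.
  - replace (RtoC 1) with (RtoC ts + 0)%C by (rewrite Heq; ring). apply Z. rewrite Cmod_0. lra.
Qed.

End Segment.

(** * Approximation of loops with vanishing negative Fourier coefficients *)

Definition entire (p : C -> C) : Prop := forall z, hol1 p z.

Lemma cis_cts_scal a b t : cts (fun t => cis (a * t + b)) t.
Proof.
  apply (continuous_comp (fun t => a * t + b) cis). 2: apply cts_cis.
  apply (continuous_plus (fun t => a * t) (fun _ => b)). 2: apply continuous_const.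
  apply (continuous_mult (fun _ => a) (fun t => t)). apply continuous_const. apply continuous_id.
Qed.

Lemma cis_pow (n : nat) t : (cis t ^ n)%C = cis (INR n * t).
Proof.
  induction n as [|n IH]. simpl. now rewrite Rmult_0_l, cis_0.
  rewrite Cpow_S, IH, <- cis_add, S_INR. f_equal. ring.
Qed.

Lemma CI_cis_nat (n : nat) : CI (fun t => cis (INR (S n) * t)) 0 (2 * PI) = 0.
Proof.
  assert (Hp := two_PI_pos).
  transitivity (J (fun z => z ^ n)%C 1).
  - apply CI_ext. lra. intros t _. rewrite Cmult_1_l, <- cis_pow, Cpow_S. ring.
  - apply (J_zero _ 0 1 1 1); try lra.
    + intros z _. apply cts_pow, continuous_id.
    + intros z _ _. apply hol2_pow, hol2_fst.
    + intros z Hz. rewrite Cmod_pow. rewrite <- (pow1 n). apply pow_incr. lra.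
Qed.

(** With a pole at 0 the circle cannot be shrunk. Instead, the integral of [/ z ^ S (S n)] does not
    depend on the radius, yet by homogeneity it scales like [/ r ^ S n]; comparing the radii 1 and 2
    gives 0. *)
Lemma CI_cis_nat_opp (n : nat) : CI (fun t => cis (- INR (S n) * t)) 0 (2 * PI) = 0.
Proof.
  assert (Hp := two_PI_pos). set (X := CI _ _ _).
  assert (E : forall r, 0 < r -> J (fun z => / z ^ (S (S n)))%C r = (/ RtoC r ^ (S n) * X)%C).
  { intros r Hr. assert (Hrn : RtoC r <> 0) by (apply RtoC_nz; lra).
    unfold X. rewrite <- CI_scal.
    - apply CI_ext. lra. intros t _. rewrite <- Ropp_mult_distr_l, cis_opp, <- cis_pow.
      rewrite (Cpow_S _ (S n)), Cpow_mult_l. field. repeat split; auto using cis_nz, Cpow_nz.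
    - lra.
    - intros t _. apply (continuous_ext (fun t => cis (- INR (S n) * t + 0))). intros s; f_equal; ring. apply cis_cts_scal. }
  assert (E12 := J_const_hol (fun z => / z ^ (S (S n)))%C 1 2 ltac:(lra)).
  rewrite !E in E12 by lra.
  assert (H : (/ RtoC 1 ^ S n * X)%C = (/ RtoC 2 ^ S n * X)%C).
  { apply E12. intros z Hz. apply hol2_inv. simpl fst. apply Cpow_nz, Cmod_nz; lra. apply hol2_pow, hol2_fst. }
  rewrite Cpow_1_l, <- RtoC_pow in H.
  assert (H2 : 1 < 2 ^ S n) by (apply Rlt_pow_R1; [lra | lia]).
  rewrite <- RtoC_inv in H by lra. rewrite <- RtoC_inv in H by lra. rewrite Rinv_1 in H.
  assert (H3 : ((RtoC 1 - RtoC (/ 2 ^ S n)) * X = 0)%C) by (transitivity (RtoC 1 * X - RtoC (/ 2 ^ S n) * X)%C; [ring | rewrite H; ring]).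
  assert (H4 : / 2 ^ S n < 1) by (rewrite <- Rinv_1; apply Rinv_lt_contravar; lra).
  rewrite <- RtoC_minus in H3. assert (Hn : RtoC (1 - / 2 ^ S n) <> 0) by (apply RtoC_nz; lra).
  replace X with (/ RtoC (1 - / 2 ^ S n) * (RtoC (1 - / 2 ^ S n) * X))%C by (field; auto).
  rewrite H3. ring.
Qed.

Lemma CI_cis_Z (m : Z) : m <> 0%Z -> CI (fun t => cis (IZR m * t)) 0 (2 * PI) = 0.
Proof.
  intros Hm. destruct m as [|p|p]; [easy| |].
  - destruct (Pos2Nat.is_succ p) as [n Hn].
    replace (IZR (Z.pos p)) with (INR (S n)). apply CI_cis_nat.
    rewrite <- Hn, INR_IZR_INZ, positive_nat_Z. reflexivity.
  - destruct (Pos2Nat.is_succ p) as [n Hn].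
    replace (IZR (Z.neg p)) with (- INR (S n)). apply CI_cis_nat_opp.
    rewrite <- Hn, INR_IZR_INZ, positive_nat_Z, <- opp_IZR. reflexivity.
Qed.

(* [((1 + cos (th - t)) / 2) ^ n] is, up to its mass, an approximate identity. *)
Definition ckernel (th t : R) : R := (1 + cos (th - t)) / 2.

Lemma ckernel_cis th t : RtoC (ckernel th t) = (RtoC (/ 2) + RtoC (/ 4) * cis (th - t) + RtoC (/ 4) * cis (- (th - t)))%C.
Proof.
  unfold ckernel, cis. rewrite cos_neg, sin_neg. apply injective_projections; simpl; field.
Qed.

(** Expressed by the chord, the concentration of the kernel needs no reduction of angles modulo
    [2 * PI]. *)
Lemma ckernel_chord th t : ckernel th t = 1 - (Cmod (cis th - cis t)) ^ 2 / 4.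
Proof.
  rewrite Cmod2_alt. unfold ckernel, cis, Re, Im. simpl. rewrite cos_minus.
  generalize (sin2_cos2 th) (sin2_cos2 t). unfold Rsqr. intros. nra.
Qed.

Lemma ckernel_bound th t : 0 <= ckernel th t <= 1.
Proof. unfold ckernel. generalize (COS_bound (th - t)). lra. Qed.

Lemma ckernel_cts th t : continuous (ckernel th) t.
Proof.
  apply continuity_pt_filterlim. unfold ckernel.
  apply derivable_continuous_pt. apply ex_derive_Reals_0. auto_derive. trivial.
Qed.

Lemma ckernel_pow_cts th n t : cts (fun t => RtoC (ckernel th t) ^ n)%C t.
Proof. apply cts_pow. apply cts_RtoC. apply ckernel_cts. Qed.

Section Convolution.

Variable (psi : R -> C).
Hypothesis Hpsi : forall t, cts psi t.

(** The convolution of interest has [m = 0]. The other modes enter by induction on [n], since one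
    more kernel factor shifts [m] by -1, 0 or 1. *)
Definition conv (n : nat) (m : Z) (th : R) : C :=
  CI (fun t => psi t * cis (IZR m * (th - t)) * RtoC (ckernel th t) ^ n)%C 0 (2 * PI).

Lemma conv_cts n m th : cts_on (fun t => psi t * cis (IZR m * (th - t)) * RtoC (ckernel th t) ^ n)%C 0 (2 * PI).
Proof.
  intros t _. apply (cts_mult (fun t => psi t * cis (IZR m * (th - t)))%C). 2: apply ckernel_pow_cts.
  apply (cts_mult psi); auto.
  apply (continuous_ext (fun t => cis (- IZR m * t + IZR m * th))). intros s; f_equal; ring. apply cis_cts_scal.
Qed.

(** In the form of an induction principle: a convolution is a finite linear combination of the modes
    [cis (m th)], each weighted by the Fourier coefficient of [psi] with the same index. *)
Lemma conv_ind (Pr : (R -> C) -> Prop) :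
  (forall f g, (forall t, f t = g t) -> Pr f -> Pr g) ->
  (forall f g, Pr f -> Pr g -> Pr (fun t => f t + g t)%C) ->
  (forall c f, Pr f -> Pr (fun t => c * f t)%C) ->
  (forall m, Pr (fun th => cis (IZR m * th) * CI (fun t => psi t * cis (- (IZR m * t))) 0 (2 * PI))%C) ->
  forall n m, Pr (conv n m).
Proof.
  intros He Hp Hs Hb. assert (Hpi := two_PI_pos). induction n as [|n IH]; intros m.
  - eapply He; [ | exact (Hb m)]. intros th. simpl. rewrite <- CI_scal.
    + apply CI_ext. lra. intros t _. rewrite Rmult_minus_distr_l. unfold Rminus. rewrite cis_add. simpl. ring.
    + lra.
    + intros t _. apply (cts_mult psi); auto.
      apply (continuous_ext (fun t => cis (- IZR m * t + 0))). intros s; f_equal; ring. apply cis_cts_scal.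
  - eapply He; [ | apply Hp; [apply Hp; [apply (Hs (RtoC (/ 2))), (IH m) | apply (Hs (RtoC (/ 4))), (IH (m + 1)%Z) ] | apply (Hs (RtoC (/ 4))), (IH (m - 1)%Z)]].
    intros th. simpl. unfold conv.
    assert (S1 : forall c k, cts_on (fun t => c * (psi t * cis (IZR k * (th - t)) * RtoC (ckernel th t) ^ n))%C 0 (2 * PI)).
    { intros c k t Ht. apply (cts_mult (fun _ => c)). apply continuous_const. now apply conv_cts. }
    rewrite <- !CI_scal; try lra; try apply conv_cts.
    rewrite <- CI_plus; auto; try lra.
    rewrite <- CI_plus; auto; try lra.
    + apply CI_ext. lra. intros t _. rewrite ?(Cpow_S (ckernel th t)). set (Kn := (RtoC (ckernel th t) ^ n)%C).
      rewrite (ckernel_cis th t).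
      replace (IZR (m + 1) * (th - t)) with (IZR m * (th - t) + (th - t)) by (rewrite plus_IZR; ring).
      replace (IZR (m - 1) * (th - t)) with (IZR m * (th - t) + - (th - t)) by (rewrite minus_IZR; ring).
      rewrite !(cis_add (IZR m * (th - t))). ring.
    + intros t Ht. apply (cts_plus (fun t => RtoC (/ 2) * (psi t * cis (IZR m * (th - t)) * RtoC (ckernel th t) ^ n))%C); now apply S1.
Qed.

End Convolution.

(** All nonzero modes of the constant 1 vanish. This yields the rotation invariance of the kernel's
    mass without translating a periodic integral. *)
Lemma conv_one_const n : exists c, forall th, conv (fun _ => RtoC 1) n 0 th = c.
Proof.
  apply (conv_ind (fun _ => RtoC 1) (fun _ => continuous_const _ _) (fun g => exists c, forall th, g th = c)).
  - intros f g E [c H]. exists c. intros; now rewrite <- E.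
  - intros f g [c H] [d K]. exists (c + d)%C. intros; now rewrite H, K.
  - intros c f [d H]. exists (c * d)%C. intros; now rewrite H.
  - intros m. assert (Hp := two_PI_pos). destruct (Z.eq_dec m 0) as [->|Hm].
    + exists (RtoC (2 * PI)). intros th. rewrite Rmult_0_l, cis_0, Cmult_1_l.
      rewrite (CI_ext _ (fun _ => RtoC 1)), CI_const, Rminus_0_r. ring. lra.
      intros t _. rewrite Rmult_0_l, Ropp_0, cis_0. ring.
    + exists (RtoC 0). intros th.
      rewrite (CI_ext _ (fun t => cis (IZR (- m) * t))), CI_cis_Z. ring. lia. lra.
      intros t _. rewrite opp_IZR, Cmult_1_l. f_equal. ring.
Qed.

Lemma CI_RtoC (g : R -> R) a b : a <= b -> (forall t, continuous g t) ->
  CI (fun t => RtoC (g t)) a b = RtoC (RInt g a b).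
Proof.
  intros Hab Hg. apply CI_unique.
  apply (is_RInt_fct_extend_pair (U := R_NormedModule) (V := R_NormedModule)); simpl.
  - apply (RInt_correct (V := R_CompleteNormedModule)).
    apply (ex_RInt_continuous (V := R_CompleteNormedModule)). auto.
  - replace 0 with (scal (V := R_NormedModule) (b - a) 0) at 1. apply (is_RInt_const (V := R_NormedModule)).
    apply Rmult_0_r.
Qed.

Lemma CI_le_fun u (g : R -> R) a b : a <= b -> cts_on u a b -> (forall t, continuous g t) ->
  (forall t, a <= t <= b -> Cmod (u t) <= g t) -> Cmod (CI u a b) <= RInt g a b.
Proof.
  intros Hab Hu Hg HM. rewrite <- Cmod_C_R_norm.
  apply (norm_RInt_le (V := C_R_NormedModule) u g a b); auto.
  - intros x Hx. rewrite Cmod_C_R_norm. now apply HM.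
  - now apply CI_correct.
  - apply (RInt_correct (V := R_CompleteNormedModule)).
    apply (ex_RInt_continuous (V := R_CompleteNormedModule)). auto.
Qed.

Definition ckernel_mass (n : nat) : R := RInt (fun t => ckernel 0 t ^ n) 0 (2 * PI).

Lemma ckernel_pow_continuous th n t : continuous (fun t => ckernel th t ^ n) t.
Proof.
  apply continuity_pt_filterlim. unfold ckernel.
  apply derivable_continuous_pt. apply ex_derive_Reals_0. auto_derive. trivial.
Qed.

Lemma ex_RInt_ckernel_pow th n a b : ex_RInt (fun t => ckernel th t ^ n) a b.
Proof. apply (ex_RInt_continuous (V := R_CompleteNormedModule)). intros; apply ckernel_pow_continuous. Qed.

Lemma ckernel_mass_eq n th : RInt (fun t => ckernel th t ^ n) 0 (2 * PI) = ckernel_mass n.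
Proof.
  assert (Hp := two_PI_pos).
  destruct (conv_one_const n) as [c Hc].
  assert (E : forall th, conv (fun _ => RtoC 1) n 0 th = RtoC (RInt (fun t => ckernel th t ^ n) 0 (2 * PI))).
  { intros s. rewrite <- CI_RtoC; try lra; try apply ckernel_pow_continuous.
    apply CI_ext. lra. intros t _. rewrite Rmult_0_l, cis_0, RtoC_pow. ring. }
  apply RtoC_inj. unfold ckernel_mass. now rewrite <- !E, !Hc.
Qed.

(** Only the interval [[0, eta / 2]] is kept, where the kernel is [1 - sin (t / 2) ^ 2]. The base
    [1 - eta ^ 2 / 16] exceeds [1 - eta ^ 2 / 4], which bounds the kernel at chords of length at
    least [eta]; so the tails are negligible relative to the mass. *)
Lemma ckernel_mass_lower n eta : 0 < eta <= 2 -> eta / 2 * (1 - eta ^ 2 / 16) ^ n <= ckernel_mass n.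
Proof.
  intros He. assert (Hp := two_PI_pos).
  assert (Hpi : 1 < 2 * PI) by (generalize PI2_1; unfold PI2 in *; lra).
  unfold ckernel_mass. rewrite <- (RInt_Chasles (V := R_CompleteNormedModule) _ 0 (eta / 2) (2 * PI)); try apply ex_RInt_ckernel_pow.
  assert (A : 0 <= RInt (fun t => ckernel 0 t ^ n) (eta / 2) (2 * PI)).
  { apply RInt_ge_0. lra. apply ex_RInt_ckernel_pow. intros t _. apply pow_le, ckernel_bound. }
  assert (B : RInt (fun _ => (1 - eta ^ 2 / 16) ^ n) 0 (eta / 2) <= RInt (fun t => ckernel 0 t ^ n) 0 (eta / 2)).
  { apply RInt_le. lra. apply ex_RInt_const. apply ex_RInt_ckernel_pow. intros t Ht.
    apply pow_incr. split. nra.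
    unfold ckernel. rewrite Rminus_0_l, cos_neg.
    replace t with (2 * (t / 2)) by field. rewrite cos_2a_sin.
    assert (S1 : sin (t / 2) < t / 2) by (apply sin_lt_x; lra).
    assert (S2 : 0 <= sin (t / 2)) by (apply sin_ge_0; generalize PI2_1; lra).
    nra. }
  rewrite (RInt_const (V := R_CompleteNormedModule)) in B. unfold scal in B; simpl in B. unfold mult in B; simpl in B.
  rewrite Rminus_0_r in B. unfold plus; simpl. lra.
Qed.

(** Convolution with the normalised kernel is uniformly close to [phi], and it only contains
    frequencies of [phi]. These being nonnegative, it is a polynomial in [cis th], hence entire. *)
Lemma entire_approx (phi : R -> C) (B : R) :
  (forall t, cts phi t) -> (forall t, Cmod (phi t) <= B) ->
  (forall e, 0 < e -> exists d, 0 < d /\ forall s t, Cmod (cis s - cis t) < d -> Cmod (phi s - phi t) <= e) ->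
  (forall m : Z, (m < 0)%Z -> CI (fun t => phi t * cis (- (IZR m * t)))%C 0 (2 * PI) = 0) ->
  forall e, 0 < e -> exists p, entire p /\ forall t, Cmod (p (cis t) - phi t) <= e.
Proof.
  intros Hc HB Hu Hm e He. assert (Hp := two_PI_pos).
  assert (HB0 : 0 <= B) by (eapply Rle_trans; [apply (Cmod_ge_0 (phi 0)) | apply HB]).
  destruct (Hu (e / 2) ltac:(lra)) as [eta' [Heta' Hu1]].
  set (eta := Rmin eta' 2). assert (He0 : 0 < eta) by (apply Rmin_glb_lt; lra).
  assert (He1 : eta <= eta') by apply Rmin_l. assert (He2 : eta <= 2) by apply Rmin_r.
  assert (Hee : 0 < eta ^ 2 <= 4) by (split; [apply pow_lt; lra | nra]).
  set (q1 := 1 - eta ^ 2 / 4). set (q2 := 1 - eta ^ 2 / 16).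
  assert (Hq1 : 0 <= q1) by (unfold q1; lra). assert (Hq12 : q1 < q2) by (unfold q1, q2; lra).
  assert (HB2 : 0 <= 2 * B * (2 * PI)) by (apply Rmult_le_pos; lra).
  assert (HB3 : 0 <= 2 * B * (2 * PI) / (eta / 2)) by (apply Rmult_le_pos; [lra | left; apply Rinv_0_lt_compat; lra]).
  (* The tail [2 * B * q1 ^ n * (2 * PI)] divided by the lower bound [eta / 2 * q2 ^ n] of the mass
     is [(K - 1) * (q1 / q2) ^ n]. The 1 keeps [K] positive when [B = 0]. *)
  set (K := 2 * B * (2 * PI) / (eta / 2) + 1).
  assert (HK : 0 < K).
  { unfold K. lra. }
  assert (Hq0 : 0 <= q1 / q2) by (apply Rmult_le_pos; [lra | left; apply Rinv_0_lt_compat; lra]).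
  assert (Hq3 : q1 / q2 < 1) by (apply Rmult_lt_reg_r with q2; try lra; unfold Rdiv; rewrite Rmult_assoc, Rinv_l; lra).
  destruct (pow_lt_1_zero (q1 / q2) ltac:(rewrite Rabs_pos_eq; lra) (e / 2 / K) ltac:(rpos)) as [n Hn].
  specialize (Hn n (Nat.le_refl _)). rewrite Rabs_pos_eq in Hn by now apply pow_le.
  assert (HL := ckernel_mass_lower n eta ltac:(lra)). fold q2 in HL.
  assert (Hq2n : 0 < q2 ^ n) by (apply pow_lt; lra).
  assert (Hmass : 0 < ckernel_mass n) by (eapply Rlt_le_trans; [|exact HL]; apply Rmult_lt_0_compat; lra).
  assert (HP : exists p, entire p /\ forall th, conv phi n 0 th = p (cis th)).
  { apply (conv_ind phi Hc (fun g => exists p, entire p /\ forall th, g th = p (cis th))).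
    - intros f g E [p [Hp1 Hp2]]. exists p. split; auto. intros; now rewrite <- E.
    - intros f g [p [Hp1 Hp2]] [q [Hq Hq']]. exists (fun z => p z + q z)%C. split.
      intros z. apply hol2_plus; [apply Hp1 | apply Hq]. intros; now rewrite Hp2, Hq'.
    - intros c f [p [Hp1 Hp2]]. exists (fun z => c * p z)%C. split.
      intros z. apply hol2_mult; [apply hol2_const | apply Hp1]. intros; now rewrite Hp2.
    - intros m. destruct (Z_lt_le_dec m 0) as [Hlt|Hle].
      + exists (fun _ => RtoC 0). split. intros z; apply hol2_const. intros th. rewrite Hm by auto. ring.
      + set (c := CI _ _ _). exists (fun z => z ^ (Z.to_nat m) * c)%C. split.
        intros z. apply hol2_mult; [apply hol2_pow, hol2_fst | apply hol2_const].
        intros th. rewrite cis_pow, INR_IZR_INZ, Z2Nat.id by auto. reflexivity. }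
  destruct HP as [p [Hp1 Hp2]].
  assert (Hmn : RtoC (ckernel_mass n) <> 0) by (apply RtoC_nz; lra).
  exists (fun z => / RtoC (ckernel_mass n) * p z)%C. split.
  { intros z. apply hol2_mult; [apply hol2_const | apply Hp1]. }
  intros th.
  assert (E1 : (phi th * RtoC (ckernel_mass n))%C = CI (fun t => phi th * RtoC (ckernel th t ^ n))%C 0 (2 * PI)).
  { rewrite CI_scal, CI_RtoC, ckernel_mass_eq; auto; try lra. apply ckernel_pow_continuous.
    intros t _. apply cts_RtoC, ckernel_pow_continuous. }
  assert (C1 : cts_on (fun t => phi t * RtoC (ckernel th t ^ n))%C 0 (2 * PI)).
  { intros t _. apply cts_mult; auto. apply cts_RtoC, ckernel_pow_continuous. }
  assert (C2 : cts_on (fun t => phi th * RtoC (ckernel th t ^ n))%C 0 (2 * PI)).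
  { intros t _. apply cts_mult. apply continuous_const. apply cts_RtoC, ckernel_pow_continuous. }
  assert (E2 : conv phi n 0 th = CI (fun t => phi t * RtoC (ckernel th t ^ n))%C 0 (2 * PI)).
  { apply CI_ext. lra. intros t _. rewrite Rmult_0_l, cis_0, RtoC_pow. ring. }
  assert (Q : Cmod (conv phi n 0 th - phi th * RtoC (ckernel_mass n)) <= e / 2 * ckernel_mass n + 2 * B * q1 ^ n * (2 * PI)).
  { rewrite E1, E2, <- CI_minus; auto; try lra.
    eapply Rle_trans. apply (CI_le_fun _ (fun t => e / 2 * ckernel th t ^ n + 2 * B * q1 ^ n)). lra.
    - intros t Ht. apply (cts_minus (fun t => phi t * RtoC (ckernel th t ^ n))%C); auto.
    - intros t. apply (continuous_plus (fun t => e / 2 * ckernel th t ^ n) (fun _ => 2 * B * q1 ^ n)).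
      apply (continuous_mult (fun _ => e / 2)). apply continuous_const. apply ckernel_pow_continuous. apply continuous_const.
    - intros t _. replace (_ - _)%C with ((phi t - phi th) * RtoC (ckernel th t ^ n))%C by ring.
      assert (Kb := ckernel_bound th t). assert (Kn : 0 <= ckernel th t ^ n) by now apply pow_le.
      rewrite Cmod_mult, Cmod_R, (Rabs_pos_eq (ckernel th t ^ n)) by auto.
      assert (Hq1n : 0 <= q1 ^ n) by (apply pow_le; lra).
      destruct (Rlt_le_dec (Cmod (cis t - cis th)) eta) as [H|H].
      + assert (H' := Hu1 t th ltac:(lra)).
        assert (0 <= 2 * B * q1 ^ n) by (repeat apply Rmult_le_pos; lra).
        assert (Cmod (phi t - phi th) * ckernel th t ^ n <= e / 2 * ckernel th t ^ n) by now apply Rmult_le_compat_r. lra.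
      + assert (ckernel th t ^ n <= q1 ^ n).
        { apply pow_incr. split. lra. rewrite ckernel_chord, Cmod_minus_sym. unfold q1.
          assert (eta ^ 2 <= Cmod (cis t - cis th) ^ 2) by (apply pow_incr; lra). lra. }
        assert (Cmod (phi t - phi th) <= 2 * B) by (eapply Rle_trans; [apply Cmod_minus_le|]; generalize (HB t) (HB th); lra).
        assert (0 <= e / 2 * ckernel th t ^ n) by (apply Rmult_le_pos; lra).
        assert (Cmod (phi t - phi th) * ckernel th t ^ n <= 2 * B * q1 ^ n) by (apply Rmult_le_compat; auto; apply Cmod_ge_0). lra.
    - rewrite (RInt_plus (V := R_CompleteNormedModule)), (RInt_scal (V := R_CompleteNormedModule)), (RInt_const (V := R_CompleteNormedModule)).
      rewrite ckernel_mass_eq. unfold plus, scal, mult; simpl. unfold mult; simpl. right; ring.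
      apply ex_RInt_ckernel_pow.
      apply (ex_RInt_scal (V := R_NormedModule)), ex_RInt_ckernel_pow. apply ex_RInt_const. }
  rewrite <- Hp2.
  replace (_ - _)%C with ((conv phi n 0 th - phi th * RtoC (ckernel_mass n)) / RtoC (ckernel_mass n))%C by (field; auto).
  rewrite Cmod_div, Cmod_R, Rabs_pos_eq by (auto; lra).
  apply Rmult_le_reg_r with (ckernel_mass n); auto. unfold Rdiv. rewrite Rmult_assoc, Rinv_l, Rmult_1_r by lra.
  eapply Rle_trans. exact Q.
  assert (Z : 2 * B * q1 ^ n * (2 * PI) <= e / 2 * ckernel_mass n).
  { apply Rle_trans with (e / 2 * (eta / 2 * q2 ^ n)). 2: apply Rmult_le_compat_l; lra.
    replace (2 * B * q1 ^ n * (2 * PI)) with ((K - 1) * ((q1 / q2) ^ n) * (eta / 2 * q2 ^ n)).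
    2: { unfold K, Rdiv. rewrite Rpow_mult_distr, pow_inv. field. lra. }
    apply Rmult_le_compat_r. apply Rmult_le_pos; lra.
    assert (0 <= (q1 / q2) ^ n) by now apply pow_le.
    apply Rle_trans with (K * (e / 2 / K)). apply Rmult_le_compat; try lra.
    unfold K. lra.
    right; field; lra. }
  lra.
Qed.

(** * Extension across the bidisc *)

Lemma Cmod_RtoC_mult r z : 0 <= r -> Cmod (RtoC r * z) = r * Cmod z.
Proof. intros. rewrite Cmod_mult, Cmod_R, Rabs_pos_eq; auto. Qed.

Lemma Cmod_convex (t M : R) (x y : C) : 0 <= t <= 1 -> Cmod x < M -> Cmod y < M ->
  Cmod (x + RtoC t * (y - x)) < M.
Proof.
  intros Ht Hx Hy. replace (x + RtoC t * (y - x))%C with (RtoC (1 - t) * x + RtoC t * y)%C by (rewrite RtoC_minus; ring).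
  eapply Rle_lt_trans. apply Cmod_triangle. rewrite !Cmod_RtoC_mult by lra.
  destruct (Req_dec t 0) as [->|Hn]. lra. nra.
Qed.

Lemma Cmod_convex_minus (t M : R) (x y c : C) : 0 <= t <= 1 -> Cmod (x - c) < M -> Cmod (y - c) < M ->
  Cmod (x + RtoC t * (y - x) - c) < M.
Proof.
  intros. replace (x + RtoC t * (y - x) - c)%C with ((x - c) + RtoC t * ((y - c) - (x - c)))%C by ring.
  now apply Cmod_convex.
Qed.

Lemma entire_cts_circle p r : entire p -> cts_circle p r.
Proof. intros H z _. apply hol1_cts, H. Qed.

Lemma disc_bound (u : C -> C) :
  (forall z, Cmod z <= 1 -> forall e, 0 < e -> exists d, 0 < d /\
    forall y, Cmod y <= 1 -> Cmod (y - z) < d -> Cmod (u y - u z) < e) ->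
  exists M, 0 < M /\ forall z, Cmod z <= 1 -> Cmod (u z) <= M.
Proof.
  intros uc. destruct (disc_unif (fun z d => Cmod (u z) <= / d)) as [d [Hd H]].
  - intros z d d' Hd H. eapply Rle_trans. exact H. apply Rinv_le_contravar; lra.
  - intros z Hz. destruct (uc z Hz 1 Rlt_0_1) as [d [Hd H]].
    set (M := Cmod (u z) + 1). assert (HM : 0 < M) by (unfold M; generalize (Cmod_ge_0 (u z)); lra).
    assert (HM' : 0 < / M) by now apply Rinv_0_lt_compat.
    exists (Rmin d (/ M)). split. now apply Rmin_glb_lt.
    intros y Hy Hyz. specialize (H y Hy (Rlt_le_trans _ _ _ Hyz (Rmin_l _ _))).
    apply Rle_trans with M. unfold M. generalize (Cmod_rev_tri (u y) (u z)). lra.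
    apply Rle_trans with (/ / M). right; symmetry; apply Rinv_inv. apply Rinv_le_contravar.
    now apply Rmin_glb_lt. apply Rmin_r.
  - exists (/ d). split; auto. now apply Rinv_0_lt_compat.
Qed.

Lemma entire_bound p : entire p -> exists M, 0 < M /\ forall z, Cmod z <= 1 -> Cmod (p z) <= M.
Proof.
  intros Hp. apply disc_bound. intros z _ e He.
  destruct (proj1 (locally_C_eps _ _) (proj1 (continuous_C_eps _ _) (hol1_cts p z (Hp z)) e He)) as [d [Hd H]].
  exists d. auto.
Qed.

(** * Vanishing of loop integrals and of the moments *)

Section Discs.

Variable (F : C -> C).
Hypothesis Fc : forall z, Cmod z <= 1 -> forall e, 0 < e -> exists d, 0 < d /\
  forall y, Cmod y <= 1 -> Cmod (y - z) < d -> Cmod (F y - F z) < e.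
Hypothesis Ff : forall j : Z, (j < 0)%Z -> forall r : R, 0 < r <= 1 ->
  CI (fun t => F (RtoC r * cis t) * cis (- (IZR j * t)))%C 0 (2 * PI) = 0.

Lemma F_unif e : 0 < e -> exists d, 0 < d /\ forall z y, Cmod z <= 1 -> Cmod y <= 1 ->
  Cmod (y - z) < d -> Cmod (F y - F z) < e.
Proof.
  intros He. destruct (disc_unif (fun z d => forall y, Cmod y <= 1 -> Cmod (y - z) < d -> Cmod (F y - F z) < e)) as [d [Hd H]].
  - intros z d d' Hd H y Hy Hyz. apply H; auto. lra.
  - intros z Hz. destruct (Fc z Hz (e / 2) ltac:(lra)) as [d [Hd H]].
    exists (d / 2). split. lra. intros y Hy Hyz w Hw Hwy.
    assert (H1 := H y Hy ltac:(lra)).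
    assert (H2 := H w Hw ltac:(generalize (Cmod_minus_tri y w z); lra)).
    assert (H3 := Cmod_minus_tri (F z) (F w) (F y)). rewrite (Cmod_minus_sym (F z)) in H3. lra.
  - exists d. split; auto.
Qed.

Lemma F_circle_cts r : 0 <= r <= 1 -> forall t, cts (fun t => F (RtoC r * cis t)%C) t.
Proof.
  intros Hr t. apply continuous_C_eps. intros e He.
  destruct (Fc (RtoC r * cis t)%C ltac:(rewrite Cmod_r_cis; lra) e He) as [d [Hd H]].
  assert (Hc : cts (fun t => RtoC r * cis t)%C t) by (apply (cts_mult (fun _ => RtoC r)); [apply continuous_const | apply cts_cis]).
  generalize (proj1 (continuous_C_eps _ _) Hc d Hd). apply filter_imp. intros s Hs.
  apply H; auto. rewrite Cmod_r_cis; lra.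
Qed.

Lemma F_approx r : 0 <= r <= 1 -> forall e, 0 < e ->
  exists q, entire q /\ forall z, Cmod z = 1 -> Cmod (q z - F (RtoC r * z)%C) <= e.
Proof.
  (* The coefficients are given for [0 < r] only; at [r = 0] the loop is constant and approximates
     itself. *)
  intros Hr e He. destruct (Req_dec r 0) as [->|Hr0].
  - exists (fun _ => F 0). split. intros z; apply hol2_const.
    intros z _. rewrite Cmult_0_l, Cmod_0_minus. lra.
  - destruct (disc_bound F Fc) as [B [_ HB]].
    destruct (entire_approx (fun t => F (RtoC r * cis t)%C) B) with (e := e) as [q [Hq1 Hq2]]; auto.
    + now apply F_circle_cts.
    + intros t. apply HB. rewrite Cmod_r_cis; lra.
    + intros e' He'. destruct (F_unif e' He') as [d [Hd H]]. exists d. split; auto.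
      intros s t Hst. left. apply H; rewrite ?Cmod_r_cis; try lra.
      replace (RtoC r * cis s - RtoC r * cis t)%C with (RtoC r * (cis s - cis t))%C by ring.
      rewrite Cmod_RtoC_mult by lra. generalize (Cmod_ge_0 (cis s - cis t)). nra.
    + intros m Hm. apply Ff; auto. lra.
    + exists q. split; auto. intros z Hz. destruct (circle_cis z Hz) as [t ->]. apply Hq2.
Qed.

Variables (O : C * C -> Prop) (dl : R).
Hypothesis HO : eps_open O.
Hypothesis Hdl : 0 < dl.
Hypothesis Hnear : forall z, Cmod z <= 1 -> forall a b : C, Cmod (a - z) < dl -> Cmod (b - F z) < dl -> O (a, b).

Definition near_loop (r : R) (p q : C -> C) : Prop :=
  forall z, Cmod z = 1 -> Cmod (p z - RtoC r * z) < dl /\ Cmod (q z - F (RtoC r * z)%C) < dl.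

Section Moments.

Variable (h : C * C -> C).
Hypothesis Hh : forall x, O x -> hol2 h x.

(** Quantified over all nearby entire curves: passing to another radius uses the vanishing for every
    curve on an initial piece of a segment. *)
Definition loops_vanish (r : R) : Prop :=
  forall p q, entire p -> entire q -> near_loop r p q -> J (fun z => h (p z, q z)) 1 = 0.

Lemma seg_int_real p0 p1 q0 q1 (t : R) :
  seg_int h p0 p1 q0 q1 (RtoC t) =
  J (fun z => h ((fun z => p0 z + RtoC t * (p1 z - p0 z)) z, (fun z => q0 z + RtoC t * (q1 z - q0 z)) z))%C 1.
Proof. reflexivity. Qed.

Lemma seg_int_1 p0 p1 q0 q1 : seg_int h p0 p1 q0 q1 (RtoC 1) = J (fun z => h (p1 z, q1 z)) 1.
Proof.
  unfold seg_int. apply J_ext. lra. intros z _. unfold seg. f_equal. f_equal; ring.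
Qed.

Lemma entire_seg p0 p1 (t : R) : entire p0 -> entire p1 -> entire (fun z => p0 z + RtoC t * (p1 z - p0 z))%C.
Proof.
  intros H0 H1 z. apply hol2_plus. apply H0. apply hol2_mult. apply hol2_const. apply hol2_minus. apply H1. apply H0.
Qed.

Lemma loop_in_O r z a b : 0 <= r <= 1 -> Cmod z = 1 ->
  Cmod (a - RtoC r * z) < dl -> Cmod (b - F (RtoC r * z)%C) < dl -> O (a, b).
Proof. intros Hr Hz. apply Hnear. rewrite Cmod_RtoC_mult, Hz; lra. Qed.

(** On the segment from the constant curve [(0, F 0)] to [(p, q)], a small parameter maps the whole
    closed disc, not only the circle, into [O], and there the disc can be filled. [N] bounds [p] and
    [q - F 0] on the disc, so [t <= dl / (2 * N)] is small enough. *)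
Lemma loops_vanish_0 : loops_vanish 0.
Proof.
  intros p q Hp Hq Hg. assert (Hpi := two_PI_pos).
  assert (Hg' : forall z, Cmod z = 1 -> Cmod (p z - 0) < dl /\ Cmod (q z - F 0) < dl).
  { intros z Hz. destruct (Hg z Hz) as [A B]. rewrite Cmult_0_l in A, B. auto. }
  destruct (entire_bound p Hp) as [M1 [HM1 B1]]. destruct (entire_bound q Hq) as [M2 [HM2 B2]].
  set (N := M1 + M2 + Cmod (F 0) + 1).
  assert (HN : 0 < N) by (unfold N; generalize (Cmod_ge_0 (F 0)); lra).
  rewrite <- (seg_int_1 (fun _ => RtoC 0) p (fun _ => F 0) q).
  apply (seg_int_zero O h (fun _ => RtoC 0) p (fun _ => F 0) q) with (e := dl / (2 * N)); auto.
  - intros z _; apply continuous_const.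
  - now apply entire_cts_circle.
  - intros z _; apply continuous_const.
  - now apply entire_cts_circle.
  - intros t z Ht Hz. destruct (Hg' z Hz) as [A B]. unfold seg.
    apply (loop_in_O 0 (RtoC 1)). lra. apply Cmod_1.
    + rewrite Cmult_0_l. apply Cmod_convex_minus; auto. now rewrite Cmod_0_minus.
    + rewrite Cmult_0_l. apply Cmod_convex_minus; auto. now rewrite Cmod_0_minus.
  - rpos.
  - intros t Ht Ht1.
    assert (HtN : t * N < dl).
    { apply Rle_lt_trans with (dl / (2 * N) * N). apply Rmult_le_compat_r; lra.
      replace (dl / (2 * N) * N) with (dl / 2) by (field; lra). lra. }
    set (pt := (fun z => 0 + RtoC t * (p z - 0))%C). set (qt := (fun z => F 0 + RtoC t * (q z - F 0))%C).
    assert (Ept : entire pt) by (apply (entire_seg (fun _ => RtoC 0)); auto; intros z; apply hol2_const).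
    assert (Eqt : entire qt) by (apply (entire_seg (fun _ => F 0)); auto; intros z; apply hol2_const).
    assert (K : forall z, Cmod z <= 1 -> hol1 (fun z => h (pt z, qt z)) z).
    { intros z Hz. apply hol1_hol2. 2: apply Ept. 2: apply Eqt. apply Hh.
      apply (loop_in_O 0 (RtoC 1)). lra. apply Cmod_1.
      + rewrite Cmult_0_l, Cminus_0_r. unfold pt. rewrite Cplus_0_l, Cminus_0_r, Cmod_RtoC_mult by lra.
        specialize (B1 z Hz). eapply Rle_lt_trans. 2: exact HtN. apply Rmult_le_compat_l. lra.
        unfold N. generalize (Cmod_ge_0 (F 0)). lra.
      + rewrite Cmult_0_l. unfold qt. replace (F 0 + RtoC t * (q z - F 0) - F 0)%C with (RtoC t * (q z - F 0))%C by ring.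
        rewrite Cmod_RtoC_mult by lra. specialize (B2 z Hz). eapply Rle_lt_trans. 2: exact HtN. apply Rmult_le_compat_l. lra.
        unfold N. generalize (Cmod_minus_le (q z) (F 0)). lra. }
    rewrite seg_int_real. fold pt qt. change (J (fun z => h (pt z, qt z)) 1 = 0).
    destruct (proj1 (locally_C_eps _ _) (proj1 (continuous_C_eps _ _) (hol1_cts _ _ (K (RtoC 0) ltac:(rewrite Cmod_0; lra))) 1 Rlt_0_1)) as [d [Hd H]].
    apply (J_zero _ 0 1 (d / 2) (Cmod (h (pt 0, qt 0)) + 1)); try lra.
    + intros z Hz. apply hol1_cts, K. lra.
    + intros z Hz _. apply K. lra.
    + intros z Hz. specialize (H z). rewrite Cminus_0_r in H. specialize (H ltac:(lra)). simpl in H.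
      generalize (Cmod_rev_tri (h (pt z, qt z)) (h (pt 0, qt 0))). lra.
Qed.

(** The segment starts at an entire curve near the loops of both radii and ends at an arbitrary one
    near [r']. By convexity it stays near the loop [r'], hence in [O]. For [t <= 1 / 4] it is also
    near the loop [r]: its end points differ by less than [2 * dl] in each coordinate, and
    [dl / 4 + 2 * dl / 4 < dl]. *)
Lemma loops_vanish_step r r' : 0 <= r <= 1 -> 0 <= r' <= 1 -> Rabs (r - r') < dl / 4 ->
  (forall z, Cmod z = 1 -> Cmod (F (RtoC r * z)%C - F (RtoC r' * z)%C) < dl / 4) ->
  loops_vanish r -> loops_vanish r'.
Proof.
  intros Hr Hr' Hrr HF HV p q Hp Hq Hg.
  destruct (F_approx r Hr (dl / 4) ltac:(lra)) as [q0 [Hq0 Hq0']].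
  set (p0 := fun z => (RtoC r * z)%C).
  assert (Hp0 : entire p0) by (intros z; apply hol2_mult; [apply hol2_const | apply hol2_fst]).
  assert (D1 : forall z, Cmod z = 1 -> Cmod (p0 z - RtoC r' * z) < dl / 4).
  { intros z Hz. unfold p0. replace (RtoC r * z - RtoC r' * z)%C with (RtoC (r - r') * z)%C by (rewrite RtoC_minus; ring).
    rewrite Cmod_mult, Cmod_R, Hz. lra. }
  assert (D2 : forall z, Cmod z = 1 -> Cmod (q0 z - F (RtoC r' * z)%C) < dl / 2).
  { intros z Hz. generalize (Cmod_minus_tri (F (RtoC r * z)%C) (q0 z) (F (RtoC r' * z)%C)) (Hq0' z Hz) (HF z Hz). lra. }
  rewrite <- (seg_int_1 p0 p q0 q).
  apply (seg_int_zero O h p0 p q0 q) with (e := / 4); auto; try now apply entire_cts_circle.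
  - intros t z Ht Hz. destruct (Hg z Hz) as [A B]. unfold seg.
    specialize (D1 z Hz). specialize (D2 z Hz).
    apply (loop_in_O r' z); auto; apply Cmod_convex_minus; auto; lra.
  - lra.
  - intros t Ht Ht1. rewrite seg_int_real. apply HV; try now apply entire_seg.
    intros z Hz. destruct (Hg z Hz) as [A B]. specialize (D1 z Hz). specialize (D2 z Hz). specialize (Hq0' z Hz).
    split; simpl.
    + replace (p0 z + RtoC t * (p z - p0 z) - RtoC r * z)%C with (RtoC t * (p z - p0 z))%C by (unfold p0; ring).
      rewrite Cmod_RtoC_mult by lra.
      assert (Cmod (p z - p0 z) < 2 * dl).
      { generalize (Cmod_minus_tri (RtoC r' * z) (p z) (p0 z)). rewrite (Cmod_minus_sym (RtoC r' * z)). lra. }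
      generalize (Cmod_ge_0 (p z - p0 z)). nra.
    + replace (q0 z + RtoC t * (q z - q0 z) - F (RtoC r * z))%C with ((q0 z - F (RtoC r * z)) + RtoC t * (q z - q0 z))%C by ring.
      eapply Rle_lt_trans. apply Cmod_triangle. rewrite Cmod_RtoC_mult by lra.
      assert (Cmod (q z - q0 z) < 2 * dl).
      { generalize (Cmod_minus_tri (F (RtoC r' * z)%C) (q z) (q0 z)). rewrite (Cmod_minus_sym (F (RtoC r' * z)%C)). lra. }
      generalize (Cmod_ge_0 (q z - q0 z)). nra.
Qed.

Lemma loops_vanish_1 : loops_vanish 1.
Proof.
  destruct (F_unif (dl / 4) ltac:(lra)) as [d [Hd HF]].
  set (m := Rmin d (dl / 4)). assert (Hm : 0 < m) by (apply Rmin_glb_lt; lra).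
  destruct (archimed_cor1 m Hm) as [n [Hn Hn0]].
  assert (Hnp : 0 < INR n) by now apply lt_0_INR.
  assert (Hi : forall i, (i <= n)%nat -> 0 <= INR i / INR n <= 1).
  { intros i Hi. apply le_INR in Hi. assert (0 <= INR i) by apply pos_INR. split.
    apply Rmult_le_pos; auto. left; now apply Rinv_0_lt_compat.
    apply Rmult_le_reg_r with (INR n); auto. unfold Rdiv. rewrite Rmult_assoc, Rinv_l; lra. }
  assert (A : forall i, (i <= n)%nat -> loops_vanish (INR i / INR n)).
  { induction i as [|i IH]; intros Hin.
    - simpl. unfold Rdiv. rewrite Rmult_0_l. apply loops_vanish_0.
    - assert (E : Rabs (INR i / INR n - INR (S i) / INR n) < m).
      { replace (INR i / INR n - INR (S i) / INR n) with (- / INR n) by (rewrite S_INR; field; lra).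
        rewrite Rabs_Ropp, Rabs_pos_eq; auto. left; now apply Rinv_0_lt_compat. }
      apply (loops_vanish_step (INR i / INR n)); try (apply Hi; lia); try (apply IH; lia).
      + eapply Rlt_le_trans. exact E. apply Rmin_r.
      + intros z Hz. apply HF; try (rewrite Cmod_RtoC_mult, Hz, Rmult_1_r; apply Hi; lia).
        replace (_ - _)%C with (RtoC (INR i / INR n - INR (S i) / INR n) * z)%C by (rewrite RtoC_minus; ring).
        rewrite Cmod_mult, Cmod_R, Hz, Rmult_1_r. eapply Rlt_le_trans. exact E. apply Rmin_l. }
  specialize (A n (Nat.le_refl _)). unfold Rdiv in A. rewrite Rinv_r in A by lra. exact A.
Qed.

End Moments.

Lemma moments_vanish f rho : rho < 1 -> (forall z, Cmod z = 1 -> Cmod (F z) <= rho) ->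
  (forall z w, Cmod z = 1 -> Cmod w < 1 -> O (z, w)) ->
  (forall x, O x -> hol2 f x) ->
  forall w n, Cmod w < 1 -> J (fun z => f (z, w) * z ^ n)%C 1 = 0.
Proof.
  intros Hrho HFr HOc Hf w n Hw.
  set (h := fun x : C * C => (f x * fst x ^ n)%C).
  assert (Hh : forall x, O x -> hol2 h x).
  { intros x Hx. apply hol2_mult; auto. apply hol2_pow, hol2_fst. }
  (* The first bound keeps the starting curve near the loop [r = 1]; the second keeps
     [Cmod (q0 z) < 1], so that the segment to [w] stays in the unit disc. *)
  set (e := Rmin (dl / 2) ((1 - rho) / 2)).
  assert (He : 0 < e) by (apply Rmin_glb_lt; lra).
  assert (He1 : e <= dl / 2) by apply Rmin_l. assert (He2 : e <= (1 - rho) / 2) by apply Rmin_r.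
  destruct (F_approx 1 ltac:(lra) e He) as [q0 [Hq0 Hq0']].
  assert (Hq1 : forall z, Cmod z = 1 -> Cmod (q0 z) < 1).
  { intros z Hz. specialize (Hq0' z Hz). rewrite Cmult_1_l in Hq0'. specialize (HFr z Hz).
    generalize (Cmod_rev_tri (q0 z) (F z)). lra. }
  assert (Eid : entire (fun z => z)) by (intros z; apply hol1_id).
  assert (Ew : entire (fun _ => w)) by (intros z; apply hol2_const).
  change (J (fun z => h (z, w)) 1 = 0).
  rewrite <- (seg_int_1 h (fun z => z) (fun z => z) q0 (fun _ => w)).
  (* The first coordinate does not move. Since [Cmod (w - q0 z) < 2], for [t <= dl / 8] the second
     one moves by at most [dl / 4] and stays within [dl] of [F z]. *)
  apply (seg_int_zero O h (fun z => z) (fun z => z) q0 (fun _ => w)) with (e := dl / 8); auto; try now apply entire_cts_circle.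
  - intros t z Ht Hz. unfold seg. apply HOc. rewrite <- Hz. f_equal. ring.
    apply Cmod_convex; auto.
  - lra.
  - intros t Ht Ht1. rewrite seg_int_real. apply loops_vanish_1; auto; try now apply entire_seg.
    intros z Hz. specialize (Hq0' z Hz). split; simpl.
    + replace (_ - _)%C with (RtoC 0) by ring. rewrite Cmod_0. lra.
    + replace (q0 z + RtoC t * (w - q0 z) - F (1 * z))%C with ((q0 z - F (1 * z)) + RtoC t * (w - q0 z))%C by ring.
      eapply Rle_lt_trans. apply Cmod_triangle. rewrite Cmod_RtoC_mult by lra.
      assert (Cmod (w - q0 z) < 2) by (generalize (Cmod_minus_le w (q0 z)) (Hq1 z Hz); lra).
      generalize (Cmod_ge_0 (w - q0 z)). nra.
Qed.

End Discs.

(** * Uniform neighbourhoods and the Cauchy integral extension *)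

Lemma graph_nbhd F O :
  (forall z, Cmod z <= 1 -> forall e, 0 < e -> exists d, 0 < d /\
    forall y, Cmod y <= 1 -> Cmod (y - z) < d -> Cmod (F y - F z) < e) ->
  eps_open O -> (forall z, Cmod z <= 1 -> O (z, F z)) ->
  exists d, 0 < d /\ forall z, Cmod z <= 1 -> forall a b : C, Cmod (a - z) < d -> Cmod (b - F z) < d -> O (a, b).
Proof.
  intros Fc HO HG.
  apply (disc_unif (fun z d => forall a b : C, Cmod (a - z) < d -> Cmod (b - F z) < d -> O (a, b))).
  - intros z d d' Hd H a b Ha Hb. apply H; lra.
  - intros z Hz. destruct (HO _ (HG z Hz)) as [d1 [Hd1 H1]].
    destruct (Fc z Hz (d1 / 4) ltac:(lra)) as [d2 [Hd2 H2]].
    exists (Rmin d2 (d1 / 4)). split. apply Rmin_glb_lt; lra. intros y Hy Hyz a b Ha Hb.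
    assert (X1 := Rlt_le_trans _ _ _ Hyz (Rmin_l _ _)). assert (X2 := Rlt_le_trans _ _ _ Hyz (Rmin_r _ _)).
    assert (X3 := Rlt_le_trans _ _ _ Ha (Rmin_r _ _)). assert (X4 := Rlt_le_trans _ _ _ Hb (Rmin_r _ _)).
    specialize (H2 y Hy X1). apply H1. unfold dist. simpl.
    generalize (Cmod_minus_tri y a z) (Cmod_minus_tri (F y) b (F z)). lra.
Qed.

(** The usual Cauchy integral in the first variable; the [i] of [2 i PI] is already part of [J]. *)
Definition hartogs_ext (f : C * C -> C) (x : C * C) : C :=
  (RtoC (/ (2 * PI)) * J (fun y => f (y, snd x) / (y - fst x)) 1)%C.

Section Extension.

Variables (O : C * C -> Prop) (f : C * C -> C).
Hypothesis HO : eps_open O.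
Hypothesis Hf : forall x, O x -> hol2 f x.
Hypothesis HOc : forall z w, Cmod z = 1 -> Cmod w < 1 -> O (z, w).

Lemma circle_nbhd w0 : Cmod w0 < 1 -> exists d, 0 < d /\ forall z, Cmod z = 1 -> forall y w : C,
  Cmod (y - z) < d -> Cmod (w - w0) < d -> O (y, w) /\ Cmod (f (y, w)) <= / d.
Proof.
  intros Hw. apply (circle_unif (fun z d => forall y w : C, Cmod (y - z) < d -> Cmod (w - w0) < d -> O (y, w) /\ Cmod (f (y, w)) <= / d)).
  - intros z d d' Hd H y w Hy Hww. destruct (H y w) as [A B]; try lra. split; auto.
    eapply Rle_trans. exact B. apply Rinv_le_contravar; lra.
  - intros z Hz. assert (Oz := HOc z w0 Hz Hw).
    destruct (HO _ Oz) as [d1 [Hd1 H1]].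
    destruct (hol2_cont _ _ (Hf _ Oz) 1 Rlt_0_1) as [d2 [Hd2 H2]].
    set (N := Cmod (f (z, w0)) + 1).
    assert (HN : 0 < N) by (unfold N; generalize (Cmod_ge_0 (f (z, w0))); lra).
    assert (HN' : 0 < / N) by now apply Rinv_0_lt_compat.
    set (m := Rmin d1 d2). assert (Hm : 0 < m) by now apply Rmin_glb_lt.
    assert (Hm1 : m <= d1) by apply Rmin_l. assert (Hm2 : m <= d2) by apply Rmin_r.
    exists (Rmin (m / 3) (/ N)). split. apply Rmin_glb_lt; lra.
    intros y Hy Hyz a w Ha Hww.
    assert (X1 := Rlt_le_trans _ _ _ Hyz (Rmin_l _ _)). assert (X2 := Rlt_le_trans _ _ _ Ha (Rmin_l _ _)).
    assert (X3 := Rlt_le_trans _ _ _ Hww (Rmin_l _ _)).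
    assert (D : dist (a, w) (z, w0) < m).
    { unfold dist. simpl. generalize (Cmod_minus_tri y a z). lra. }
    split. apply H1; lra. specialize (H2 (a, w) ltac:(lra)).
    apply Rle_trans with N.
    + unfold N. generalize (Cmod_rev_tri (f (a, w)) (f (z, w0))). lra.
    + apply Rle_trans with (/ / N). right; symmetry; apply Rinv_inv.
      apply Rinv_le_contravar. apply Rmin_glb_lt; lra. apply Rmin_r.
Qed.

Lemma hartogs_ext_hol x0 : Cmod (fst x0) < 1 -> Cmod (snd x0) < 1 -> hol2 (hartogs_ext f) x0.
Proof.
  intros Hz Hw. destruct (circle_nbhd _ Hw) as [d [Hd H]].
  apply hol2_mult. apply hol2_const.
  (* Half the distance to the circle: moving the pole by less than [s] keeps the denominator at
     least [s] in modulus. *)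
  set (s := (1 - Cmod (fst x0)) / 2). assert (Hs : 0 < s) by (unfold s; lra).
  assert (Hc : forall t, Cmod (RtoC 1 * cis t) = 1) by (intros; apply Cmod_r_cis; lra).
  assert (Hds : forall x, dist x x0 < Rmin d s -> Cmod (snd x - snd x0) < d /\ forall z : C, Cmod z = 1 -> s <= Cmod (z - fst x)).
  { intros x Hx. assert (X1 := Rlt_le_trans _ _ _ Hx (Rmin_l _ _)). assert (X2 := Rlt_le_trans _ _ _ Hx (Rmin_r _ _)).
    unfold dist in X1, X2. generalize (Cmod_ge_0 (fst x - fst x0)) (Cmod_ge_0 (snd x - snd x0)). intros.
    split. lra. intros z Hz1. generalize (Cmod_rev_tri z (fst x)) (Cmod_rev_tri (fst x) (fst x0)). unfold s in *. lra. }
  apply (param_int_hol (fun t x => f (RtoC 1 * cis t, snd x) / (RtoC 1 * cis t - fst x) * (RtoC 1 * cis t))%C x0 (Rmin d s) (/ d / s)).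
  - now apply Rmin_glb_lt.
  - intros t x Hx. destruct (Hds x Hx) as [A B]. specialize (B _ (Hc t)).
    apply hol2_mult. 2: apply hol2_const. apply hol2_div.
    + apply Cmod_nz. lra.
    + apply (hol2_comp f (fun _ => RtoC 1 * cis t)%C snd). 2: apply hol2_const. 2: apply hol2_snd.
      apply Hf. apply (H _ (Hc t)); auto. now rewrite Cmod_0_minus.
    + apply hol2_minus. apply hol2_const. apply hol2_fst.
  - intros t x Hx. destruct (Hds x Hx) as [A B]. specialize (B _ (Hc t)).
    rewrite Cmod_mult, Hc, Rmult_1_r, Cmod_div by (apply Cmod_nz; lra).
    apply Rmult_le_compat. apply Cmod_ge_0. left; apply Rinv_0_lt_compat; lra.
    apply (H _ (Hc t)); auto. now rewrite Cmod_0_minus. apply Rinv_le_contravar; lra.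
  - intros x Hx t. destruct (Hds x Hx) as [A B]. specialize (B _ (Hc t)).
    assert (Cc : cts (fun t => RtoC 1 * cis t)%C t)
      by (apply (cts_mult (fun _ => RtoC 1)); [apply continuous_const | apply cts_cis]).
    apply (cts_mult (fun t => f (RtoC 1 * cis t, snd x) / (RtoC 1 * cis t - fst x))%C); auto.
    apply (cts_div (fun t => f (RtoC 1 * cis t, snd x))%C (fun t => RtoC 1 * cis t - fst x)%C).
    + apply Cmod_nz. lra.
    + apply (cts_hol2 f (fun t => RtoC 1 * cis t)%C (fun _ => snd x)); auto. 2: apply continuous_const.
      apply Hf. apply (H _ (Hc t)); auto. now rewrite Cmod_0_minus.
    + apply (cts_minus (fun t => RtoC 1 * cis t)%C (fun _ => fst x)); auto. apply continuous_const.
Qed.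

Hypothesis Hmom : forall w n, Cmod w < 1 -> J (fun z => f (z, w) * z ^ n)%C 1 = 0.

(** In a thin annulus [f (., w)] is the Cauchy integral over the unit circle minus the one over a
    smaller circle. The moments keep their value 0 when moved to the smaller circle, so the second
    integral vanishes outside that circle. *)
Lemma hartogs_ext_eq w0 : Cmod w0 < 1 -> exists d, 0 < d /\ forall z w : C,
  1 - d < Cmod z < 1 -> Cmod (w - w0) < d -> hartogs_ext f (z, w) = f (z, w).
Proof.
  intros Hw0. destruct (circle_nbhd _ Hw0) as [d [Hd H]].
  (* Besides staying in the tube, [/ 2] keeps the annulus away from 0, so that [y / Cmod y] is
     defined, and [1 - Cmod w0] keeps [w] in the unit disc. *)
  set (d' := Rmin (Rmin d (/ 2)) (1 - Cmod w0)). assert (B0 : d' <= Rmin d (/ 2)) by apply Rmin_l.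
  assert (B1 : d' <= d) by (eapply Rle_trans; [exact B0 | apply Rmin_l]).
  assert (B2 : d' <= / 2) by (eapply Rle_trans; [exact B0 | apply Rmin_r]).
  assert (B3 : d' <= 1 - Cmod w0) by apply Rmin_r.
  assert (Hd' : 0 < d') by (repeat apply Rmin_glb_lt; lra).
  exists d'. split; auto. intros z w Hz Hww.
  assert (Hw : Cmod w < 1) by (generalize (Cmod_rev_tri w w0); lra).
  assert (Hh : forall y, 1 - d' < Cmod y <= 1 -> hol1 (fun y => f (y, w)) y).
  { intros y Hy. apply (hol1_hol2 f (fun y => y) (fun _ => w)). 2: apply hol1_id. 2: apply hol2_const.
    assert (Hyn : RtoC (Cmod y) <> 0) by (apply RtoC_nz; lra).
    apply Hf, (H (y / RtoC (Cmod y))%C).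
    - rewrite Cmod_div, Cmod_R, Rabs_pos_eq by (auto; lra). field. lra.
    - replace (y - y / RtoC (Cmod y))%C with (RtoC (Cmod y - 1) * (y / RtoC (Cmod y)))%C by (rewrite RtoC_minus; field; auto).
      rewrite Cmod_mult, Cmod_div, !Cmod_R, (Rabs_pos_eq (Cmod y)), Rabs_left1 by (auto; lra).
      replace (- (Cmod y - 1) * (Cmod y / Cmod y)) with (1 - Cmod y) by (field; lra). lra.
    - lra. }
  set (r := (1 - d' + Cmod z) / 2).
  assert (Hr : 1 - d' < r < Cmod z) by (unfold r; lra).
  assert (Z : J (fun y => f (y, w) / (y - z))%C r = 0).
  { apply (J_kernel_zero_moments (fun y => f (y, w))). lra.
    - intros y Hy. apply hol1_cts, Hh. lra.
    - intros n. rewrite (J_const_hol _ r 1). now apply Hmom. lra.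
      intros y Hy. apply (hol2_mult (fun x => f (fst x, w)) (fun x => fst x ^ n)%C (y, RtoC 0)).
      apply Hh; lra. apply hol2_pow, hol2_fst. }
  assert (E := cauchy_annulus (fun y => f (y, w)) z r 1 ltac:(lra) ltac:(lra) ltac:(intros; apply Hh; lra)).
  cbv beta in E. rewrite Z in E. apply Ceq_minus in E. unfold hartogs_ext. simpl. rewrite E.
  assert (Hp := two_PI_pos). rewrite Cmult_assoc, <- RtoC_mult, Rinv_l by lra. apply Cmult_1_l.
Qed.

End Extension.

(** * Gluing along the unit circle *)

Theorem theorem1p2
  (F : C -> C)
  (F_cont : continuous_on closed_unit_disc F)
  (F_sup : Rbar_lt (sup_mod unit_circle F) 1)
  (F_fourier : forall j : Z, (j < 0)%Z ->
     forall r : R, 0 < r <= 1 -> fourier_coef F j r = RtoC 0)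
  (Omega1 : C * C -> Prop)
  (Omega1_open : open Omega1)
  (Omega1_nbhd : incl (union (graph F) (setprod unit_circle unit_disc)) Omega1)
  (Omega2 : C * C -> Prop)
  (Omega2_open : open Omega2)
  (Omega2_connected : connected Omega2)
  (Omega2_sub : incl Omega2 (setprod Cfull unit_disc))
  (Omega2_lower : incl (setprod unit_circle unit_disc)
     (inter (closure Omega2) (setprod Cfull unit_disc)))
  (Omega2_upper : incl (inter (closure Omega2) (setprod Cfull unit_disc))
     (inter Omega1 (setprod exterior unit_disc)))
  (f : C * C -> C)
  (f_hol : holomorphic_on Omega1 f) :
  exists (W : C * C -> Prop) (g : C * C -> C),
    open W /\
    incl (union (setprod closed_unit_disc unit_disc) Omega2) W /\
    holomorphic_on W g /\
    (forall p : C * C, Omega2 p -> g p = f p).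
Proof.
  assert (HO : eps_open Omega1) by (intros p Hp; apply locally_CC_eps; now apply Omega1_open).
  assert (Hf : forall x, Omega1 x -> hol2 f x) by (intros x Hx; apply hol2_ex_filterdiff; now apply f_hol).
  assert (HOc : forall z w, Cmod z = 1 -> Cmod w < 1 -> Omega1 (z, w)).
  { intros z w Hz Hw. apply Omega1_nbhd. right. now split. }
  assert (Fc : forall z, Cmod z <= 1 -> forall e, 0 < e -> exists d, 0 < d /\
    forall y, Cmod y <= 1 -> Cmod (y - z) < d -> Cmod (F y - F z) < e).
  { intros z Hz e He. specialize (F_cont z Hz (fun y => Cmod (y - F z) < e)).
    destruct (proj1 (locally_C_eps _ _) (F_cont (proj2 (locally_C_eps _ _) (ex_intro _ e (conj He (fun y Hy => Hy)))))) as [d [Hd H]].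
    exists d. split; auto. }
  assert (Ff : forall j : Z, (j < 0)%Z -> forall r : R, 0 < r <= 1 ->
    CI (fun t => F (RtoC r * cis t) * cis (- (IZR j * t)))%C 0 (2 * PI) = 0).
  { intros j Hj r Hr. specialize (F_fourier j Hj r Hr). unfold fourier_coef in F_fourier.
    fold (CI (fun t => F (RtoC r * cis t) * cis (- (IZR j * t)))%C 0 (2 * PI)) in F_fourier.
    assert (Hp := two_PI_pos). set (X := CI _ _ _) in *.
    replace X with (RtoC (2 * PI) * (RtoC (/ (2 * PI)) * X))%C. rewrite F_fourier. ring.
    rewrite Cmult_assoc, <- RtoC_mult, Rinv_r by lra. ring. }
  destruct (graph_nbhd F Omega1 Fc HO) as [dl [Hdl Hnear]].
  { intros z Hz. apply Omega1_nbhd. left. now split. }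
  (* The supremum itself serves as [rho]: [F_sup] excludes plus infinity, and the point 1 of the
     circle excludes minus infinity. *)
  assert (Hrho : exists rho, rho < 1 /\ forall z, Cmod z = 1 -> Cmod (F z) <= rho).
  { destruct (Lub_Rbar_correct (fun x => exists z, unit_circle z /\ x = Cmod (F z))) as [Hub _].
    change (Lub_Rbar _) with (sup_mod unit_circle F) in Hub.
    assert (Hub' : forall z, Cmod z = 1 -> Rbar_le (Cmod (F z)) (sup_mod unit_circle F)) by (intros z Hz; apply Hub; exists z; now split).
    destruct (sup_mod unit_circle F) as [rho| |]; simpl in F_sup; try easy.
    - now exists rho.
    - now elim (Hub' (RtoC 1) Cmod_1). }
  destruct Hrho as [rho [Hrho HFr]].
  assert (Hmom := moments_vanish F Fc Ff Omega1 dl HO Hdl Hnear f rho Hrho HFr HOc Hf).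
  set (W := fun x : C * C => Cmod (snd x) < 1 /\ (Cmod (fst x) < 1 \/ (1 <= Cmod (fst x) /\ Omega1 x))).
  (* The two formulas agree on the inner side of the circle by [hartogs_ext_eq], so near a point of
     the circle [g] is just [f]. *)
  set (g := fun x => if Rlt_dec (Cmod (fst x)) 1 then hartogs_ext f x else f x).
  (* [Omega2] lies in its own closure, hence in [Omega1] and over the exterior, where [g] is [f] by
     definition. *)
  assert (HO2 : forall p, Omega2 p -> W p /\ 1 <= Cmod (fst p)).
  { intros p Hp. destruct (Omega2_upper p) as [H1 [H2 H3]].
    - split. intros P HP. exists p. split; auto. now apply locally_singleton. now apply Omega2_sub.
    - split; auto. split; auto. }
  assert (Dfst : forall x p, Cmod (fst x - fst p) <= dist x p).
  { intros x p. unfold dist. generalize (Cmod_ge_0 (snd x - snd p)). lra. }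
  assert (Dsnd : forall x p, Cmod (snd x - snd p) <= dist x p).
  { intros x p. unfold dist. generalize (Cmod_ge_0 (fst x - fst p)). lra. }
  exists W, g. split; [|split; [|split]].
  - intros p [Hw Hp]. apply (proj2 (locally_CC_eps p W)). change (C * C)%type in p.
    assert (Hs : forall x, dist x p < 1 - Cmod (snd p) -> Cmod (snd x) < 1).
    { intros x Hx. generalize (Dsnd x p) (Cmod_rev_tri (snd x) (snd p)). lra. }
    destruct Hp as [Hz|[Hz HOp]].
    + exists (Rmin (1 - Cmod (snd p)) (1 - Cmod (fst p))). split. apply Rmin_glb_lt; lra.
      intros x Hx. assert (X1 := Rlt_le_trans _ _ _ Hx (Rmin_l _ _)). assert (X2 := Rlt_le_trans _ _ _ Hx (Rmin_r _ _)).
      split; auto. left. generalize (Dfst x p) (Cmod_rev_tri (fst x) (fst p)). lra.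
    + destruct (HO p HOp) as [d [Hd H]].
      exists (Rmin (1 - Cmod (snd p)) d). split. apply Rmin_glb_lt; lra.
      intros x Hx. assert (X1 := Rlt_le_trans _ _ _ Hx (Rmin_l _ _)). assert (X2 := Rlt_le_trans _ _ _ Hx (Rmin_r _ _)).
      split; auto. destruct (Rlt_le_dec (Cmod (fst x)) 1); auto.
  - intros p [[Hz Hw]|Hp]. 2: now apply HO2.
    split; auto. destruct Hz as [Hz|Hz]; auto. right. split. lra. destruct p. now apply HOc.
  - intros p [Hw Hp]. apply (hol2_ex_filterdiff g p).
    destruct (Rtotal_order (Cmod (fst p)) 1) as [Hz|[Hz|Hz]].
    + apply (hol2_ext (hartogs_ext f) g p (1 - Cmod (fst p))). lra.
      * intros x Hx. unfold g. destruct (Rlt_dec (Cmod (fst x)) 1) as [|Hn]; auto. elim Hn.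
        generalize (Dfst x p) (Cmod_rev_tri (fst x) (fst p)). lra.
      * now apply (hartogs_ext_hol Omega1).
    + destruct (hartogs_ext_eq Omega1 f HO Hf HOc Hmom (snd p) Hw) as [d [Hd H]].
      apply (hol2_ext f g p d); auto.
      * intros x Hx. unfold g. destruct (Rlt_dec (Cmod (fst x)) 1) as [Hx1|]; auto.
        rewrite (surjective_pairing x). symmetry. apply H.
        -- generalize (Dfst x p) (Cmod_rev_tri (fst p) (fst x)). rewrite (Cmod_minus_sym (fst p)). lra.
        -- generalize (Dsnd x p). lra.
      * apply Hf. destruct Hp as [Hp|[_ Hp]]; auto. lra.
    + apply (hol2_ext f g p (Cmod (fst p) - 1)). lra.
      * intros x Hx. unfold g. destruct (Rlt_dec (Cmod (fst x)) 1) as [Hx1|]; auto. exfalso.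
        generalize (Dfst x p) (Cmod_rev_tri (fst p) (fst x)). rewrite (Cmod_minus_sym (fst p)). lra.
      * apply Hf. destruct Hp as [Hp|[_ Hp]]; auto. lra.
  - intros p Hp. destruct (HO2 p Hp) as [_ Hz]. unfold g. destruct (Rlt_dec (Cmod (fst p)) 1); auto. lra.
Qed.
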